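(* Let $P$ be a contact plane in $H_1$, and let $P_+$ and $P_-$ be the upper and lower (open) halfspaces determined by $P$. Suppose that $\Sigma$ is a $C^2$ smooth, connected, complete, immersed p-minimal surface contained in $P_+$ (or contained in $P_-$). Then $\Sigma$ is a contact plane parallel to $P$.
   Context: The Heisenberg group $H_1$ is identified with $\mathbb{R}^3$ (coordinates $x,y,z$), with contact form $\Theta=dz+x\,dy-y\,dx$. The contact plane past $p=(x_0,y_0,z_0)$ is the affine plane through $p$ with direction $\ker\Theta_p$, i.e. $\{z=z_0+y_0x-x_0y\}$; a contact plane is a plane of this form. For such $P$, $H_1\setminus P=P_+\cup P_-$ with $P_+=\{z>z_0+y_0x-x_0y\}$ (upper halfspace) and $P_-=\{z<z_0+y_0x-x_0y\}$ (lower halfspace). For a $C^2$ (immersed) surface $\Sigma$ in $H_1$, a point $p$ is singular if $T_p\Sigma=\ker\Theta_p$. On the nonsingular part, $T\Sigma\cap\ker\Theta$ is a line field, whose integral curves are called characteristic curves. $\Sigma$ is p-minimal if its p-mean curvature vanishes at all nonsingular points, i.e. the $xy$-projections of the characteristic curves have zero curvature; for a graph $z=u(x,y)$ this is the equation $\mathrm{div}\big((\nabla u+\vec F)/|\nabla u+\vec F|\big)=0$, $\vec F=(-y,x)$, where $\nabla u+\vec F\ne0$. An immersed surface is the image of a $C^2$ immersion of a 2-manifold; connected means that the domain of the immersion is connected; complete means complete with respect to the metric induced from the Euclidean metric of $\mathbb{R}^3$. *)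

(* Defs.v *)
From mathcomp Require Import all_boot all_order all_algebra.
From mathcomp Require Import ring lra.
From mathcomp Require Import all_classical all_reals all_analysis.

Set Implicit Arguments.
Unset Strict Implicit.
Unset Printing Implicit Defensive.

Import Order.TTheory GRing.Theory Num.Theory.
Import numFieldNormedType.Exports.

Local Open Scope classical_set_scope.
Local Open Scope ring_scope.

Section HeisenbergGroup.
Context {R : realType}.
Implicit Types p q v w : 'rV[R]_3.

Definition xco p : R := p 0 0.
Definition yco p : R := p 0 1.
Definition zco p : R := p 0 ord_max.

(* The contact form dz + x dy - y dx at the point p, applied to v. *)
Definition Theta p v : R := zco v + xco p * yco v - yco p * xco v.

Definition contact_plane p : set 'rV[R]_3 :=
  [set q | zco q = zco p + yco p * xco q - xco p * yco q].

Definition upper_halfspace p : set 'rV[R]_3 :=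
  [set q | zco q > zco p + yco p * xco q - xco p * yco q].

Definition lower_halfspace p : set 'rV[R]_3 :=
  [set q | zco q < zco p + yco p * xco q - xco p * yco q].

Lemma contact_planeE p : contact_plane p = [set q | Theta p (q - p) = 0].
Proof.
apply/seteqP; split=> q /=;
  rewrite /contact_plane /Theta /xco /yco /zco /= !mxE.
- by move=> ->; ring.
- by move=> h; lra.
Qed.

Definition parallel (P Q : set 'rV[R]_3) : Prop :=
  exists v, P = [set q + v | q in Q].

(* The norm of the normed module ['rV[R]_3] is the sup norm. *)
Definition euclidean_norm v : R := Num.sqrt (\sum_(i < 3) v 0 i ^+ 2).

End HeisenbergGroup.

Section Surfaces.
Context {R : realType}.

(* Class C^k on an open set U. *)
Fixpoint Ck_on (V W : normedModType R) (k : nat) (U : set V) (g : V -> W) :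
    Prop :=
  match k with
  | 0%N => forall x, U x -> {for x, continuous g}
  | k'.+1 => (forall x, U x -> differentiable g x) /\
             (forall v, Ck_on k' U (fun x => 'D_v g x))
  end.

Section Atlas.
Context {M : topologicalType}.

(* [coord] and [param] are only meaningful on [dom] and on its image
   respectively. *)
Record chart := Chart {
  dom : set M;
  coord : M -> 'rV[R]_2;
  param : 'rV[R]_2 -> M }.

Definition cdom (c : chart) : set 'rV[R]_2 := coord c @` dom c.

Definition is_chart (c : chart) : Prop :=
  [/\ open (dom c), open (cdom c),
      (forall m, dom c m -> {for m, continuous (coord c)}),
      (forall u, cdom c u -> {for u, continuous (param c)}) &
      (forall m, dom c m -> param c (coord c m) = m)].

Definition C2_atlas (A : set chart) : Prop :=
  [/\ (forall c, A c -> is_chart c),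
      (forall m, exists2 c, A c & dom c m) &
      (forall c c', A c -> A c' ->
         Ck_on 2 (coord c @` (dom c `&` dom c')) (coord c' \o param c))].

Definition C2_2manifold (A : set chart) : Prop :=
  [/\ hausdorff_space M, @second_countable M & C2_atlas A].

Variables (A : set chart) (f : M -> 'rV[R]_3).

Definition C2_immersion : Prop :=
  forall c, A c -> Ck_on 2 (cdom c) (f \o param c) /\
    (forall u, cdom c u -> injective ('d (f \o param c) u)).

(* The image of T_m M under the differential of f.  The singular set is a
   subset of M, so that distinct sheets through a point of the image are not
   confused. *)
Definition tangent_plane (m : M) : set 'rV[R]_3 :=
  [set w | exists c, [/\ A c, dom c m &
     exists v, w = 'd (f \o param c) (coord c m) v]].

Definition singular (m : M) : Prop :=
  tangent_plane m = [set v | Theta (f m) v = 0].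

(* gamma is of class C^k on the open set I as a curve in M. *)
Definition Ck_curve (k : nat) (I : set R) (gamma : R -> M) : Prop :=
  (forall t, I t -> {for t, continuous gamma}) /\
  (forall c, A c -> Ck_on k (I `&` gamma @^-1` dom c) (coord c \o gamma)).

(* The line field is C^1, so its integral curves have regular C^2
   parametrizations, e.g. by arc length. *)
Definition characteristic_curve (a b : R) (gamma : R -> M) : Prop :=
  Ck_curve 2 `]a, b[ gamma /\
  (forall t, t \in `]a, b[ ->
     let w := derive1 (f \o gamma) t in
     [/\ ~ singular (gamma t), w != 0, tangent_plane (gamma t) w &
         Theta (f (gamma t)) w = 0]).

Definition plane_curvature (x y : R -> R) (t : R) : R :=
  (derive1 x t * derive1 (derive1 y) t - derive1 y t * derive1 (derive1 x) t) /
  Num.sqrt (derive1 x t ^+ 2 + derive1 y t ^+ 2) ^+ 3.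

(* The p-mean curvature at a nonsingular point is the curvature of the
   xy-projection of the characteristic curve through it. *)
Definition p_minimal : Prop :=
  forall (a b : R) (gamma : R -> M), characteristic_curve a b gamma ->
  forall t, t \in `]a, b[ ->
    plane_curvature (xco \o f \o gamma) (yco \o f \o gamma) t = 0.

Definition curve_length (gamma : R -> M) : \bar R :=
  (\int[lebesgue_measure]_(t in `[0%R, 1%R])
     (euclidean_norm (derive1 (f \o gamma) t))%:E)%E.

(* Distance of the metric induced from the Euclidean one.  Curves need not be
   regular, so C^1 curves (restricted to [0, 1]) give the same infimum as
   piecewise C^1 ones. *)
Definition induced_dist (m m' : M) : \bar R :=
  ereal_inf [set curve_length gamma | gamma in
    [set gamma : R -> M |
       [/\ Ck_curve 1 setT gamma, gamma 0 = m & gamma 1 = m']]].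

Definition complete_surface : Prop :=
  forall u : nat -> M,
    (forall e : R, 0 < e -> exists N, forall i j, (N <= i)%N -> (N <= j)%N ->
       (induced_dist (u i) (u j) < e%:E)%E) ->
  exists m : M, forall e : R, 0 < e -> exists N, forall i, (N <= i)%N ->
    (induced_dist (u i) m < e%:E)%E.

End Atlas.
End Surfaces.

Arguments chart R M : clear implicits.

(* Main.v *)
From HB Require Import structures.
Require Import Defs.
From mathcomp Require Import all_boot all_order all_algebra.
From mathcomp Require Import ring lra.
From mathcomp Require Import all_classical all_reals all_analysis.
From mathcomp Require Import measurable_realfun.

(** Write [h] for the function [Theta p] on the space: it is linear, its level
    sets are the planes parallel to the contact plane of [p], and the latter is
    the level [zco p].  The surface lies on one side of it, so that [h] does not
    take the value [zco p] on the surface.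

    P-minimality makes the characteristic curves straight segments
    ([nonsingular_lift]).  They extend to complete lines ([characteristic_line]):
    a bounded piece has an end point by completeness ([lift_limit]); at a
    nonsingular end point the next segment takes over, and a line that arrives
    at a singular point leaves it in the same direction.  This last fact is the
    core of the argument.  Near a singular point the surface is a graph over a
    contact plane, and its characteristic lines are the null lines of a plane
    field with nonzero curl.  Since the null lines are straight and cannot cross
    away from the zeros of the field, elementary planar geometry shows first
    that the zero is transversal to the arriving line ([arrival_transversal]),
    then that the opposite ray is again a null line ([departure]).

    Along a complete line the function [h] is affine and would take the value
    [zco p] unless it were constant.  Hence characteristic directions are horizontal for
    the contact form at their own point and for the one at [p]; the only such
    direction is radial with respect to the vertical axis through [p], so that
    the radial field is tangent to the surface everywhere ([radial_tangent]).
    At a point of the axis the tangent plane is the direction of the contact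
    plane of [p]: otherwise either rays give another tangent plane, or the axis
    is contained in the surface and meets the level [zco p] ([axis_singular]).

    The radial line through a nonsingular point reaches the axis.  There [h] is
    locally constant on the surface, because it is constant on rays; this
    property propagates back along the line ([level_back]), so that it holds at
    all nonsingular points.  These are dense ([nonsingular_dense]), hence every
    tangent plane is parallel to the contact plane of [p], and [h] is constant by
    connectedness ([height_constant]).  Finally, lines of the plane
    containing the surface lift through every point and are complete, so that
    the whole plane is covered ([plane_swept]).

    The surface is immersed, so that all curves are followed in the manifold and
    not in space.  The local tool is a graph chart over any frame adapted to the
    tangent plane ([local_graph]), given by the inverse function theorem; lifts
    of lines are unique in such a chart, and the induced distance controls the
    sheet in which a short curve lies ([dist_near]). *)

Set Implicit Arguments.
Unset Strict Implicit.
Unset Printing Implicit Defensive.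

Import Order.TTheory GRing.Theory Num.Theory.
Import numFieldNormedType.Exports.

Local Open Scope classical_set_scope.
Local Open Scope ring_scope.

Local Notation coord := Defs.coord.


(** * Functions of class C^k *)

Section Differentiability.
Context {R : realType}.
Implicit Types V W : normedModType R.

Lemma differentiable_eps V W (f : V -> W) x (L : {linear V -> W}) :
  continuous L ->
  (forall e, 0 < e -> \forall h \near (0 : V), `|f (h + x) - f x - L h| <= e * `|h|) ->
  differentiable f x /\ 'd f x = L :> (V -> W).
Proof.
move=> cL H.
have E : f \o shift x = cst (f x) + L +o_ (0 : V) id.
  apply/eqaddoP => e e0; near=> h.
  by rewrite /= opprD addrA; near: h; exact: H.
have dL := diff_unique cL E.
split => //; apply/diff_locallyP; split.
  by rewrite dL.
by rewrite [X in cst _ + X](_ : _ = L :> (V -> W)).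
Unshelve. all: by end_near. Qed.

Lemma differentiable_epsE V W (f : V -> W) x : differentiable f x ->
  forall e, 0 < e -> \forall h \near (0 : V), `|f (h + x) - f x - 'd f x h| <= e * `|h|.
Proof.
move=> /diff_locallyP[_ /eqaddoP H] e /H; apply: filterS => h.
by rewrite /= opprD addrA.
Qed.

Lemma near_eq_differentiable V W (f g : V -> W) x : {near x, f =1 g} ->
  differentiable f x -> differentiable g x.
Proof.
move=> fg df; have fgx := nbhs_singleton fg.
have [] // := @differentiable_eps _ _ g x ('d f x).
  exact: diff_continuous.
move=> e e0.
move: fg => /nbhs0P fg; near=> h.
rewrite -fgx -(_ : f (h + x) = g (h + x)).
  by near: h; exact: differentiable_epsE.
by rewrite addrC; near: h.
Unshelve. all: by end_near. Qed.

Lemma diff_rV n W (g : 'rV[R]_n -> W) u d : differentiable g u ->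
  'd g u d = \sum_(i < n) d 0 i *: 'D_('e_i) g u.
Proof.
move=> dg; rewrite [in LHS](row_sum_delta d) linear_sum.
by apply: eq_bigr => i _; rewrite linearZ/= -deriveE.
Qed.

Lemma differentiable_entry V n (g : V -> 'rV[R]_n) x i :
  differentiable g x -> differentiable (fun x => g x 0 i) x.
Proof.
move=> dg; apply: (@differentiable_comp _ _ _ _ g (fun v : 'rV[R]_n => v 0 i)) => //.
exact: differentiable_coord.
Qed.

Lemma diff_entry V n (g : V -> 'rV[R]_n) x i v :
  differentiable g x -> 'd (fun x => g x 0 i) x v = ('d g x v) 0 i.
Proof.
move=> dg; rewrite -!deriveE//; last exact: differentiable_entry.
by rewrite derive_mx ?mxE//; exact: diff_derivable.
Qed.

End Differentiability.

Section CkAlgebra.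
Context {R : realType}.
Implicit Types V W : normedModType R.

Lemma Ck_on_eq V W k (U : set V) (g1 g2 : V -> W) : open U ->
  (forall x, U x -> g1 x = g2 x) -> Ck_on k U g1 -> Ck_on k U g2.
Proof.
move=> oU; elim: k W g1 g2 => [|k IH] W g1 g2 E /=.
  move=> H x Ux; have := H x Ux; rewrite /prop_for /continuous_at (E _ Ux).
  apply: cvg_trans; apply: near_eq_cvg.
  by have := open_nbhs_nbhs (conj oU Ux); apply: filterS => y; exact: E.
have nE x : U x -> {near x, g1 =1 g2}.
  by move=> Ux; have := open_nbhs_nbhs (conj oU Ux); apply: filterS => y; exact: E.
move=> [H1 H2]; split=> [x Ux|v].
  exact: near_eq_differentiable (nE x Ux) (H1 x Ux).
by apply: IH (H2 v) => x Ux; apply: near_eq_derive; exact: nE.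
Qed.

Lemma Ck_on_sub V W k (U U' : set V) (g : V -> W) : U `<=` U' ->
  Ck_on k U' g -> Ck_on k U g.
Proof.
move=> UU'; elim: k W g => [|k IH] W g /=; first by move=> H x /UU'; exact: H.
by move=> [H1 H2]; split=> [x Ux|v]; [exact/H1/UU'|exact/IH/H2].
Qed.

(** Because derivatives are taken in the ambient space, [Ck_on] only looks at
    the germs of the function at the points of the set; this is what makes it
    a local notion. *)
Lemma Ck_on_pointwise V W k (U : set V) (g : V -> W) :
  (forall x, U x -> Ck_on k [set x] g) -> Ck_on k U g.
Proof.
elim: k W g => [|k IH] W g /= H; first by move=> x Ux; exact: (H x Ux x).
split=> [x Ux|v]; first exact: (proj1 (H x Ux) x).
by apply: IH => x Ux; exact: (proj2 (H x Ux) v).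
Qed.

Lemma Ck_on_local V W k (U : set V) (g : V -> W) :
  (forall x, U x -> exists2 O, open O & O x /\ Ck_on k O g) -> Ck_on k U g.
Proof.
move=> H; apply: Ck_on_pointwise => x /H [D oD [Dx HD]].
by apply: (Ck_on_sub _ HD) => _ ->.
Qed.

Lemma Ck_on_pred V W k (U : set V) (g : V -> W) :
  Ck_on k.+1 U g -> Ck_on k U g.
Proof.
elim: k W g => [|k IH] W g.
  by move=> [H _] x Ux; apply/differentiable_continuous/H.
by move=> [H1 H2]; split => // v; apply: IH; exact: H2.
Qed.

Lemma Ck_on0 V W k (U : set V) (g : V -> W) :
  Ck_on k U g -> forall x, U x -> {for x, continuous g}.
Proof. by elim: k => [//|k IH] H; apply: IH; exact: Ck_on_pred H. Qed.

Lemma Ck_on_cst V W k (U : set V) (c : W) : Ck_on k U (fun _ : V => c).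
Proof.
elim: k c => [|k IH] c /=; first by move=> x _; exact: cst_continuous.
split=> [x _|v]; first exact: differentiable_cst.
have -> : (fun x => 'D_v (fun _ : V => c) x) = (fun=> 0); last exact: IH.
by apply/funext => x; rewrite (derive_cst c).
Qed.

Lemma Ck_on_linear V W k (U : set V) (L : {linear V -> W}) :
  continuous L -> Ck_on k U L.
Proof.
case: k => [|k] cL /=; first by move=> x _; exact: cL.
split=> [x _|v]; first exact: linear_differentiable.
have -> : (fun x => 'D_v L x) = (fun=> L v); last exact: Ck_on_cst.
by apply/funext => x; rewrite deriveE ?diff_lin//; exact: linear_differentiable.
Qed.

Lemma Ck_onD V W k (U : set V) (g1 g2 : V -> W) : open U ->
  Ck_on k U g1 -> Ck_on k U g2 -> Ck_on k U (fun x => g1 x + g2 x).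
Proof.
move=> oU; elim: k g1 g2 => [|k IH] g1 g2 /=.
  by move=> H1 H2 x Ux; apply: continuousD; [exact: H1|exact: H2].
move=> [H1 K1] [H2 K2]; split=> [x Ux|v].
  by apply: differentiableD; [exact: H1|exact: H2].
apply: (Ck_on_eq oU _ (IH _ _ (K1 v) (K2 v))) => // x Ux.
by rewrite -deriveD//; apply: diff_derivable; [exact: H1|exact: H2].
Qed.

Lemma Ck_onZl V W k (U : set V) (g1 : V -> R) (w : W) : open U ->
  Ck_on k U g1 -> Ck_on k U (fun x => g1 x *: w).
Proof.
move=> oU; elim: k g1 => [|k IH] g1 /=.
  by move=> H1 x Ux; rewrite /prop_for /continuous_at; apply: cvgZr_tmp; exact: H1.
move=> [H1 K1]; split=> [x Ux|v].
  by apply: differentiableZl; exact: H1.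
apply: (Ck_on_eq oU _ (IH _ (K1 v))) => // x Ux.
rewrite [RHS]deriveE ?diffZl ?deriveE//; try exact: H1.
by apply: differentiableZl; exact: H1.
Qed.

Lemma Ck_onM V k (U : set V) (g1 g2 : V -> R) : open U ->
  Ck_on k U g1 -> Ck_on k U g2 -> Ck_on k U (fun x => g1 x * g2 x).
Proof.
move=> oU; elim: k g1 g2 => [|k IH] g1 g2 /=.
  by move=> H1 H2 x Ux; apply: continuousM; [exact: H1|exact: H2].
move=> H1' H2'; have G1 := Ck_on_pred H1'; have G2 := Ck_on_pred H2'.
move: H1' H2' => [H1 K1] [H2 K2]; split=> [x Ux|v].
  by apply: differentiableM; [exact: H1|exact: H2].
apply: (Ck_on_eq oU _ (Ck_onD oU (IH _ _ G1 (K2 v)) (IH _ _ G2 (K1 v)))) => // x Ux.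
by rewrite [RHS]deriveM//; apply: diff_derivable; [exact: H1|exact: H2].
Qed.

Lemma Ck_onN V k (U : set V) (g1 : V -> R) : open U ->
  Ck_on k U g1 -> Ck_on k U (fun x => - g1 x).
Proof.
move=> oU H1; apply: (Ck_on_eq oU _ (Ck_onM oU (Ck_on_cst k U (-1 : R)) H1)) => // x _.
by rewrite mulN1r.
Qed.

Lemma Ck_onB V k (U : set V) (g1 g2 : V -> R) : open U ->
  Ck_on k U g1 -> Ck_on k U g2 -> Ck_on k U (fun x => g1 x - g2 x).
Proof. by move=> oU H1 H2; apply: Ck_onD => //; exact: Ck_onN. Qed.

Lemma Ck_onV V k (U : set V) (g : V -> R) : open U ->
  (forall x, U x -> g x != 0) ->
  Ck_on k U g -> Ck_on k U (fun x => (g x)^-1).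
Proof.
move=> oU g0; elim: k => [|k IH] /=.
  by move=> H x Ux; apply: cvgV; [exact: g0|exact: H].
move=> H'; have G := IH (Ck_on_pred H').
move: H' => [H K]; split=> [x Ux|v].
  by apply: differentiableV; [exact: H|exact: g0].
have C := Ck_onN oU (Ck_onM oU (Ck_onM oU G G) (K v)).
apply: (Ck_on_eq oU _ C) => // x Ux.
rewrite [RHS]deriveV ?g0//; last by apply: diff_derivable; exact: H.
by rewrite -exprVn expr2 scaleNr.
Qed.

Lemma Ck_on_sum V W k (U : set V) I (r : seq I) (P : pred I) (g : I -> V -> W) :
  open U -> (forall i, Ck_on k U (g i)) ->
  Ck_on k U (fun x => \sum_(i <- r | P i) g i x).
Proof.
move=> oU H; elim: r => [|i r IH].
  by apply: (Ck_on_eq oU _ (Ck_on_cst k U (0 : W))) => x _; rewrite big_nil.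
case Pi: (P i).
  apply: (Ck_on_eq oU _ (Ck_onD oU (H i) IH)) => x _.
  by rewrite big_cons Pi.
by apply: (Ck_on_eq oU _ IH) => x _; rewrite big_cons Pi.
Qed.

Lemma Ck_on_rV V n k (U : set V) (g : V -> 'rV[R]_n) : open U ->
  (forall i, Ck_on k U (fun x => g x 0 i)) -> Ck_on k U g.
Proof.
move=> oU H.
have C := Ck_on_sum (index_enum 'I_n) predT oU
  (fun i => Ck_onZl ('e_i : 'rV[R]_n) oU (H i)).
by apply: (Ck_on_eq oU _ C) => x _; rewrite -row_sum_delta.
Qed.

Lemma Ck_on_entry V n k (U : set V) (g : V -> 'rV[R]_n) i : open U ->
  Ck_on k U g -> Ck_on k U (fun x => g x 0 i).
Proof.
move=> oU; elim: k g => [|k IH] g /=.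
  move=> H x Ux.
  exact: (@continuous_comp _ _ _ g (fun v : 'rV[R]_n => v 0 i) x (H x Ux) (@coord_continuous R 1 n 0 i (g x))).
move=> [H K]; split=> [x Ux|v]; first exact/differentiable_entry/H.
apply: (Ck_on_eq oU _ (IH _ (K v))) => // x Ux.
rewrite !deriveE ?diff_entry//; try exact: H.
exact/differentiable_entry/H.
Qed.

Lemma Ck_on_comp V n k (U : set V) (O : set 'rV[R]_n) (h : V -> 'rV[R]_n)
    (g : 'rV[R]_n -> R) : open U -> (forall x, U x -> O (h x)) ->
  Ck_on k U h -> Ck_on k O g -> Ck_on k U (g \o h).
Proof.
move=> oU hUO; elim: k g => [|k IH] g /=.
  move=> H K x Ux; apply: continuous_comp; [exact: H|exact/K/hUO].
move=> H' K'; have Hp := Ck_on_pred H'.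
move: H' K' => [H1 H2] [K1 K2]; split=> [x Ux|v].
  apply: differentiable_comp; [exact: H1|exact/K1/hUO].
pose t i x := 'D_v h x 0 i * 'D_('e_i) g (h x).
have C : Ck_on k U (fun x => \sum_(i < n) t i x).
  apply: Ck_on_sum => // i; apply: Ck_onM => //.
    exact: Ck_on_entry.
  exact: (IH _ Hp (K2 _)).
apply: (Ck_on_eq oU _ C) => // x Ux.
have dh := H1 x Ux; have dg := K1 _ (hUO x Ux).
rewrite [RHS]deriveE; last exact: differentiable_comp.
rewrite diff_comp//= diff_rV//; apply: eq_bigr => i _.
by rewrite /t deriveE.
Qed.

Lemma Ck_on_comp_rV V n p k (U : set V) (O : set 'rV[R]_n) (h : V -> 'rV[R]_n)
    (g : 'rV[R]_n -> 'rV[R]_p) : open U -> open O -> (forall x, U x -> O (h x)) ->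
  Ck_on k U h -> Ck_on k O g -> Ck_on k U (g \o h).
Proof.
move=> oU oO hUO Hh Hg; apply: Ck_on_rV => // i.
exact: (Ck_on_comp (g := fun u => g u 0 i) oU hUO Hh (Ck_on_entry i oO Hg)).
Qed.

End CkAlgebra.

(** * Mean value and strict differentiability *)

Section MeanValue.
Context {R : realType}.
Implicit Types V : normedModType R.

Lemma segment_MVT V (g : V -> R) (a d : V) :
  (forall t : R, 0 <= t <= 1 -> differentiable g (a + t *: d)) ->
  exists2 c : R, 0 < c < 1 & g (a + d) - g a = 'd g (a + c *: d) d.
Proof.
move=> H.
pose s (t : R) := a + t *: d.
have ds t : is_diff (t : R) s ( *:%R^~ d).
  have -> : s = cst a + ( *:%R^~ d) by [].
  rewrite -[X in is_diff _ _ X]add0r.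
  exact: is_diffD.
have dst t : differentiable s (t : R) by case: (ds t).
have dgs (t : R) : 0 <= t <= 1 -> is_derive t (1 : R) (g \o s) ('d g (s t) d).
  move=> t01; have dg := H t t01.
  have dc : differentiable (g \o s) t.
    exact: differentiable_comp.
  apply: DeriveDef; first exact: diff_derivable.
  rewrite deriveE// diff_comp//=.
  by rewrite diff_val scale1r.
have [|x|c c01 E] := @MVT R (g \o s) (fun t => 'd g (s t) d) 0 1 ltr01.
- by move=> x; rewrite in_itv/= => /andP[x0 x1]; apply: dgs; rewrite !ltW.
- apply: continuous_in_subspaceT x => x; rewrite inE/= in_itv/= => x01.
  by have [+ _] := dgs x x01 => /derivable1_diffP/differentiable_continuous.
- exists c; first by move: c01; rewrite in_itv.
  by move: E; rewrite /= /s scale1r scale0r addr0 subr0 mulr1.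
Qed.

Lemma segment_constant V (g : V -> R) y v :
  (forall u : R, 0 <= u <= 1 -> differentiable g (y + u *: v)) ->
  (forall u : R, 0 < u < 1 -> 'd g (y + u *: v) v = 0) ->
  g (y + v) = g y.
Proof.
by move=> /segment_MVT[u u01 E] H; apply/subr0_eq; rewrite E; exact: H.
Qed.

Lemma entry_le_norm n (y : 'rV[R]_n) i : `|y 0 i| <= `|y|.
Proof.
rewrite [leRHS]/Num.Def.normr/= mx_normrE.
exact: (le_bigmax _ (fun ij : 'I_1 * 'I_n => `|y ij.1 ij.2|) (0, i)).
Qed.

Lemma norm_rV_le n (y : 'rV[R]_n) (r : R) : 0 <= r ->
  (forall i, `|y 0 i| <= r) -> `|y| <= r.
Proof.
move=> r0 H; rewrite [leLHS]/Num.Def.normr/= mx_normrE.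
by apply: bigmax_le => // -[i j] _; rewrite ord1.
Qed.

Lemma norm_rV_lt n (y : 'rV[R]_n) (r : R) : 0 < r ->
  (forall i, `|y 0 i| < r) -> `|y| < r.
Proof.
move=> r0 H; rewrite [ltLHS]/Num.Def.normr/= mx_normrE.
by apply: bigmax_lt => // -[i j] _; rewrite ord1.
Qed.

Lemma mulmx_norm_le n p (v : 'rV[R]_n) (B : 'M[R]_(n, p)) :
  `|v *m B| <= (n%:R * `|B|) * `|v|.
Proof.
apply: norm_rV_le => [|j]; first by rewrite !mulr_ge0.
rewrite mxE (le_trans (ler_norm_sum _ _ _))//.
apply: (@le_trans _ _ (\sum_(i < n) `|B| * `|v|)).
  apply: ler_sum => i _; rewrite normrM mulrC ler_pM ?entry_le_norm//.
  rewrite [leRHS]/Num.Def.normr/= mx_normrE.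
  exact: (le_bigmax _ (fun ij : 'I_n * 'I_p => `|B ij.1 ij.2|) (i, j)).
by rewrite sumr_const card_ord -[leLHS]mulr_natl mulrA.
Qed.

Lemma C1_near n p (U : set 'rV[R]_n) (Y : 'rV[R]_n -> 'rV[R]_p) u0 (e : R) :
  open U -> U u0 -> Ck_on 1 U Y -> 0 < e ->
  exists2 d : R, 0 < d & forall u, `|u - u0| < d ->
    U u /\ forall v, `|'d Y u v - 'd Y u0 v| <= e * `|v|.
Proof.
move=> oU Uu0 [dY cY] e0.
pose e' := e / n.+1%:R.
have e'0 : 0 < e' by rewrite divr_gt0.
have : \forall u \near u0, U u /\ forall i, `|'D_('e_i) Y u - 'D_('e_i) Y u0| <= e'.
  near=> u; split; first by near: u; exact: open_nbhs_nbhs.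
  near: u; apply: filter_forall => i.
  have cDi : 'D_('e_i) Y u @[u --> u0] --> 'D_('e_i) Y u0 := cY 'e_i u0 Uu0.
  exact: cvgr_distC_le cDi _ e'0.
move=> /nbhs_normP[d /= d0 H]; exists d => // u ud.
have [Uu Hu] : U u /\ forall i, `|'D_('e_i) Y u - 'D_('e_i) Y u0| <= e'.
  by apply: H; rewrite /ball_ /= distrC.
split=> // v.
rewrite [X in X - _](diff_rV v (dY u Uu)) [X in _ - X](diff_rV v (dY u0 Uu0)).
rewrite -sumrB (le_trans (ler_norm_sum _ _ _))//.
apply: (@le_trans _ _ (\sum_(i < n) e' * `|v|)).
  apply: ler_sum => i _; rewrite -scalerBr normrZ mulrC.
  by rewrite ler_pM ?entry_le_norm.
rewrite sumr_const card_ord -[leLHS]mulr_natl mulrA ler_wpM2r//.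
rewrite /e' mulrCA ger_pMr// ler_pdivrMr// mul1r ler_nat leqnSn.
Unshelve. all: by end_near. Qed.

(** Strict differentiability compares two arbitrary points near [u0], which a
    mere derivative at [u0] does not; both the inverse function theorem and
    the study of the zeros of a plane field depend on it. *)
Lemma C1_strict n p (U : set 'rV[R]_n) (Y : 'rV[R]_n -> 'rV[R]_p) u0 (e : R) :
  open U -> U u0 -> Ck_on 1 U Y -> 0 < e ->
  exists2 d : R, 0 < d & forall u u', `|u - u0| < d -> `|u' - u0| < d ->
    `|Y u - Y u' - 'd Y u0 (u - u')| <= e * `|u - u'|.
Proof.
move=> oU Uu0 CY e0; have [dY cY] := CY.
have [d d0 Hd] := C1_near oU Uu0 CY e0.
exists d => // u u' ud u'd.
apply: norm_rV_le => [|j]; first by rewrite mulr_ge0// ltW.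
have seg (t : R) : 0 <= t <= 1 -> `|u' + t *: (u - u') - u0| < d.
  move=> /andP[t0 t1].
  have -> : u' + t *: (u - u') - u0 = (1 - t) *: (u' - u0) + t *: (u - u0).
    by apply/rowP => i; rewrite !mxE; ring.
  apply: (le_lt_trans (ler_normD _ _)).
  rewrite !normrZ !ger0_norm ?subr_ge0//.
  have m : forall x : R, 0 <= x -> x <= 1 -> (1 - t) * `|u' - u0| + t * `|u - u0| <
      (1 - t) * d + t * d -> (1 - t) * `|u' - u0| + t * `|u - u0| < d.
    by move=> *; lra.
  apply: (m 0) => //.
  have [->|tn1] := eqVneq t 1; first by rewrite subrr !mul0r !add0r !mul1r.
  apply: ltr_leD; last by rewrite ler_wpM2l// ltW.
  by rewrite ltr_pM2l// subr_gt0 lt_neqAle tn1.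
have [|c /andP[c0 c1] E] := @segment_MVT _ (fun u => Y u 0 j) u' (u - u').
  by move=> t t01; apply/differentiable_entry/dY; have [] := Hd _ (seg t t01).
have c01 : 0 <= c <= 1 by rewrite !ltW.
have [Uc Hc] := Hd _ (seg c c01).
rewrite subrKC in E.
rewrite !mxE E diff_entry; last exact: dY.
have := entry_le_norm ('d Y (u' + c *: (u - u')) (u - u') - 'd Y u0 (u - u')) j.
by rewrite !mxE => /le_trans; apply; exact: Hc.
Qed.

End MeanValue.

(** * Symmetry of second derivatives *)

Section Chain.
Context {R : realType}.
Implicit Types U V W : normedModType R.

Lemma diff_compE U V W (f : U -> V) (g : V -> W) x v :
  differentiable f x -> differentiable g (f x) ->
  'd (g \o f) x v = 'd g (f x) ('d f x v).
Proof. by move=> df dg; rewrite diff_comp. Qed.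

Lemma diff_translate V W (g : V -> W) c x : differentiable g (x + c) ->
  differentiable (fun u => g (u + c)) x /\
  forall v, 'd (fun u => g (u + c)) x v = 'd g (x + c) v.
Proof.
move=> dg.
have dsh : is_diff x (fun u => u + c) id.
  rewrite -[X in is_diff _ _ X]addr0; exact: is_diffD.
have dshx : differentiable (fun u => u + c) x by case: dsh.
split; first exact: (@differentiable_comp _ _ _ _ (fun u => u + c) g).
move=> v; have E := diff_compE v dshx dg.
rewrite [LHS]E; congr ('d g (x + c) _).
by case: dsh => _ ->.
Qed.

End Chain.

Section Schwarz.
Context {R : realType} {n : nat}.
Implicit Types (u v w x : 'rV[R]_n).

Lemma C1_strict_scalar (U : set 'rV[R]_n) (g : 'rV[R]_n -> R) u0 (e : R) :
  open U -> U u0 -> Ck_on 1 U g -> 0 < e ->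
  exists2 d : R, 0 < d & forall u u', `|u - u0| < d -> `|u' - u0| < d ->
    `|g u - g u' - 'd g u0 (u - u')| <= e * `|u - u'|.
Proof.
move=> oU Uu0 Cg e0.
pose Y u : 'rV[R]_1 := \row_(i < 1) g u.
have Y0 : (fun u => Y u 0 0) = g by apply/funext => u; rewrite mxE.
have CY : Ck_on 1 U Y.
  apply: (@Ck_on_rV R _ 1 1 U Y oU) => i.
  by have -> : (fun u => Y u 0 i) = g by apply/funext => u; rewrite mxE.
have [d d0 Hd] := C1_strict oU Uu0 CY e0; exists d => // u u' ud u'd.
apply: le_trans (Hd u u' ud u'd).
have E : 'd g u0 (u - u') = ('d Y u0 (u - u')) 0 0.
  by rewrite -(diff_entry 0 _ (proj1 CY u0 Uu0)) Y0.
rewrite E; have := entry_le_norm (Y u - Y u' - 'd Y u0 (u - u')) 0.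
by rewrite !mxE.
Qed.

Definition second_difference (g : 'rV[R]_n -> R) x v w (h : R) :=
  g (x + h *: v + h *: w) - g (x + h *: v) - g (x + h *: w) + g x.

(** Two applications of the mean value theorem give the symmetric second
    difference the second derivative as leading term, whichever direction is
    differentiated first; hence the symmetry of second derivatives. *)
Lemma second_differenceP (U : set 'rV[R]_n) (g : 'rV[R]_n -> R) x v w (e : R) :
  open U -> U x -> Ck_on 2 U g -> 0 < e ->
  \forall h \near (0 : R)^'+,
    `|second_difference g x v w h - h ^+ 2 * 'D_w ('D_v g) x| <= h ^+ 2 * (e * `|w|).
Proof.
move=> oU Ux Cg e0; have [dg Cdg] := Cg.
have [d d0 Hd] := C1_strict_scalar oU Ux (Cdg v) e0.
have /nbhs_normP[r /= r0 Hr] := open_nbhs_nbhs (conj oU Ux).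
have HU u : `|u - x| < r -> U u by move=> ur; apply: Hr; rewrite /ball_ /= distrC.
pose m := Num.min d r.
have m0 : 0 < m by rewrite lt_min d0 r0.
near=> h.
have h0 : 0 < h by near: h; exact: nbhs_right_gt.
have hm : h * (1 + `|v| + `|w|) < m.
  have q0 : 0 < 1 + `|v| + `|w| by rewrite -addrA ltr_pwDl// addr_ge0.
  rewrite -ltr_pdivlMr//.
  by near: h; apply: nbhs_right_lt; rewrite divr_gt0.
have close (s t : R) : 0 <= s <= 1 -> 0 <= t <= 1 ->
    `|x + s *: (h *: v) + t *: (h *: w) - x| < m.
  move=> /andP[s0 s1] /andP[t0 t1].
  rewrite -[x + _ + _]addrA [x + _]addrC addrK.
  apply: le_lt_trans hm; apply: (le_trans (ler_normD _ _)).
  rewrite !normrZ (ger0_norm s0) (ger0_norm t0) (ger0_norm (ltW h0)).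
  rewrite -addrA mulrDr mulr1 mulrDr ler_wpDl ?(ltW h0)//.
  by rewrite lerD// ler_piMl ?mulr_ge0// ltW.
have mr u : `|u - x| < m -> `|u - x| < r.
  by move=> /lt_le_trans; apply; rewrite ge_min lexx orbT.
have md u : `|u - x| < m -> `|u - x| < d.
  by move=> /lt_le_trans; apply; rewrite ge_min lexx.
pose k u := g (u + h *: w) - g u.
have dgsh u : U (u + h *: w) -> differentiable (fun u => g (u + h *: w)) u.
  by move=> Uu; have [] := @diff_translate _ _ _ g (h *: w) u (dg _ Uu).
(* the difference in the direction [w] is the increment of [k] along [h *: v] *)
have [|c /andP[c0 c1] E] := @segment_MVT _ _ k x (h *: v).
  move=> t t01; apply: differentiableB.
    apply: dgsh; apply/HU/mr; rewrite -[h *: w]scale1r.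
    by apply: close; rewrite // ler01 lexx.
  apply/dg/HU/mr; have := close t 0 t01; rewrite scale0r addr0; apply.
  by rewrite lexx ler01.
have c01 : 0 <= c <= 1 by rewrite !ltW.
set xi := x + c *: (h *: v) in E.
have xim : `|xi - x| < m.
  by have := close c 0 c01; rewrite scale0r addr0; apply; rewrite lexx ler01.
have xiwm : `|xi + h *: w - x| < m.
  by rewrite -[h *: w]scale1r; apply: close; rewrite // ler01 lexx.
have -> : second_difference g x v w h = h * ('D_v g (xi + h *: w) - 'D_v g xi).
  have -> : second_difference g x v w h = k (x + h *: v) - k x.
    by rewrite /second_difference /k; ring.
  rewrite E /k.
  have Uxi := HU _ (mr _ xim); have Uxiw := HU _ (mr _ xiwm).
  rewrite (diffB (dgsh _ Uxiw) (dg _ Uxi)).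
  have [_ E2] := @diff_translate _ _ _ g (h *: w) xi (dg _ Uxiw).
  rewrite /= [X in X - _]E2.
  rewrite (deriveE v (dg _ Uxi)) (deriveE v (dg _ Uxiw)).
  rewrite mulrBr; congr (_ - _); exact: linearZ.
have := Hd _ _ (md _ xiwm) (md _ xim).
rewrite [xi + _]addrC addrK.
have -> : 'd ('D_v g) x (h *: w) = h * 'D_w ('D_v g) x.
  have [ddv _] := Cdg v.
  by rewrite (deriveE w (ddv x Ux)); exact: linearZ.
rewrite [X in _ <= e * X]normrZ (ger0_norm (ltW h0)) => H.
rewrite -mulrA expr2 -!mulrA -mulrBr normrM (ger0_norm (ltW h0)).
by rewrite ler_pM2l// mulrCA.
Unshelve. all: by end_near. Qed.

Lemma second_differenceC (g : 'rV[R]_n -> R) x v w h :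
  second_difference g x v w h = second_difference g x w v h.
Proof. by rewrite /second_difference [X in g X]addrAC; ring. Qed.

Theorem Schwarz (U : set 'rV[R]_n) (g : 'rV[R]_n -> R) x v w :
  open U -> U x -> Ck_on 2 U g -> 'D_w ('D_v g) x = 'D_v ('D_w g) x.
Proof.
move=> oU Ux Cg.
apply/eqP; rewrite -subr_eq0 -normr_le0; apply/ler_addgt0Pl => e e0.
rewrite addr0.
pose q := `|v| + `|w| + 1.
have q0 : 0 < q by rewrite ltr_wpDl// addr_ge0.
have eq0 : 0 < e / q by rewrite divr_gt0.
have H1 := second_differenceP v w oU Ux Cg eq0.
have H2 := second_differenceP w v oU Ux Cg eq0.
have [h [h0 [K1 K2]]] : exists h : R, 0 < h /\
  (`|second_difference g x v w h - h ^+ 2 * 'D_w ('D_v g) x| <= h ^+ 2 * (e / q * `|w|)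
  /\ `|second_difference g x w v h - h ^+ 2 * 'D_v ('D_w g) x| <= h ^+ 2 * (e / q * `|v|)).
  apply: (@filter_ex _ (0 : R)^'+).
  near=> h; split; first by near: h; exact: nbhs_right_gt.
  by split; near: h.
have h20 : 0 < h ^+ 2 by rewrite exprn_gt0.
rewrite -(ler_pM2l h20) -[X in X * `|_|](ger0_norm (ltW h20)) -normrM mulrBr.
rewrite -(subrKA (second_difference g x v w h)) (le_trans (ler_normD _ _))//.
rewrite distrC [X in _ + `|X - _|]second_differenceC.
apply: (le_trans (lerD K1 K2)).
rewrite -mulrDr ler_pM2l// -mulrDr -mulrA ger_pMr// mulrC ler_pdivrMr// mul1r.
by rewrite /q addrC lerDl.
Unshelve. all: by end_near. Qed.

End Schwarz.

(** * The inverse function theorem *)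

Section CkMatrix.
Context {R : realType} {V : normedModType R}.
Variables (k : nat) (U : set V).
Hypothesis oU : open U.

Lemma Ck_on_bigprod I (r : seq I) (F : I -> V -> R) :
  (forall i, Ck_on k U (F i)) -> Ck_on k U (fun x => \prod_(i <- r) F i x).
Proof.
move=> H; elim: r => [|i r IH].
  by apply: (Ck_on_eq oU _ (Ck_on_cst k U (1 : R))) => x _; rewrite big_nil.
by apply: (Ck_on_eq oU _ (Ck_onM oU (H i) IH)) => x _; rewrite big_cons.
Qed.

Lemma Ck_on_det n (B : V -> 'M[R]_n) :
  (forall i j, Ck_on k U (fun x => B x i j)) -> Ck_on k U (fun x => \det (B x)).
Proof.
move=> H; apply: (Ck_on_sum _ _ oU) => s; apply: Ck_onM => //.
  exact: Ck_on_cst.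
by apply: Ck_on_bigprod => i; exact: H.
Qed.

Lemma Ck_on_invmx n (B : V -> 'M[R]_n) i j :
  (forall x, U x -> B x \in unitmx) ->
  (forall i j, Ck_on k U (fun x => B x i j)) ->
  Ck_on k U (fun x => invmx (B x) i j).
Proof.
move=> uB H.
have d0 x : U x -> \det (B x) != 0 by move=> /uB; rewrite unitmxE unitfE.
have C : Ck_on k U (fun x => (\det (B x))^-1 * cofactor (B x) j i).
  apply: (Ck_onM oU (Ck_onV oU d0 (Ck_on_det H))).
  apply: Ck_onM => //; first exact: Ck_on_cst.
  apply: Ck_on_det => i' j'.
  by apply: (Ck_on_eq oU _ (H (lift j i') (lift i j'))) => x _; rewrite !mxE.
apply: (Ck_on_eq oU _ C) => x Ux.
by rewrite /invmx uB// !mxE.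
Qed.

End CkMatrix.

Lemma Ck_on_leq {R : realType} (V W : normedModType R) j k (U : set V)
    (g : V -> W) : (j <= k)%N -> Ck_on k U g -> Ck_on j U g.
Proof.
move=> jk; rewrite -(subnK jk); elim: (k - j)%N => [//|i IH] H.
by apply: IH; exact: Ck_on_pred H.
Qed.

Section InverseFunction.
Context {R : realType}.

Lemma mulmxr_continuous n p (B : 'M[R]_(n, p)) :
  continuous (mulmxr B : 'rV[R]_n -> 'rV[R]_p).
Proof.
move=> x; apply/(@cvgrPdist_le _ _ _ (nbhs x)) => e e0.
pose q := n%:R * `|B| + 1.
have q0 : 0 < q by rewrite ltr_wpDl// mulr_ge0.
have eq0 : 0 < e / q by rewrite divr_gt0.
near=> t.
have xt : `|x - t| <= e / q by near: t; exact: cvgr_dist_le.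
rewrite -mulmxBl (le_trans (mulmx_norm_le _ _))//.
rewrite -(divfK (lt0r_neq0 q0) e) mulrC ler_pM ?mulr_ge0//.
by rewrite lerDl.
Unshelve. all: by end_near. Qed.

Lemma diff_lin_mulmxr n p (B : 'M[R]_(n, p)) (x w : 'rV[R]_n) :
  'd (mulmxr B) x w = w *m B.
Proof. by rewrite (diff_lin x (@mulmxr_continuous n p B)). Qed.

Lemma diff_subc (V W : normedModType R) (X : V -> W) (c : W) u :
  differentiable X u -> differentiable (fun u => X u - c) u /\
  forall v, 'd (fun u => X u - c) u v = 'd X u v.
Proof.
move=> dX; have dc := differentiable_cst c u; split; first exact: differentiableB.
move=> v; transitivity ('d X u v - 'd (cst c) u v).
  exact: (congr1 (@^~ v) (diffB dX dc)).
have -> : 'd (cst c) u v = 0 by exact: (congr1 (@^~ v) (diff_cst c u)).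
exact: subr0.
Qed.

Lemma diff_mulmxr (V : normedModType R) n p (X : V -> 'rV[R]_n) (c : 'rV[R]_n)
    (B : 'M[R]_(n, p)) u :
  differentiable X u -> differentiable (fun u => (X u - c) *m B) u /\
  forall v, 'd (fun u => (X u - c) *m B) u v = 'd X u v *m B.
Proof.
move=> /(diff_subc c)[dXc EX].
have dB : differentiable (mulmxr B) (X u - c).
  by apply: linear_differentiable; exact: mulmxr_continuous.
split; first exact: (differentiable_comp dXc dB).
move=> v; have E := diff_compE v dXc dB.
apply: (etrans E).
apply: (etrans (diff_lin_mulmxr B (X u - c) _)).
exact: (congr1 (mulmx^~ B) (EX v)).
Qed.

Context {n : nat}.
Implicit Types (u v y : 'rV[R]_n).

Lemma diff_jacobian (Y : 'rV[R]_n -> 'rV[R]_n) u v :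
  'd Y u v = v *m jacobian Y u.
Proof. by rewrite /jacobian mul_rV_lin1. Qed.

Lemma Ck_on_jacobian k (U : set 'rV[R]_n) (Y : 'rV[R]_n -> 'rV[R]_n) i j :
  open U -> Ck_on k.+1 U Y -> Ck_on k U (fun u => jacobian Y u i j).
Proof.
move=> oU [dY CY].
apply: (Ck_on_eq oU _ (Ck_on_entry j oU (CY 'e_i))) => u Uu.
rewrite (deriveE 'e_i (dY u Uu)) /jacobian !mxE.
by [].
Qed.

Lemma injective_unitmx (B : 'M[R]_n) : injective (fun v => v *m B) -> B \in unitmx.
Proof.
move=> iB; rewrite -row_free_unit; apply: inj_row_free => v vB.
by apply: iB; rewrite vB mul0mx.
Qed.

(** A Lipschitz right inverse is differentiable where the derivative is
    invertible: the Lipschitz bound turns the remainder of [Y] at [g y] into a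
    remainder of [g] at [y]. *)
Lemma differentiable_inverse (Y g : 'rV[R]_n -> 'rV[R]_n) (D : set 'rV[R]_n) y (K : R) :
  open D -> D y -> (forall y', D y' -> Y (g y') = y') ->
  0 < K -> (forall y', D y' -> `|g y' - g y| <= K * `|y' - y|) ->
  differentiable Y (g y) -> jacobian Y (g y) \in unitmx ->
  differentiable g y /\ forall v, 'd g y v = v *m invmx (jacobian Y (g y)).
Proof.
move=> oD Dy Yg K0 gK dY uJ.
set J := jacobian Y (g y) in uJ *; set B := invmx J.
have Bc := @mulmxr_continuous n n B.
have [] := @differentiable_eps R _ _ g y (mulmxr B) Bc; last first.
  by move=> dg E; split=> // v; rewrite E.
move=> e e0.
pose q := n%:R * `|B| + 1.
have q0 : 0 < q by rewrite ltr_wpDl// mulr_ge0.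
pose e' := e / (q * K).
have e'0 : 0 < e' by rewrite divr_gt0// mulr_gt0.
have /nbhs_normP[r /= r0 Hr] := differentiable_epsE dY e'0.
have /nbhs0P Dnear := open_nbhs_nbhs (conj oD Dy).
near=> h.
have Dh : D (h + y) by rewrite addrC; near: h.
have hr : K * `|h| < r.
  rewrite -ltr_pdivlMl//; near: h; apply: (@nbhs0_lt R ('rV[R]_n : normedModType R)).
  by rewrite mulr_gt0// invr_gt0.
pose w := g (h + y) - g y.
have wh : `|w| <= K * `|h| by have := gK _ Dh; rewrite addrK.
have := Hr w; rewrite /ball_ /= sub0r normrN => /(_ (le_lt_trans wh hr)).
rewrite subrK !Yg// addrK diff_jacobian -/J => Hw.
have -> : g (h + y) - g y - h *m B = - ((h - w *m J) *m B).
  by rewrite mulmxBl mulmxK// opprB.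
rewrite normrN (le_trans (mulmx_norm_le _ _))//.
apply: (@le_trans _ _ (q * (e' * (K * `|h|)))).
  rewrite ler_pM ?mulr_ge0//; first by rewrite lerDl.
  by apply: (le_trans Hw); rewrite ler_pM2l.
have -> : q * (e' * (K * `|h|)) = (e' * (q * K)) * `|h| by ring.
by rewrite /e' divfK// mulf_neq0// lt0r_neq0.
Unshelve. all: by end_near. Qed.

(** Newton's map with the derivative taken at [u0] is a contraction by strict
    differentiability, so that it has a fixed point for every nearby value.
    The open set [N] makes the inverse two-sided. *)
Theorem inverse_function k (U : set 'rV[R]_n) (Y : 'rV[R]_n -> 'rV[R]_n) u0 :
  open U -> U u0 -> Ck_on k.+1 U Y -> injective ('d Y u0) ->
  exists (r : R) (g : 'rV[R]_n -> 'rV[R]_n) (N : set 'rV[R]_n),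
  [/\ 0 < r, open N, N u0 & N `<=` U] /\
  [/\ forall y, `|y - Y u0| < r -> N (g y) /\ Y (g y) = y,
      forall u, N u -> `|Y u - Y u0| < r /\ g (Y u) = u,
      Ck_on k.+1 [set y | `|y - Y u0| < r] g &
      forall u, N u -> jacobian Y u \in unitmx].
Proof.
move=> oU Uu0 CY iY.
have C1Y : Ck_on 1 U Y.
  exact: Ck_on_leq CY.
have [dY _] := C1Y.
have [J JE] : {J | J = jacobian Y u0} by exists (jacobian Y u0).
have uJ : J \in unitmx.
  rewrite JE; apply: injective_unitmx => v w E; apply: iY.
  by rewrite [LHS]diff_jacobian [RHS]diff_jacobian.
pose B := invmx J; pose q := n%:R * `|B| + 1.
have q0 : 0 < q by rewrite ltr_wpDl// mulr_ge0.
have qB v : `|v *m B| <= q * `|v|.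
  by rewrite (le_trans (mulmx_norm_le _ _))// ler_wpM2r// lerDl.
pose e := (2 * q)^-1.
have e0 : 0 < e by rewrite invr_gt0 mulr_gt0.
have qe : q * e = 2^-1.
  by rewrite /e invfM mulrCA divff ?mulr1// lt0r_neq0.
have [d1 d10 H1] := C1_near oU Uu0 C1Y e0.
have [d2 d20 H2] := C1_strict oU Uu0 C1Y e0.
pose d := Num.min d1 d2.
have d0 : 0 < d by rewrite lt_min d10 d20.
have dd1 u : `|u - u0| < d -> `|u - u0| < d1.
  by move=> /lt_le_trans; apply; rewrite ge_min lexx.
have dd2 u : `|u - u0| < d -> `|u - u0| < d2.
  by move=> /lt_le_trans; apply; rewrite ge_min lexx orbT.
have dU u : `|u - u0| < d -> U u by move=> /dd1 /H1[].
have contr u u' : `|u - u0| < d -> `|u' - u0| < d ->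
    `|(Y u - Y u') *m B - (u - u')| <= 2^-1 * `|u - u'|.
  move=> ud u'd; have := H2 u u' (dd2 _ ud) (dd2 _ u'd).
  rewrite diff_jacobian -JE => H.
  have -> : (Y u - Y u') *m B - (u - u') = (Y u - Y u' - (u - u') *m J) *m B.
    by rewrite [RHS]mulmxBl mulmxK.
  by rewrite (le_trans (qB _))// -qe -mulrA ler_pM2l.
have lip u u' : `|u - u0| < d -> `|u' - u0| < d ->
    `|u - u'| <= 2 * q * `|Y u - Y u'|.
  move=> ud u'd; have H := contr u u' ud u'd; have H' := qB (Y u - Y u').
  have : `|u - u'| <= `|(Y u - Y u') *m B| + `|(Y u - Y u') *m B - (u - u')|.
    set a := _ *m B; rewrite -[X in `|X|](subKr a) .
    exact: ler_normB.
  by move: H H'; set a := `|u - u'|; set b := `|_ - _|; set c := `|_|; lra.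
pose r := d / (4 * q).
have r0 : 0 < r by rewrite divr_gt0// mulr_gt0.
have qr : q * r = d / 4.
  by rewrite /r invfM mulrCA [q * _]mulrCA divff ?mulr1 ?lt0r_neq0// mulrC.
(* the contraction has ratio 1/2 on a ball of radius [d], hence preserves the
   closed ball of radius [d / 2] when the target value moves by less than [r] *)
pose cb := [set u | `|u - u0| <= d / 2].
have cbd u : cb u -> `|u - u0| < d by move=> ud; have {}ud : `|u - u0| <= d / 2 := ud; lra.
have fixpt y : `|y - Y u0| < r -> exists2 u, `|u - u0| < d / 2 & Y u = y.
  move=> yr.
  pose T u := u - (Y u - y) *m B.
  have TT u u' : `|u - u0| < d -> `|u' - u0| < d -> `|T u - T u'| <= 2^-1 * `|u - u'|.
    move=> ud u'd; have := contr u u' ud u'd.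
    have -> : T u - T u' = - ((Y u - Y u') *m B - (u - u')).
      rewrite /T !mulmxBl; apply/rowP => i; rewrite !mxE; ring.
    by rewrite normrN.
  have T0 u : cb u -> `|T u - u0| < d / 2.
    move=> cu; have du := cbd _ cu.
    have d0u0 : `|u0 - u0| < d by rewrite subrr normr0.
    have HT := TT u u0 du d0u0.
    have -> : T u - u0 = (T u - T u0) + (y - Y u0) *m B.
      rewrite /T !mulmxBl; apply/rowP => i; rewrite !mxE; ring.
    apply: (le_lt_trans (ler_normD _ _)).
    have HB := qB (y - Y u0).
    have : q * `|y - Y u0| < q * r by rewrite ltr_pM2l.
    have {}cu : `|u - u0| <= d / 2 := cu.
    rewrite qr; move: HT HB cu; lra.
  have Tcb : set_fun cb cb T by move=> u /T0 /ltW.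
  pose F : {fun cb >-> cb} := mkfun_fun Tcb.
  pose X : completeNormedModType R := HB.pack 'rV[R]_n.
  have [|||p cbp pT] := @banach_fixed_point R X cb F.
  - exists (2^-1)%:nng; split; first by rewrite /=; lra.
    move=> [u u'] [/= /cbd cu /cbd cu']; exact: TT.
  - have -> : cb = closed_ball u0 (d / 2).
      rewrite closed_ballE ?divr_gt0//; apply/seteqP.
      by split=> u; rewrite /cb /closed_ball_/= distrC.
    exact: closed_ball_closed.
  - by exists u0; rewrite /cb/= subrr normr0 divr_ge0// ltW.
  have {}pT : p = T p := pT.
  exists p; first by rewrite pT; exact: T0.
  have /eqP := pT; rewrite /T eq_sym subr_eq addrC -subr_eq subrr => /eqP /esym E.
  apply/subr0_eq.
  by rewrite -[LHS](mulmxKV uJ) -/B E mul0mx.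
have [g Hg] : exists g : 'rV[R]_n -> 'rV[R]_n, forall y, `|y - Y u0| < r ->
    `|g y - u0| < d / 2 /\ Y (g y) = y.
  have : forall y, exists u, `|y - Y u0| < r -> `|u - u0| < d / 2 /\ Y u = y.
    move=> y; case: (pselect (`|y - Y u0| < r)) => yr; last by exists 0.
    by have [u ud Yu] := fixpt y yr; exists u.
  by move=> /choice[g Hg]; exists g => y /Hg.
pose D := [set y | `|y - Y u0| < r].
have oD : open D.
  have -> : D = ball (Y u0) r.
    by rewrite -ball_normE; apply/seteqP; split=> u; rewrite /D/ball_/= distrC.
  exact: ball_open.
pose N := [set u | `|u - u0| < d / 2] `&` (Y @^-1` D).
have oN : open N.
  have -> : N = ball u0 (d / 2) `&` (Y @^-1` D).
    by rewrite /N -ball_normE; apply/seteqP; split=> u; rewrite /ball_/= distrC.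
  rewrite openE => u [ub uD]; apply: filterI.
    by apply: open_nbhs_nbhs; split => //; exact: ball_open.
  have ud : `|u - u0| < d.
    move: ub; rewrite -ball_normE /ball_/= distrC => ub.
    by apply: lt_trans ub _; rewrite ltr_pdivrMr// ltr_pMr// ltr1n.
  have cYu : {for u, continuous Y} by apply/differentiable_continuous/dY/dU.
  by apply: cYu; apply: open_nbhs_nbhs.
have dNu u : N u -> `|u - u0| < d.
  by move=> [/= ub _]; apply: lt_trans ub _; rewrite ltr_pdivrMr// ltr_pMr// ltr1n.
have DgN y : D y -> N (g y).
  by move=> Dy; have [H1' H2'] := Hg y Dy; split => //; rewrite /= H2'.
have Yg y : D y -> Y (g y) = y by move=> /Hg[].
have NuJ u : N u -> jacobian Y u \in unitmx.
  move=> Nu; apply: injective_unitmx => v w /= E; apply/eqP; rewrite -subr_eq0.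
  set z := v - w.
  have zJ : z *m jacobian Y u = 0 by rewrite mulmxBl E subrr.
  have zJe : `|z *m J| <= e * `|z|.
    have E1 : 'd Y u z - 'd Y u0 z = - (z *m J).
      transitivity (z *m jacobian Y u - z *m J); last by rewrite zJ sub0r.
      by rewrite JE; congr (_ - _); exact: diff_jacobian.
    have [_ Hz] := H1 u (dd1 _ (dNu _ Nu)).
    by rewrite -normrN -E1; exact: Hz.
  have : `|z *m J *m B| <= q * (e * `|z|).
    by rewrite (le_trans (qB _))// ler_pM2l.
  rewrite mulmxK// mulrA qe -normr_le0.
  by have := normr_ge0 z; lra.
have gL y y' : D y -> D y' -> `|g y' - g y| <= 2 * q * `|y' - y|.
  move=> Dy Dy'; rewrite -{2}(Yg _ Dy) -{2}(Yg _ Dy').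
  by apply: lip; apply: dNu; exact: DgN.
have gd y : D y -> differentiable g y /\
    forall v, 'd g y v = v *m invmx (jacobian Y (g y)).
  move=> Dy.
  apply: (@differentiable_inverse Y g D y (2 * q) oD Dy Yg).
  - by rewrite mulr_gt0.
  - by move=> y' Dy'; exact: gL.
  - by apply/dY/dU/dNu/DgN.
  - exact/NuJ/DgN.
exists r, g, N; split; split => //.
- by split; rewrite /D/= ?subrr ?normr0// divr_gt0.
- by move=> u /dNu /dU.
- by move=> y Dy; split; [exact: DgN|exact: Yg].
- move=> u Nu; have [_ Du] := Nu; split => //.
  apply/eqP; rewrite -subr_eq0 -normr_le0.
  by have := lip _ _ (dNu _ (DgN _ Du)) (dNu _ Nu); rewrite Yg// subrr normr0 mulr0.
(* bootstrap: the derivative of [g] is the inverse matrix at [g y] *)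
- have : forall j, (j <= k.+1)%N -> Ck_on j D g.
    elim=> [_|j IH jk].
      by move=> y Dy; exact/differentiable_continuous/(gd y Dy).1.
    split=> [y Dy|v]; first exact: (gd y Dy).1.
    have Cg := IH (ltnW jk).
    have CJ : Ck_on j.+1 U Y.
      exact: Ck_on_leq CY.
    have Cinv i l : Ck_on j D (fun y => invmx (jacobian Y (g y)) i l).
      apply: Ck_on_invmx => //; first by move=> y Dy; exact/NuJ/DgN.
      move=> i' l'.
      apply: (@Ck_on_comp R _ n j D U g (fun u => jacobian Y u i' l')) => //.
        by move=> y Dy; exact/dU/dNu/DgN.
      exact: Ck_on_jacobian.
    apply: Ck_on_rV => // l.
    have C : Ck_on j D (fun y => \sum_(i < n) v 0 i * invmx (jacobian Y (g y)) i l).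
      apply: Ck_on_sum => // i; apply: Ck_onM => //; exact: Ck_on_cst.
    apply: (Ck_on_eq oD _ C) => y Dy.
    by rewrite (deriveE v (gd y Dy).1) (gd y Dy).2 mxE.
  by move=> /(_ k.+1); apply.
Unshelve. all: by end_near. Qed.
End InverseFunction.

(** * Local graphs of an immersed surface *)

Lemma near_eq_diff {R : realType} (V W : normedModType R) (f g : V -> W) x v :
  {near x, f =1 g} -> differentiable f x -> 'd f x v = 'd g x v.
Proof.
move=> fg df; have dg := near_eq_differentiable fg df.
apply: (etrans (esym (deriveE v df))); apply: (etrans _ (deriveE v dg)).
exact: near_eq_derive.
Qed.

Section Frame.
Context {R : realType}.
Implicit Types (v n w q : 'rV[R]_3).

Definition frame v1 v2 n : 'M[R]_3 :=
  \matrix_(i < 3) (if i == 0 then v1 else if i == 1 then v2 else n).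

Lemma mul_frame w v1 v2 n :
  w *m frame v1 v2 n = w 0 0 *: v1 + w 0 1 *: v2 + w 0 ord_max *: n.
Proof.
rewrite mulmx_sum_row !big_ord_recl big_ord0 addr0 addrA !rowK /=.
by congr (_ *: _ + _ *: _ + _ *: _); congr (w 0 _); exact: val_inj.
Qed.

(** The graph parameters of a point, seen from the base point. *)
Definition plane_coord (B : 'M[R]_3) w : 'rV[R]_2 :=
  \row_(i < 2) (w *m invmx B) 0 (widen_ord (leqnSn 2) i).

Lemma plane_coordE B w : (plane_coord B w 0 0 = (w *m invmx B) 0 0) *
  (plane_coord B w 0 1 = (w *m invmx B) 0 1).
Proof. by split; rewrite mxE; congr (_ 0 _); exact: val_inj. Qed.

Lemma plane_coord_mulmx (B : 'M[R]_3) :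
  exists L : 'M[R]_(3, 2), forall w, plane_coord B w = w *m L.
Proof.
exists (\matrix_(i, j) invmx B i (widen_ord (leqnSn 2) j)) => w.
by apply/rowP => j; rewrite !mxE; apply: eq_bigr => i _; rewrite !mxE.
Qed.

Lemma plane_coord_frame v1 v2 n (a b c : R) : frame v1 v2 n \in unitmx ->
  let w := a *: v1 + b *: v2 + c *: n in
  [/\ plane_coord (frame v1 v2 n) w 0 0 = a, plane_coord (frame v1 v2 n) w 0 1 = b
    & (w *m invmx (frame v1 v2 n)) 0 ord_max = c].
Proof.
move=> uB w.
pose u : 'rV[R]_3 := \row_(i < 3) (if i == 0 then a else if i == 1 then b else c).
have -> : w = u *m frame v1 v2 n by rewrite mul_frame !mxE.
by rewrite !plane_coordE mulmxK// !mxE.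
Qed.

Lemma frame_coord_inj v1 v2 n (a b c a' b' c' : R) : frame v1 v2 n \in unitmx ->
  a *: v1 + b *: v2 + c *: n = a' *: v1 + b' *: v2 + c' *: n ->
  [/\ a = a', b = b' & c = c'].
Proof.
move=> uB E; have [] := plane_coord_frame a b c uB; rewrite E.
by have [-> -> ->] := plane_coord_frame a' b' c' uB.
Qed.

Lemma frame_span v1 v2 n w : frame v1 v2 n \in unitmx ->
  exists a b c : R, w = a *: v1 + b *: v2 + c *: n.
Proof.
move=> uB; rewrite -[w](mulmxKV uB) mul_frame.
by do 3 eexists.
Qed.

End Frame.

Section LocalGraph.
Context {R : realType} {M : topologicalType}.
Context (A : set (chart R M)) (f : M -> 'rV[R]_3).
Context (hM : C2_2manifold A) (hf : C2_immersion A f).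

Notation T := (tangent_plane A f).

Lemma chart_of m : exists2 c, A c & dom c m.
Proof. by have [_ _ [_ + _]] := hM; exact. Qed.

Lemma chartP c : A c -> is_chart c.
Proof. by have [_ _ [+ _ _]] := hM; exact. Qed.

Lemma coordK c m : A c -> dom c m -> param c (coord c m) = m.
Proof. by move=> /chartP[_ _ _ _]; exact. Qed.

Lemma cdomP c u : A c -> cdom c u -> dom c (param c u) /\ coord c (param c u) = u.
Proof. by move=> Ac [m dm <-]; rewrite coordK. Qed.

Lemma immersion_differentiable c u : A c -> cdom c u -> differentiable (f \o param c) u.
Proof. by move=> /hf[[+ _] _]; exact. Qed.

(** Charts are compared through coordinate changes, whose domains have to be
    open for the chain rule. *)
Lemma transition_open c c' : A c -> A c' ->
  open (coord c @` (dom c `&` dom c')).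
Proof.
move=> Ac Ac'; have [_ ocd _ cp _] := chartP Ac; have [od' _ _ _ _] := chartP Ac'.
rewrite openE => _ [m [dm d'm] <-].
have cm : cdom c (coord c m) by exists m.
have N1 : nbhs (coord c m) (cdom c) by apply: open_nbhs_nbhs.
have N2 : nbhs (coord c m) (param c @^-1` dom c').
  by apply: (cp _ cm); apply: open_nbhs_nbhs; split => //; rewrite coordK.
apply: filterS2 N1 N2 => u cu pu.
by have [dpu pK] := cdomP Ac cu; exists (param c u).
Qed.

Lemma diff_chart_change c c' m v : A c -> A c' -> dom c m -> dom c' m ->
  exists v', 'd (f \o param c) (coord c m) v = 'd (f \o param c') (coord c' m) v'.
Proof.
move=> Ac Ac' dm d'm.
pose t := coord c' \o param c; set u := coord c m.
have ut : (coord c @` (dom c `&` dom c')) u by exists m.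
have [_ _ [_ _ /(_ c c' Ac Ac')[dt _]]] := hM.
have {}dt : differentiable t u by exact: dt.
have tu : t u = coord c' m by rewrite /t/u/= coordK.
have dX' : differentiable (f \o param c') (t u).
  by rewrite tu; apply: immersion_differentiable => //; exists m.
have dX : differentiable (f \o param c) u.
  by apply: immersion_differentiable => //; exists m.
exists ('d t u v); rewrite -tu.
apply: (etrans _ (diff_compE v dt dX')); apply: near_eq_diff => //.
have := open_nbhs_nbhs (conj (transition_open Ac Ac') ut).
apply: filterS => _ [m' [dm' d'm'] <-].
by rewrite /t/= (coordK Ac dm') coordK.
Qed.

Lemma tangent_chart c m w : A c -> dom c m -> T m w ->
  exists v, w = 'd (f \o param c) (coord c m) v.
Proof.
move=> Ac dm [c' [Ac' d'm [v' ->]]].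
exact: diff_chart_change.
Qed.

(** Near [m] the surface is the graph of [phi] over the plane spanned by [v1]
    and [v2], in the direction [n].  The parametrization [G] takes its values
    in the manifold, since [f] is only an immersion: [N] is the sheet through
    [m], and the other sheets of the image are kept out by [graph_surj].  The
    direction [n] is free, which is why the graph may be vertical. *)
Record is_graph (m : M) (v1 v2 n : 'rV[R]_3) (r : R) (G : 'rV[R]_2 -> M)
    (phi : 'rV[R]_2 -> R) (N : set M) : Prop := IsGraph {
  graph_frame : frame v1 v2 n \in unitmx;
  graph_gt0 : 0 < r;
  graph_open : open N;
  graph_base : G 0 = m;
  graph_in : forall y, `|y| < r -> N (G y);
  graph_eq : forall y, `|y| < r ->
    f (G y) = f m + (y 0 0 *: v1 + y 0 1 *: v2 + phi y *: n);
  graph_surj : forall m', N m' -> exists2 y, `|y| < r & G y = m';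
  graph_cont : forall y, `|y| < r -> {for y, continuous G};
  graph_charts : forall c, A c ->
    Ck_on 2 ([set y | `|y| < r] `&` G @^-1` dom c) (coord c \o G);
  graph_C2 : Ck_on 2 [set y | `|y| < r] phi;
  graph_tangent : forall y, `|y| < r -> forall w, T (G y) w <->
    exists d : 'rV[R]_2, w = d 0 0 *: v1 + d 0 1 *: v2 + 'd phi y d *: n }.

Lemma open_norm_lt p (r : R) : open [set y : 'rV[R]_p | `|y| < r].
Proof.
case: (ltP 0 r) => r0.
  have -> : [set y : 'rV[R]_p | `|y| < r] = ball 0 r.
    by rewrite -ball_normE; apply/seteqP; split=> u; rewrite /ball_/= sub0r normrN.
  exact: ball_open.
suff -> : [set y : 'rV[R]_p | `|y| < r] = set0 by exact: open0.
by apply/seteqP; split => // y /= yr; have := lt_le_trans yr r0; rewrite normr_lt0.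
Qed.

(** The first two coordinates of the immersion in the frame have an injective
    derivative at [m]; [G] is obtained by inverting them. *)
Theorem local_graph m v1 v2 n : T m v1 -> T m v2 -> frame v1 v2 n \in unitmx ->
  exists r G phi N, is_graph m v1 v2 n r G phi N.
Proof.
move=> Tv1 Tv2 uB.
have [c Ac dm] := chart_of m; have [od ocd cc cp _] := chartP Ac.
set u0 := coord c m; pose X := f \o param c; set B := frame v1 v2 n in uB.
have cu0 : cdom c u0 by exists m.
have Xu0 : X u0 = f m by rewrite /X/u0/= coordK.
have CX : Ck_on 2 (cdom c) X by have [] := hf Ac.
have dX u : cdom c u -> differentiable X u by exact: immersion_differentiable.
pose Z u := (X u - f m) *m invmx B.
have CZ j : Ck_on 2 (cdom c) (fun u => Z u 0 j).
  have C : Ck_on 2 (cdom c) (fun u => \sum_(i < 3) (X u 0 i - f m 0 i) * invmx B i j).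
    apply: Ck_on_sum => // i; apply: (Ck_onM ocd); last exact: Ck_on_cst.
    apply: (Ck_onB ocd); last exact: Ck_on_cst.
    exact: (Ck_on_entry i ocd CX).
  apply: (Ck_on_eq ocd _ C) => u _; rewrite /Z mxE.
  by apply: eq_bigr => i _; rewrite !mxE.
have dZ u : cdom c u -> differentiable Z u /\ forall v, 'd Z u v = 'd X u v *m invmx B.
  by move=> cu; exact: (diff_mulmxr (f m) (invmx B) (dX u cu)).
pose Y u := plane_coord B (X u - f m).
have CY : Ck_on 2 (cdom c) Y.
  apply: (@Ck_on_rV R _ 2 2 (cdom c) Y ocd) => i.
  apply: (Ck_on_eq ocd _ (CZ (widen_ord (leqnSn 2) i))) => u _.
  by rewrite [RHS]mxE.
have dY u : cdom c u -> differentiable Y u by have [+ _] := CY; exact.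
have YE u v : cdom c u -> 'd Y u v = plane_coord B ('d X u v).
  move=> cu; have [dZu EZ] := dZ u cu; apply/rowP => i; rewrite [RHS]mxE.
  rewrite -EZ -(diff_entry i v (dY u cu)) -(diff_entry _ v dZu).
  by congr ('d _ u v); apply/funext => u'; rewrite [LHS]mxE.
have Y0 : Y u0 = 0.
  by apply/rowP => i; rewrite mxE Xu0 subrr mul0mx !mxE.
have iY : injective ('d Y u0).
  have [L LE] : exists L : {linear 'rV[R]_2 -> 'rV[R]_3}, forall v, 'd X u0 v = L v.
    by exists ('d X u0).
  have [L' LE'] : exists L : {linear 'rV[R]_2 -> 'rV[R]_2}, forall v, 'd Y u0 v = L v.
    by exists ('d Y u0).
  have LL' v : L' v = plane_coord B (L v) by rewrite -LE -LE' YE.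
  have [a1 a1E] := tangent_chart Ac dm Tv1; have [a2 a2E] := tangent_chart Ac dm Tv2.
  have {}a1E : v1 = L a1 := etrans a1E (LE a1).
  have {}a2E : v2 = L a2 := etrans a2E (LE a2).
  pose C : 'M[R]_2 := \matrix_(i < 2) (if i == 0 then a1 else a2).
  have CE (w : 'rV[R]_2) : w *m C = w 0 0 *: a1 + w 0 1 *: a2.
    rewrite mulmx_sum_row !big_ord_recl big_ord0 addr0 !rowK /=.
    by congr (_ *: _ + _ *: _); congr (w 0 _); exact: val_inj.
  have LC (w : 'rV[R]_2) : L (w *m C) = w 0 0 *: v1 + w 0 1 *: v2 + 0 *: n.
    by rewrite CE linearD !linearZ /= -a1E -a2E scale0r addr0.
  have wC0 (w : 'rV[R]_2) : plane_coord B (L (w *m C)) = w.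
    rewrite LC; have [P1 P2 _] := plane_coord_frame (w 0 0) (w 0 1) 0 uB.
    apply/rowP => i; case: (unliftP 0 i) => [j ->|->]; last exact: P1.
    by rewrite (_ : lift 0 j = 1) ?P2//; apply: val_inj; rewrite (ord1 j).
  have uC : C \in unitmx.
    apply: injective_unitmx => v w /= E.
    by rewrite -(wC0 v) -(wC0 w) E.
  move=> v w E; have {}E : L' v = L' w by rewrite -LE' -LE'.
  rewrite -[v](mulmxKV uC) -[w](mulmxKV uC); congr (_ *m C).
  by rewrite -[LHS]wC0 -[RHS]wC0 !mulmxKV// -!LL'.
have [r [g [N0 [[r0 oN0 N0u0 N0U] [gP NP Cg uJ]]]]] := inverse_function ocd cu0 CY iY.
rewrite Y0 in gP NP Cg.
have {}gP y : `|y| < r -> N0 (g y) /\ Y (g y) = y.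
  by move=> yr; apply: gP; rewrite subr0.
have {}NP u : N0 u -> `|Y u| < r /\ g (Y u) = u.
  by move=> /NP; rewrite subr0.
have {}Cg : Ck_on 2 [set y | `|y| < r] g.
  by apply: (Ck_on_sub _ Cg) => y /=; rewrite subr0.
pose D := [set y : 'rV[R]_2 | `|y| < r].
have oD : open D by exact: open_norm_lt.
pose G := param c \o g.
pose phi y := Z (g y) 0 ord_max.
have gU y : D y -> cdom c (g y) by move=> /gP[/N0U].
have dG y : D y -> dom c (G y) /\ coord c (G y) = g y.
  by move=> /gU; exact: cdomP.
have G0 : G 0 = m.
  have [_ E] := NP _ N0u0; rewrite Y0 in E.
  by rewrite /G/= E /u0 coordK.
have Gc y : D y -> {for y, continuous G}.
  move=> Dy; apply: continuous_comp; first exact: (Ck_on0 Cg Dy).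
  exact/cp/gU.
have XE y : D y -> X (g y) = f m + (y 0 0 *: v1 + y 0 1 *: v2 + phi y *: n).
  move=> /gP[_ Yg]; apply/eqP; rewrite addrC -subr_eq; apply/eqP.
  rewrite -[LHS](mulmxKV uB) mul_frame.
  by congr (_ *: _ + _ *: _ + _ *: _); rewrite -?(plane_coordE B) -/(Y (g y)) ?Yg.
exists r, G, phi, (dom c `&` coord c @^-1` N0); split.
- exact: uB.
- exact: r0.
- rewrite openE => m' [dm' Nm']; apply: filterI; first exact: open_nbhs_nbhs.
  by apply: cc => //; apply: open_nbhs_nbhs.
- exact: G0.
- move=> y yr; have [dGy GE] := dG y yr; split => //=; rewrite GE.
  by have [] := gP y yr.
- by move=> y yr; rewrite -XE.
- move=> m' [dm' Nm']; have [Yr gY] := NP _ Nm'; exists (Y (coord c m')) => //.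
  by rewrite /G/= gY coordK.
- exact: Gc.
- move=> c' Ac'; have [od' _ _ _ _] := chartP Ac'.
  have oO : open ([set y | `|y| < r] `&` G @^-1` dom c').
    rewrite openE => y [yr Gy]; apply: filterI; first exact: open_nbhs_nbhs.
    by apply: (Gc _ yr); apply: open_nbhs_nbhs.
  have [_ _ [_ _ /(_ c c' Ac Ac') Ct]] := hM.
  apply: (Ck_on_comp_rV oO (transition_open Ac Ac') _ _ Ct).
    move=> y [yr Gy]; have [dGy GE] := dG y yr.
    by exists (G y).
  by apply: (Ck_on_sub _ Cg) => y [].
- exact: (@Ck_on_comp R _ 2 2 D (cdom c) g (fun u => Z u 0 ord_max) oD gU Cg (CZ ord_max)).
- move=> y yr w; have [dGy GE] := dG y yr.
  have dgy : differentiable g y by have [+ _] := Cg; exact.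
  have dYg := dY _ (gU y yr).
  have [dZg EZ] := dZ _ (gU y yr).
  have Yg d : 'd Y (g y) ('d g y d) = d.
    have E := diff_compE d dgy dYg.
    apply: (etrans (esym E)).
    have H : {near y, Y \o g =1 id}.
      by have := open_nbhs_nbhs (conj oD yr); apply: filterS => y' /gP[].
    apply: (etrans (near_eq_diff d H (differentiable_comp dgy dYg))).
    have -> : 'd id y = id :> ('rV[R]_2 -> 'rV[R]_2) by case: (is_diff_id y).
    by [].
  have XgE d v : 'd g y d = v ->
      'd X (g y) v = d 0 0 *: v1 + d 0 1 *: v2 + 'd phi y d *: n.
    move=> dv; rewrite -[LHS](mulmxKV uB) mul_frame -!(plane_coordE B).
    have -> : plane_coord B ('d X (g y) v) = d.
      by apply: (etrans (esym (YE _ v (gU y yr)))); rewrite -dv; exact: Yg.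
    congr (_ + _ *: _).
    rewrite -EZ -(diff_entry ord_max v dZg) -dv.
    exact: esym (diff_compE d dgy (differentiable_entry ord_max dZg)).
  split.
    move=> /(tangent_chart Ac dGy)[v]; rewrite GE => ->.
    exists ('d Y (g y) v); apply: XgE.
    have uJg := uJ _ (gP y yr).1.
    have inj : injective ('d Y (g y)).
      move=> a b; rewrite [LHS]diff_jacobian [RHS]diff_jacobian.
      by move=> /(can_inj (mulmxK uJg)).
    by apply: inj; rewrite Yg.
  move=> [d ->]; exists c; split; [exact: Ac|exact: dGy|exists ('d g y d)].
  by rewrite GE; exact: (esym (XgE d _ erefl)).
Qed.

End LocalGraph.

(** * Picard iteration *)

Section Picard.
Context {R : realType}.
Implicit Types (g u w : R -> R).

Lemma MVT_bound w (dw : R -> R) (a b C : R) :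
  (forall x, a < x < b -> is_derive x 1 w (dw x)) ->
  (forall x, a < x < b -> `|dw x| <= C) ->
  forall x x', a < x < b -> a < x' < b -> `|w x - w x'| <= C * `|x - x'|.
Proof.
move=> dW bW x x' /andP[ax xb] /andP[ax' x'b].
have itv (t : R) : 0 <= t <= 1 -> a < x' + t *: (x - x') < b.
  move=> /andP[t0 t1]; rewrite /GRing.scale/=.
  have -> : x' + t * (x - x') = (1 - t) * x' + t * x by ring.
  have [->|t1'] := eqVneq t 1; first by rewrite subrr mul0r add0r mul1r ax.
  have {}t1 : 0 < 1 - t by rewrite subr_gt0 lt_neqAle t1' t1.
  by apply/andP; split; nra.
have [t t01|c /andP[c0 c1] E] := @segment_MVT _ _ w x' (x - x').
  by have [+ _] := dW _ (itv t t01) => /derivable1_diffP.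
have c01 : 0 <= c <= 1 by rewrite !ltW.
have [dc Ec] := dW _ (itv c c01).
have {}E : w x - w x' = (x - x') * dw (x' + c *: (x - x')).
  rewrite subrKC in E; rewrite E -Ec.
  have dd : differentiable w (x' + c *: (x - x')) by exact/derivable1_diffP.
  rewrite (deriveE (1 : R) dd) -[X in 'd w _ X = _]mulr1.
  exact: linearZ.
by rewrite E normrM mulrC ler_wpM2r// bW// itv.
Qed.

Lemma antiderivative g : continuous g ->
  exists2 G : R -> R, G 0 = 0 & forall x : R, -1 < x < 1 -> is_derive x (1 : R) G (g x).
Proof.
move=> cg.
pose F x := (\int[lebesgue_measure]_(t in `[(-1), x]) g t)%R.
exists (fun x => F x - F 0); first by rewrite subrr.
move=> x /andP[x1 x2].
have [||||dF EF] := @continuous_FTC1_closed R g (-1) x 1.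
- by [].
- apply: continuous_compact_integrable; first exact: segment_compact.
  exact: continuous_subspaceT.
- by [].
- exact: cg.
rewrite -[g x]subr0; apply: is_deriveB.
by apply: DeriveDef; [exact: dF|rewrite -derive1E].
Qed.

(** Composing with [clamp] extends a function of [[-e, e]] to the whole line
    without increasing differences, so that the Picard operator acts on
    globally defined continuous functions. *)
Definition clamp (e x : R) := Num.max (- e) (Num.min e x).

Lemma clamp_le e x : 0 <= e -> - e <= clamp e x <= e.
Proof. by move=> e0; rewrite /clamp /Num.max /Num.min; case: ifP; case: ifP; lra. Qed.

Lemma clamp_id e x : - e <= x <= e -> clamp e x = x.
Proof. by move=> e0; rewrite /clamp /Num.max /Num.min; case: ifP; case: ifP; lra. Qed.

Lemma clamp_lip e x x' : `|clamp e x - clamp e x'| <= `|x - x'|.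
Proof.
have hx : x - x' <= `|x - x'| by exact: ler_norm.
have hx' : x' - x <= `|x - x'| by rewrite distrC ler_norm.
have n0 := normr_ge0 (x - x').
rewrite ler_norml /clamp.
case: (ltP e x) => ?; case: (ltP e x') => ?; case: (ltP (- e) e) => ?; try (case: (ltP (- e) x) => ?); try (case: (ltP (- e) x') => ?); lra.
Qed.

Lemma lipschitz_continuous (K : R) u : 0 <= K ->
  (forall x x', `|u x - u x'| <= K * `|x - x'|) -> continuous u.
Proof.
move=> K0 H x; apply/cvgrPdist_le => e e0.
have K1 : 0 < K + 1 by rewrite ltr_wpDl.
near=> t.
apply: (le_trans (H x t)).
have : `|x - t| <= e / (K + 1).
  by near: t; apply: cvgr_dist_le => //; rewrite divr_gt0.
rewrite ler_pdivlMr// => h.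
by have := normr_ge0 (x - t); nra.
Unshelve. all: by end_near. Qed.

Lemma half_pow_small (C e : R) : 0 < e -> exists n : nat, C * 2^-1 ^+ n <= e.
Proof.
move=> e0.
have [C0|C0] := leP C 0.
  by exists 0%N; rewrite expr0 mulr1; exact: le_trans C0 (ltW e0).
have h1 : `|2^-1 : R| < 1 by rewrite ger0_norm; lra.
have /cvgrPdist_le/(_ _ (divr_gt0 e0 C0)) [n _ Hn] := cvg_expr h1.
exists n; have := Hn n (leqnn n); rewrite /= sub0r normrN ger0_norm ?exprn_ge0 ?invr_ge0//.
by rewrite ler_pdivlMr// mulrC.
Qed.

(** The iterates of the clamped Picard operator converge geometrically; the
    limit is produced pointwise, as the supremum of increasing lower bounds. *)
Theorem Picard (H : R -> R -> R) (K B : R) : 0 < K -> 0 < B ->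
  (forall a b a' b', `|H a b - H a' b'| <= K * (`|a - a'| + `|b - b'|)) ->
  (forall a b, `|H a b| <= B) ->
  exists2 e : R, 0 < e & exists2 y : R -> R, y 0 = 0 &
    forall t : R, - e < t < e -> is_derive t (1 : R) y (H t (y t)).
Proof.
move=> K0 B0 HK HB.
pose e := Num.min (2^-1) (2 * K)^-1.
have e0 : 0 < e by rewrite lt_min !invr_gt0 mulr_gt0// ltr0n.
have e1 : e < 1 by rewrite gt_min; apply/orP; left; lra.
have eK : e * K <= 2^-1.
  rewrite -ler_pdivlMr// -invfM.
  by rewrite ge_min; apply/orP; right.
have cH u : continuous u -> continuous (fun t => H t (u t)).
  move=> cu x; apply/cvgrPdist_le => d d0.
  have dK : 0 < d / (2 * K) by rewrite divr_gt0// mulr_gt0.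
  near=> t.
  apply: (le_trans (HK _ _ _ _)).
  have : `|x - t| <= d / (2 * K) by near: t; exact: cvgr_dist_le.
  have : `|u x - u t| <= d / (2 * K) by near: t; apply: cvgr_dist_le => //; exact: cu.
  have -> : d / (2 * K) = d / 2 / K by rewrite invfM mulrA.
  rewrite !ler_pdivlMr// => h1 h2; rewrite mulrDr; lra.
(* [P u] is an antiderivative of [H t (u t)] vanishing at 0 *)
have [P HP] : exists P : (R -> R) -> R -> R, forall u, continuous u ->
    P u 0 = 0 /\ forall x : R, -1 < x < 1 -> is_derive x (1 : R) (P u) (H x (u x)).
  have : forall u, exists G : R -> R, continuous u ->
      G 0 = 0 /\ forall x : R, -1 < x < 1 -> is_derive x (1 : R) G (H x (u x)).
    move=> u; case: (pselect (continuous u)) => cu; last by exists u.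
    by have [G G0 dG] := antiderivative (cH u cu); exists G.
  by move=> /choice[P HP]; exists P.
pose Q u x := P u (clamp e x).
have cle x : -1 < clamp e x < 1.
  by have := clamp_le x (ltW e0); move: e1; lra.
have Qlip u : continuous u -> forall x x', `|Q u x - Q u x'| <= B * `|x - x'|.
  move=> cu x x'; have [_ dP] := HP u cu.
  apply: (le_trans (MVT_bound dP _ (cle x) (cle x'))).
    by move=> *; exact: HB.
  by rewrite ler_pM2l// clamp_lip.
have cQ u : continuous u -> continuous (Q u).
  by move=> cu; apply: (lipschitz_continuous (ltW B0)); exact: Qlip.
have Qcontr u v (d : R) : continuous u -> continuous v ->
    (forall x, `|u x - v x| <= d) -> forall x, `|Q u x - Q v x| <= 2^-1 * d.
  move=> cu cv uv x; have [P0 dP] := HP u cu; have [P0' dP'] := HP v cv.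
  have dd (y : R) : -1 < y < 1 -> is_derive y (1 : R) (P u \- P v) (H y (u y) - H y (v y)).
    by move=> y1; apply: is_deriveB; [exact: dP|exact: dP'].
  have bd (y : R) : -1 < y < 1 -> `|H y (u y) - H y (v y)| <= K * d.
    by move=> _; apply: (le_trans (HK _ _ _ _)); rewrite subrr normr0 add0r ler_pM2l.
  have z01 : - 1 < (0 : R) < 1 by apply/andP; split; [exact: ltrN10|exact: ltr01].
  have := MVT_bound dd bd (cle x) z01.
  rewrite /= P0 P0' !subr0 => /le_trans; apply.
  have d0 : 0 <= d by exact: le_trans (uv 0).
  have : `|clamp e x| <= e by rewrite ler_norml clamp_le// ltW.
  move=> h; have : K * d * `|clamp e x| <= K * d * e by rewrite ler_wpM2l// mulr_ge0// ltW.
  move=> /le_trans; apply; rewrite mulrAC [K * e]mulrC; exact: ler_wpM2r.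
pose u_ := fix u_ (n : nat) : R -> R := if n is n'.+1 then Q (u_ n') else (fun=> 0).
have cu n : continuous (u_ n).
  by elim: n => [|n IH]; [exact: cst_continuous|exact: cQ].
have step n x : `|u_ n.+1 x - u_ n x| <= B * 2^-1 ^+ n.
  elim: n x => [|n IH] x.
    rewrite expr0 mulr1 subr0.
    have [P0 _] := HP _ (cu 0%N).
    have [P0' dP] := HP _ (cu 0%N).
    have z01 : - 1 < (0 : R) < 1 by apply/andP; split; [exact: ltrN10|exact: ltr01].
    have := MVT_bound dP (fun x _ => HB x _) (cle x) z01.
    rewrite P0' !subr0 => /le_trans; apply.
    by rewrite ger_pMr// ler_norml; have := cle x; lra.
  by rewrite exprS mulrCA; exact: (Qcontr (u_ n.+1) (u_ n) (B * 2^-1 ^+ n) (cu n.+1) (cu n) IH x).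
have [y Hy] : exists y : R -> R, forall x n, `|y x - u_ n x| <= 2 * B * 2^-1 ^+ n.
  pose a x n := u_ n x - 2 * B * 2^-1 ^+ n.
  pose b x n := u_ n x + 2 * B * 2^-1 ^+ n.
  have aS x n m : (n <= m)%N -> a x n <= a x m.
    move=> nm; rewrite -(subnK nm); elim: (m - n)%N => [//|k IH].
    apply: (le_trans IH); rewrite addSn /a exprS.
    by have := step (k + n)%N x; rewrite ler_norml; lra.
  have bS x n m : (n <= m)%N -> b x m <= b x n.
    move=> nm; rewrite -(subnK nm); elim: (m - n)%N => [//|k IH].
    apply: le_trans IH; rewrite addSn /b exprS.
    by have := step (k + n)%N x; rewrite ler_norml; lra.
  have ab x n : a x n <= b x n.
    have p0 : 0 <= B * 2^-1 ^+ n by rewrite mulr_ge0 ?exprn_ge0 ?invr_ge0// ltW.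
    by rewrite /a /b -mulrA; lra.
  have ab' x n m : a x n <= b x m.
    have h1 := aS x n (maxn n m) (leq_maxl _ _).
    have h2 := bS x m (maxn n m) (leq_maxr _ _).
    exact: le_trans h1 (le_trans (ab _ _) h2).
  have sa x : has_sup (range (a x)).
    split; first by exists (a x 0%N), 0%N.
    by exists (b x 0%N) => _ [n _ <-].
  exists (fun x => sup (range (a x))) => x n.
  have h1 : a x n <= sup (range (a x)) by apply: sup_upper_bound => //; exists n.
  have h2 : sup (range (a x)) <= b x n.
    by apply: ge_sup => [|_ [m _ <-]]; [exact: (sa x).1|exact: ab'].
  move: h1 h2; set s := sup _; rewrite /a /b => h1 h2.
  by rewrite ler_norml; apply/andP; split; lra.
have small (z C : R) : 0 <= z -> (forall n : nat, z <= C * 2^-1 ^+ n) -> z = 0.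
  move=> z0 Hz; apply/eqP; rewrite eq_le z0 andbT; apply/ler_addgt0Pr => d d0.
  by have [n Hn] := half_pow_small C d0; rewrite add0r (le_trans (Hz n)).
have cy : continuous y.
  apply: (lipschitz_continuous (ltW B0)) => x x'.
  apply/ler_addgt0Pr => d d0.
  have [n Hn] := half_pow_small (4 * B) d0.
  have h1 := Hy x n.+1; have h2 := Hy x' n.+1.
  have h3 : `|u_ n.+1 x - u_ n.+1 x'| <= B * `|x - x'| by exact: Qlip.
  have -> : y x - y x' = (y x - u_ n.+1 x) + (u_ n.+1 x - u_ n.+1 x') - (y x' - u_ n.+1 x').
    by ring.
  apply: (le_trans (ler_normB _ _)).
  have h4 := ler_normD (y x - u_ n.+1 x) (u_ n.+1 x - u_ n.+1 x').
  move: h1 h2 h3 h4 Hn; rewrite exprS.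
  have : 0 <= B * 2^-1 ^+ n by rewrite mulr_ge0 ?exprn_ge0 ?invr_ge0// ltW.
  move=> *; lra.
have yQ x : y x = Q y x.
  apply/eqP; rewrite -subr_eq0 -normr_eq0; apply/eqP.
  apply: (small _ (4 * B)) => // n.
  have h1 := Hy x n.+1.
  have h2 : `|Q y x - u_ n.+1 x| <= 2^-1 * (2 * B * 2^-1 ^+ n).
    by apply: Qcontr => // x'; exact: Hy.
  have -> : y x - Q y x = (y x - u_ n.+1 x) - (Q y x - u_ n.+1 x) by ring.
  apply: (le_trans (ler_normB _ _)); move: h1 h2; rewrite exprS.
  have : 0 <= B * 2^-1 ^+ n by rewrite mulr_ge0 ?exprn_ge0 ?invr_ge0// ltW.
  move=> *; lra.
have [P0 dP] := HP y cy.
exists e => //; exists y.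
  by rewrite yQ /Q clamp_id ?P0// oppr_le0 ltW.
move=> t /andP[t1 t2].
have tt : -1 < t < 1 by lra.
apply: (near_eq_is_derive _ (dP t tt)).
have tin : t \in `]-e, e[ by rewrite in_itv/= t1.
apply: filterS (near_in_itvoo tin) => s.
by rewrite in_itv/= => /andP[s1 s2]; rewrite yQ /Q clamp_id// !ltW.
Unshelve. all: by end_near. Qed.

End Picard.

(** * Legendrian curves with straight projection *)

Section PlaneCurves.
Context {R : realType}.

Lemma derive0_cst (w : R -> R) (e : R) :
  (forall t : R, - e < t < e -> is_derive t (1 : R) w 0) ->
  forall t, - e < t < e -> w t = w 0.
Proof.
move=> dw t te; have e0 : 0 < e by move: te => /andP[]; lra.
have z0 : - e < 0 < e by rewrite oppr_lt0 e0.
have bw x : - e < x < e -> `|0 : R| <= 0 by rewrite normr0.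
have := MVT_bound dw bw te z0; rewrite mul0r.
by rewrite normr_le0 subr_eq0 => /eqP.
Qed.

(** Zero curvature keeps the direction of the projection constant: its
    component [psi] normal to the initial velocity, divided by the tangential
    one [s], has zero derivative.  The contact form then determines the third
    coordinate. *)
Lemma straight_legendrian (x y z dx dy dz ddx ddy : R -> R) (e : R) : 0 < e ->
  (forall t : R, - e < t < e ->
     [/\ is_derive t (1 : R) x (dx t), is_derive t (1 : R) y (dy t) &
         is_derive t (1 : R) z (dz t)] /\
     [/\ is_derive t (1 : R) dx (ddx t), is_derive t (1 : R) dy (ddy t),
        dz t + x t * dy t - y t * dx t = 0 & dx t * ddy t - dy t * ddx t = 0]) ->
  0 < dx 0 ^+ 2 + dy 0 ^+ 2 ->
  exists2 e' : R, 0 < e' <= e & exists s : R -> R, forall t, - e' < t < e' ->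
    [/\ x t = x 0 + s t * dx 0, y t = y 0 + s t * dy 0 & z t = z 0 + s t * dz 0].
Proof.
move=> e0 H; set u := dx 0; set v := dy 0 => uv0.
pose s t := u * dx t + v * dy t.
pose psi t := u * dy t - v * dx t.
have z0 : - e < 0 < e by rewrite oppr_lt0 e0.
have ds t : - e < t < e -> is_derive t (1 : R) s (u * ddx t + v * ddy t).
  by move=> /H[_ [dx' dy' _ _]]; apply: is_deriveD.
have dpsi t : - e < t < e -> is_derive t (1 : R) psi (u * ddy t - v * ddx t).
  by move=> /H[_ [dx' dy' _ _]]; apply: is_deriveB.
have s0 : 0 < s 0 by rewrite /s -!expr2.
have [e' /andP[e'0 e'e] se'] : exists2 e' : R, 0 < e' <= e &
    forall t, - e' < t < e' -> 0 < s t.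
  have cs : {for (0 : R), continuous s}.
    apply: differentiable_continuous; apply/derivable1_diffP.
    by case: (ds 0 z0).
  have : \forall t \near (0 : R), 0 < s t by exact: (cvgr_gt (s 0) cs).
  move=> /nbhs_normP[d /= d0 Hd].
  exists (Num.min d e); first by rewrite lt_min d0 e0 ge_min lexx orbT.
  move=> t /andP[t1 t2]; apply: Hd; rewrite /ball_ /= sub0r normrN.
  rewrite ltr_norml; move: t1 t2; rewrite ltrNl !lt_min => /andP[t1 _] /andP[-> _].
  by rewrite ltrNl t1.
have sub t : - e' < t < e' -> - e < t < e by move=> /andP[t1 t2]; apply/andP; split; lra.
have psi0 t : - e' < t < e' -> psi t = 0.
  move=> te.
  have dq t' : - e' < t' < e' -> is_derive t' (1 : R) (fun t => psi t * (s t)^-1) 0.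
    move=> te'; have st := se' _ te'; have sn : s t' != 0 by rewrite gt_eqF.
    have d1 := ds _ (sub _ te'); have d2 := dpsi _ (sub _ te').
    have d3 := is_deriveV sn d1.
    have d4 := is_deriveM d2 d3.
    apply: (is_derive_eq d4); rewrite /GRing.scale/=.
    have [_ [_ _ _ k]] := H _ (sub _ te').
    have -> : psi t' * (- s t' ^- 2 * (u * ddx t' + v * ddy t')) +
       (s t')^-1 * (u * ddy t' - v * ddx t') =
       (s t')^- 2 * (s t' * (u * ddy t' - v * ddx t') - psi t' * (u * ddx t' + v * ddy t')).
      by field.
    have -> : s t' * (u * ddy t' - v * ddx t') - psi t' * (u * ddx t' + v * ddy t') =
      (u ^+ 2 + v ^+ 2) * (dx t' * ddy t' - dy t' * ddx t').
      by rewrite /s /psi; ring.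
    by rewrite k !mulr0.
  have psi00 : psi 0 = 0 by rewrite /psi -/u -/v [v * u]mulrC subrr.
  have := derive0_cst dq te; rewrite psi00 mul0r => /eqP.
  by rewrite mulf_eq0 invr_eq0 [s t == 0]gt_eqF ?orbF ?se'// => /eqP.
pose N := u ^+ 2 + v ^+ 2.
have N0 : N != 0 by rewrite gt_eqF.
pose si t := N^-1 * (u * (x t - x 0) + v * (y t - y 0)).
have dsi t : - e' < t < e' -> is_derive t (1 : R) si (N^-1 * s t).
  move=> /sub/H[[dx' dy' _] _]; apply: is_derive_eq.
  by rewrite /GRing.scale/= /s !subr0.
have dxE t : - e' < t < e' -> dx t = N^-1 * s t * u.
  move=> /psi0; rewrite /psi => p0; apply: (mulfI N0).
  have -> : N * (N^-1 * s t * u) = s t * u by field.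
  apply/eqP; rewrite -subr_eq0; apply/eqP.
  transitivity (- v * (u * dy t - v * dx t)); last by rewrite p0 mulr0.
  by rewrite /N /s; ring.
have dyE t : - e' < t < e' -> dy t = N^-1 * s t * v.
  move=> /psi0; rewrite /psi => p0; apply: (mulfI N0).
  have -> : N * (N^-1 * s t * v) = s t * v by field.
  apply/eqP; rewrite -subr_eq0; apply/eqP.
  transitivity (u * (u * dy t - v * dx t)); last by rewrite p0 mulr0.
  by rewrite /N /s; ring.
have si0 : si 0 = 0 by rewrite /si !subrr !mulr0 addr0 mulr0.
have xE t : - e' < t < e' -> x t = x 0 + si t * u.
  move=> te.
  have dd t' : - e' < t' < e' -> is_derive t' (1 : R) (fun t => x t - si t * u) 0.
    move=> te'; have [[dx' _ _] _] := H _ (sub _ te'); have ds' := dsi _ te'.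
    apply: is_derive_eq; rewrite /GRing.scale/= (dxE _ te'); ring.
  by have := derive0_cst dd te; rewrite si0 mul0r subr0 => <-; rewrite subrK.
have yE t : - e' < t < e' -> y t = y 0 + si t * v.
  move=> te.
  have dd t' : - e' < t' < e' -> is_derive t' (1 : R) (fun t => y t - si t * v) 0.
    move=> te'; have [[_ dy' _] _] := H _ (sub _ te'); have ds' := dsi _ te'.
    apply: is_derive_eq; rewrite /GRing.scale/= (dyE _ te'); ring.
  by have := derive0_cst dd te; rewrite si0 mul0r subr0 => <-; rewrite subrK.
exists e'; first by rewrite e'0.
exists si => t te; split; [exact: xE|exact: yE|].
have dz0 : dz 0 = y 0 * u - x 0 * v.
  have [_ [_ _ k _]] := H _ z0.
  by move: k; rewrite -/u -/v => k; lra.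
have dd t' : - e' < t' < e' -> is_derive t' (1 : R) (fun t => z t - si t * dz 0) 0.
  move=> te'; have [[_ _ dz'] [_ _ k _]] := H _ (sub _ te'); have ds' := dsi _ te'.
  apply: is_derive_eq; rewrite /GRing.scale/=.
  have -> : dz t' = y t' * dx t' - x t' * dy t' by lra.
  by rewrite (xE _ te') (yE _ te') (dxE _ te') (dyE _ te') dz0; ring.
by have := derive0_cst dd te; rewrite si0 mul0r subr0 => <-; rewrite subrK.
Qed.

End PlaneCurves.

(** * Planar differential equations *)

Section PlaneODE.
Context {R : realType}.

Definition pt2 (a b : R) : 'rV[R]_2 := \row_(i < 2) (if i == 0 then a else b).

Lemma pt2E a b : (pt2 a b 0 0 = a) * (pt2 a b 0 1 = b).
Proof. by split; rewrite mxE. Qed.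

Lemma pt2_eta (y : 'rV[R]_2) : y = pt2 (y 0 0) (y 0 1).
Proof.
apply/rowP => i; rewrite mxE; case: (unliftP 0 i) => [j ->|->//].
by rewrite (ord1 j) /=; congr (y 0 _); apply: val_inj.
Qed.

Lemma pt2_norm_lt a b r : `|a| < r -> `|b| < r -> `|pt2 a b| < r.
Proof.
move=> ar br; apply: norm_rV_lt => [|i]; first exact: le_lt_trans ar.
by rewrite mxE; case: ifP.
Qed.

Lemma pt2_norm_le a b : `|pt2 a b| <= `|a| + `|b|.
Proof.
apply: norm_rV_le => [|i]; first exact: addr_ge0.
by rewrite mxE; case: ifP => _; rewrite ?lerDl ?lerDr.
Qed.

Lemma pt2B a b a' b' : pt2 a b - pt2 a' b' = pt2 (a - a') (b - b').
Proof. by apply/rowP => i; rewrite !mxE; case: ifP. Qed.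

Lemma pt20 : pt2 0 0 = 0.
Proof. by apply/rowP => i; rewrite !mxE; case: ifP. Qed.

Lemma norm_pt2 (y : 'rV[R]_2) r : `|y| < r -> `|y 0 0| < r /\ `|y 0 1| < r.
Proof. by move=> yr; split; exact: le_lt_trans (entry_le_norm _ _) yr. Qed.

Lemma diff_pt2 (W : normedModType R) (g : 'rV[R]_2 -> W) u d : differentiable g u ->
  'd g u d = d 0 0 *: 'D_('e_0) g u + d 0 1 *: 'D_('e_1) g u.
Proof.
move=> dg; apply: (etrans (diff_rV d dg)).
rewrite big_ord_recl big_ord_recl big_ord0 addr0.
by congr (_ + d 0 _ *: 'D_('e_ _) g u); apply: val_inj.
Qed.

Lemma Ck_on_pt2 k (U : set R) (x y : R -> R) : open U -> Ck_on k U x -> Ck_on k U y ->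
  Ck_on k U (fun t => pt2 (x t) (y t)).
Proof.
move=> oU Cx Cy; apply: (@Ck_on_rV R _ 2 k U _ oU) => i.
case: (altP (i =P 0)) => [->|i0].
  by apply: (Ck_on_eq oU _ Cx) => t _; rewrite pt2E.
by apply: (Ck_on_eq oU _ Cy) => t _; rewrite mxE (negbTE i0).
Qed.

Lemma Ck_on_id (V : normedModType R) k (U : set V) : Ck_on k U (fun t : V => t).
Proof. by apply: (@Ck_on_linear R V V k U idfun) => x; exact: cvg_id. Qed.

Lemma segment_continuous (a b e1 e2 s : R) :
  {for s, continuous (fun s : R => pt2 (a + s * e1) (b + s * e2))}.
Proof.
have aff (c e : R) : Ck_on 0 setT (fun s : R => c + s * e).
  apply: (Ck_onD openT); first exact: Ck_on_cst.
  by apply: (Ck_onM openT); [exact: Ck_on_id|exact: Ck_on_cst].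
exact: (@Ck_on_pt2 0 setT _ _ openT (aff a e1) (aff b e2) s Logic.I).
Qed.

(** Being of class C^1 makes [H] Lipschitz near the origin, and clamping its
    arguments makes it globally so. *)
Lemma planar_ODE (U : set 'rV[R]_2) (H : 'rV[R]_2 -> R) : open U -> U 0 ->
  Ck_on 1 U H ->
  exists2 e : R, 0 < e & exists2 y : R -> R, y 0 = 0 & forall t, - e < t < e ->
    U (pt2 t (y t)) /\ is_derive t (1 : R) y (H (pt2 t (y t))).
Proof.
move=> oU U0 CH; have [dH _] := CH.
have [d1 d10 H1] := C1_strict_scalar oU U0 CH ltr01.
have /nbhs_normP[d2 /= d20 H2] := open_nbhs_nbhs (conj oU U0).
have [k k0 Hk] := linear_lipschitz (diff_continuous (dH 0 U0)).
pose d := Num.min d1 d2.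
have d0 : 0 < d by rewrite lt_min d10 d20.
have dU u : `|u| < d -> U u.
  by move=> ud; apply: H2; rewrite /ball_ /= sub0r normrN (lt_le_trans ud)// ge_min lexx orbT.
pose K := k + 1.
have K0 : 0 < K by rewrite ltr_wpDl// ltW.
have HK u u' : `|u| < d -> `|u'| < d -> `|H u - H u'| <= K * `|u - u'|.
  move=> ud u'd.
  have d1' (z : 'rV[R]_2) : `|z| < d -> `|z - 0| < d1.
    by rewrite subr0 => /lt_le_trans; apply; rewrite ge_min lexx.
  have h1 := H1 u u' (d1' _ ud) (d1' _ u'd); have h2 := Hk (u - u').
  have := ler_normD (H u - H u' - 'd H 0 (u - u')) ('d H 0 (u - u')).
  rewrite subrK => /le_trans; apply; rewrite /K mulrDl [leLHS]addrC.
  by apply: lerD; [exact: h2|exact: h1].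
pose e := d / 2.
have e0 : 0 < e by rewrite divr_gt0.
have ed : e < d by rewrite /e; lra.
pose Hc a b := H (pt2 (clamp e a) (clamp e b)).
have cd a : `|clamp e a| < d.
  by apply: le_lt_trans ed; rewrite ler_norml clamp_le// ltW.
have cpd a b : `|pt2 (clamp e a) (clamp e b)| < d by exact: pt2_norm_lt.
pose B := `|H 0| + K * d.
have B0 : 0 < B by rewrite ltr_wpDl// mulr_gt0.
have [|a b|e1 e10 [y y0 dy]] := @Picard R Hc K B K0 B0.
- move=> a b a' b'; apply: (le_trans (HK _ _ (cpd _ _) (cpd _ _))).
  rewrite ler_pM2l// pt2B (le_trans (pt2_norm_le _ _))//.
  by rewrite lerD// clamp_lip.
- have z0 : `|0 : 'rV[R]_2| < d by rewrite normr0.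
  have := HK _ _ (cpd a b) z0; rewrite subr0 => h.
  have := ler_normD (Hc a b - H 0) (H 0).
  rewrite subrK => /le_trans; apply; rewrite /B [leLHS]addrC lerD//.
  by apply: (le_trans h); rewrite ler_pM2l// ltW.
have cy : {for (0 : R), continuous y}.
  apply: differentiable_continuous; apply/derivable1_diffP.
  have z0 : - e1 < 0 < e1 by rewrite oppr_lt0 e10.
  by case: (dy 0 z0).
have : \forall t \near (0 : R), `|y t| < e.
  have cy' : y t @[t --> (0 : R)] --> y 0 := cy.
  have : \forall t \near (0 : R), `|y 0 - y t| < e by exact: cvgr_dist_lt cy' _ e0.
  by apply: filterS => t; rewrite y0 sub0r normrN.
move=> /nbhs_normP[e2 /= e20 He2].
pose e' := Num.min e1 (Num.min e e2).
exists e'; first by rewrite !lt_min e10 e0 e20.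
exists y => // t; rewrite ltrNl !lt_min => /andP[/and3P[t1 t2 t3] /and3P[t4 t5 t6]].
have ye : `|y t| < e.
  by apply: He2; rewrite /ball_ /= sub0r normrN ltr_norml t6 ltrNl t3.
have te : `|t| < e by rewrite ltr_norml t5 ltrNl t2.
split; first by apply: dU; apply: pt2_norm_lt; exact: lt_trans ed.
have := dy t; rewrite t4 ltrNl t1 /Hc !clamp_id; first exact.
  by rewrite -ler_norml ltW.
by rewrite -ler_norml ltW.
Qed.

Lemma planar_ODE_C2 (U : set 'rV[R]_2) (H : 'rV[R]_2 -> R) (e : R) (y : R -> R) :
  open U -> Ck_on 1 U H -> (forall t, - e < t < e ->
    U (pt2 t (y t)) /\ is_derive t (1 : R) y (H (pt2 t (y t)))) ->
  Ck_on 2 `]- e, e[%classic y.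
Proof.
move=> oU CH dy; set I := `]- e, e[%classic.
have oI : open I by exact: itv_open.
have dyI t : I t -> U (pt2 t (y t)) /\ is_derive t (1 : R) y (H (pt2 t (y t))).
  by rewrite /I /= in_itv; exact: dy.
have dd t : I t -> differentiable y t.
  by move=> /dyI[_ [h _]]; exact/derivable1_diffP.
have step k : (k <= 1)%N -> Ck_on k I y -> Ck_on k.+1 I y.
  move=> k1 Cy; split=> [//|v].
  have C : Ck_on k I (H \o (fun t => pt2 t (y t))).
    apply: (@Ck_on_comp R _ 2 k I U (fun t => pt2 t (y t)) H oI).
    - by move=> t /dyI[].
    - by apply: Ck_on_pt2 => //; exact: Ck_on_id.
    - exact: Ck_on_leq CH.
  have C' := Ck_onM oI (Ck_on_cst k I (v : R)) C.
  apply: (Ck_on_eq oI _ C') => t It /=.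
  have [_ [_ <-]] := dyI t It.
  rewrite (deriveE v (dd t It)) (deriveE (1 : R) (dd t It)) -[in RHS](mulr1 v).
  exact: (esym (linearZ _ _)).
apply: (step 1%N) => //; apply: (step 0%N) => //.
by move=> t It; apply: differentiable_continuous; exact: dd.
Qed.

End PlaneODE.

(** * The contact form and tangent planes *)

Section Vectors.
Context {R : realType}.
Implicit Types (p q v w n : 'rV[R]_3).

Definition row3 (a b c : R) : 'rV[R]_3 :=
  \row_(i < 3) (if i == 0 then a else if i == 1 then b else c).

Lemma row3E a b c : [/\ xco (row3 a b c) = a, yco (row3 a b c) = b & zco (row3 a b c) = c].
Proof. by split; rewrite /xco /yco /zco mxE. Qed.

Lemma row3P v w : xco v = xco w -> yco v = yco w -> zco v = zco w -> v = w.
Proof.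
rewrite /xco /yco /zco => hx hy hz; apply/rowP => i.
case: (unliftP 0 i) => [j ->|->//].
case: (unliftP 0 j) => [k ->|->].
  by rewrite (ord1 k); move: hz; congr (v 0 _ = w 0 _); apply: val_inj.
by move: hy; congr (v 0 _ = w 0 _); apply: val_inj.
Qed.

Lemma coD v w : [/\ xco (v + w) = xco v + xco w, yco (v + w) = yco v + yco w
  & zco (v + w) = zco v + zco w].
Proof. by rewrite /xco /yco /zco !mxE. Qed.

Lemma coZ (a : R) w : [/\ xco (a *: w) = a * xco w, yco (a *: w) = a * yco w
  & zco (a *: w) = a * zco w].
Proof. by rewrite /xco /yco /zco !mxE. Qed.

Lemma co0 : [/\ xco (0 : 'rV[R]_3) = 0, yco (0 : 'rV[R]_3) = 0 & zco (0 : 'rV[R]_3) = 0].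
Proof. by rewrite /xco /yco /zco !mxE. Qed.

Lemma ThetaD p v w : Theta p (v + w) = Theta p v + Theta p w.
Proof. by rewrite /Theta; have [-> -> ->] := coD v w; ring. Qed.

Lemma ThetaZ p (a : R) w : Theta p (a *: w) = a * Theta p w.
Proof. by rewrite /Theta; have [-> -> ->] := coZ a w; ring. Qed.

Lemma Theta0 p : Theta p 0 = 0.
Proof. by have := ThetaZ p 0 0; rewrite scale0r mul0r. Qed.

Lemma Theta_line p (a : R) w : Theta (p + a *: w) w = Theta p w.
Proof.
rewrite /Theta; have [-> -> _] := coD p (a *: w); have [-> -> _] := coZ a w; ring.
Qed.

Lemma Theta_neq0 p : exists v, Theta p v != 0.
Proof.
exists (row3 0 0 1); rewrite /Theta; have [-> -> ->] := row3E 0 0 1.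
by rewrite !mulr0 addr0 subr0 oner_neq0.
Qed.

Definition det3 v w n : R :=
  xco v * (yco w * zco n - zco w * yco n) - yco v * (xco w * zco n - zco w * xco n)
  + zco v * (xco w * yco n - yco w * xco n).

Lemma frame_unit v w n : det3 v w n != 0 -> frame v w n \in unitmx.
Proof.
move=> D0; rewrite -row_free_unit; apply: inj_row_free => u.
rewrite mul_frame.
set a := u 0 0; set b := u 0 1; set c := u 0 ord_max => E.
have E3 : [/\ a * xco v + b * xco w + c * xco n = 0, a * yco v + b * yco w + c * yco n = 0 &
    a * zco v + b * zco w + c * zco n = 0].
  by split; [move: (congr1 xco E)|move: (congr1 yco E)|move: (congr1 zco E)];
    rewrite /xco /yco /zco !mxE.
have {E3}[Ex Ey Ez] := E3.
have [x0 y0 z0] := co0.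
apply: row3P; rewrite ?x0 ?y0 ?z0; apply: (mulfI D0); rewrite mulr0.
- transitivity ((a * xco v + b * xco w + c * xco n) * (yco w * zco n - zco w * yco n)
    - (a * yco v + b * yco w + c * yco n) * (xco w * zco n - zco w * xco n)
    + (a * zco v + b * zco w + c * zco n) * (xco w * yco n - yco w * xco n)).
    by rewrite /det3 -[xco u]/a; ring.
  by rewrite Ex Ey Ez; ring.
- transitivity ((a * xco v + b * xco w + c * xco n) * (zco v * yco n - yco v * zco n)
    - (a * yco v + b * yco w + c * yco n) * (zco v * xco n - xco v * zco n)
    + (a * zco v + b * zco w + c * zco n) * (yco v * xco n - xco v * yco n)).
    by rewrite /det3 -[yco u]/b; ring.
  by rewrite Ex Ey Ez; ring.
- transitivity ((a * xco v + b * xco w + c * xco n) * (yco v * zco w - zco v * yco w)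
    - (a * yco v + b * yco w + c * yco n) * (xco v * zco w - zco v * xco w)
    + (a * zco v + b * zco w + c * zco n) * (xco v * yco w - yco v * xco w)).
    by rewrite /det3 -[zco u]/c; ring.
  by rewrite Ex Ey Ez; ring.
Qed.

(** A horizontal vector is determined by its projection. *)
Lemma legendrian_xy p w : Theta p w = 0 -> w != 0 -> 0 < xco w ^+ 2 + yco w ^+ 2.
Proof.
rewrite /Theta => T0 w0.
rewrite lt_neqAle addr_ge0 ?sqr_ge0// andbT eq_sym paddr_eq0 ?sqr_ge0// !sqrf_eq0.
apply: contra w0 => /andP[/eqP x0 /eqP y0]; apply/eqP.
move: T0; rewrite x0 y0 !mulr0 addr0 subr0 => z0.
by apply: row3P; rewrite ?x0 ?y0 ?z0 /xco /yco /zco mxE.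
Qed.

Lemma Ck_on_Theta (V : normedModType R) k (U : set V) (q v : V -> 'rV[R]_3) :
  open U -> Ck_on k U q -> Ck_on k U v -> Ck_on k U (fun u => Theta (q u) (v u)).
Proof.
move=> oU Cq Cv.
apply: (Ck_onB oU); last exact: (Ck_onM oU (Ck_on_entry 1 oU Cq) (Ck_on_entry 0 oU Cv)).
apply: (Ck_onD oU); first exact: (Ck_on_entry ord_max oU Cv).
exact: (Ck_onM oU (Ck_on_entry 0 oU Cq) (Ck_on_entry 1 oU Cv)).
Qed.

End Vectors.

Section Tangent.
Context {R : realType} {M : topologicalType}.
Context (A : set (chart R M)) (f : M -> 'rV[R]_3).
Context (hM : C2_2manifold A) (hf : C2_immersion A f).

Notation T := (tangent_plane A f).

(** Any nonzero tangent vector starts a basis of the tangent plane, which in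
    turn extends to a frame: local graphs can be taken along a given tangent
    direction. *)
Lemma tangent_basis m w : T m w -> w != 0 ->
  exists v n, T m v /\ frame w v n \in unitmx.
Proof.
have [c Ac dm] := chart_of hM m; have cu : cdom c (coord c m) by exists m.
move=> /(tangent_chart hM hf Ac dm)[a wa] w0.
have [CX iX] := hf Ac.
have [L LE] : exists L : {linear 'rV[R]_2 -> 'rV[R]_3},
    forall v, 'd (f \o param c) (coord c m) v = L v.
  by exists ('d (f \o param c) (coord c m)).
have {}wa : w = L a := etrans wa (LE a).
have iL : injective L by move=> x y; rewrite -!LE; exact: iX.
pose b := pt2 (- a 0 1) (a 0 0).
pose v := L b.
have Tv : T m v by exists c; split => //; exists b; rewrite LE.
pose x := yco w * zco v - zco w * yco v.
pose y := zco w * xco v - xco w * zco v.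
pose z := xco w * yco v - yco w * xco v.
exists v, (row3 x y z); split => //.
apply: frame_unit; rewrite /det3; have [-> -> ->] := row3E x y z.
have -> : xco w * (yco v * z - zco v * y) - yco w * (xco v * z - zco v * x) +
  zco w * (xco v * y - yco v * x) = x ^+ 2 + y ^+ 2 + z ^+ 2.
  by rewrite /x /y /z; ring.
apply/eqP => /eqP; rewrite !paddr_eq0 ?addr_ge0 ?sqr_ge0// !sqrf_eq0.
move=> /andP[/andP[/eqP x0 /eqP y0] /eqP z0].
pose N := xco w ^+ 2 + yco w ^+ 2 + zco w ^+ 2.
pose k := xco w * xco v + yco w * yco v + zco w * zco v.
have N0 : N != 0.
  apply: contra w0; rewrite !paddr_eq0 ?addr_ge0 ?sqr_ge0// !sqrf_eq0.
  move=> /andP[/andP[/eqP x0' /eqP y0'] /eqP z0'].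
  by apply/eqP/row3P; rewrite ?x0' ?y0' ?z0' /xco /yco /zco mxE.
have E : N *: v = k *: w.
  have [X1 Y1 Z1] := coZ N v; have [X2 Y2 Z2] := coZ k w.
  apply: row3P; rewrite ?X1 ?X2 ?Y1 ?Y2 ?Z1 ?Z2; apply/eqP; rewrite -subr_eq0; apply/eqP.
  - by transitivity (zco w * y - yco w * z); [rewrite /N /k /y /z; ring|rewrite y0 z0; ring].
  - by transitivity (xco w * z - zco w * x); [rewrite /N /k /x /z; ring|rewrite x0 z0; ring].
  - by transitivity (yco w * x - xco w * y); [rewrite /N /k /x /y; ring|rewrite x0 y0; ring].
have {}E : N *: b = k *: a by apply: iL; rewrite !linearZ/= -wa.
have E0 : N * - a 0 1 = k * a 0 0 by move: (congr1 (fun u : 'rV[R]_2 => u 0 0) E); rewrite !mxE.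
have E1 : N * a 0 0 = k * a 0 1 by move: (congr1 (fun u : 'rV[R]_2 => u 0 1) E); rewrite !mxE.
have : N * (a 0 0 ^+ 2 + a 0 1 ^+ 2) = 0.
  transitivity (N * a 0 0 * a 0 0 - N * - a 0 1 * a 0 1); first by ring.
  by rewrite E0 E1; ring.
move=> /eqP; rewrite mulf_eq0 (negbTE N0)/= paddr_eq0 ?sqr_ge0// !sqrf_eq0.
move=> /andP[/eqP a0 /eqP a1]; move/eqP: w0; apply.
by rewrite wa (pt2_eta a) a0 a1 pt20 linear0.
Qed.

Lemma tangent0 m : T m 0.
Proof.
have [c Ac dm] := chart_of hM m; exists c; split => //; exists 0.
by rewrite (linear0 ('d (f \o param c) (coord c m))).
Qed.

Lemma tangent_neq0 m : exists2 w, T m w & w != 0.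
Proof.
have [c Ac dm] := chart_of hM m; have cu : cdom c (coord c m) by exists m.
have [_ /(_ _ cu) iX] := hf Ac.
exists ('d (f \o param c) (coord c m) (pt2 1 0)).
  by exists c; split => //; exists (pt2 1 0).
apply/eqP => E.
have E0 : 'd (f \o param c) (coord c m) 0 = 0 by exact: linear0.
have /(congr1 (fun u : 'rV[R]_2 => u 0 0)) : pt2 1 0 = 0 :> 'rV[R]_2.
  by apply: iX; exact: (etrans E (esym E0)).
by rewrite pt2E mxE => /eqP; rewrite oner_eq0.
Qed.

Section Graph.
Context (m : M) (v1 v2 n : 'rV[R]_3) (r : R) (G : 'rV[R]_2 -> M)
  (phi : 'rV[R]_2 -> R) (N : set M).
Hypothesis gG : is_graph A f m v1 v2 n r G phi N.
Hypotheses (Tv1 : T m v1) (Tv2 : T m v2).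

Lemma graph_norm0 : `|0 : 'rV[R]_2| < r.
Proof. by rewrite normr0; exact: graph_gt0 gG. Qed.

Lemma graph_phi0 : phi 0 = 0.
Proof.
have := graph_eq gG graph_norm0; rewrite (graph_base gG) !mxE !scale0r !add0r.
rewrite -[X in X = _]addr0 => /addrI /esym E.
have E' : 0 *: v1 + 0 *: v2 + phi 0 *: n = 0 *: v1 + 0 *: v2 + 0 *: n.
  by rewrite E !scale0r !addr0.
by have [] := frame_coord_inj (graph_frame gG) E'.
Qed.

Lemma graph_differentiable y : `|y| < r -> differentiable phi y.
Proof. by move=> yr; have [+ _] := graph_C2 gG; exact. Qed.

(** At the base point the tangent plane is spanned by the first two vectors of
    the frame, so that the graph is tangent to its reference plane. *)
Lemma graph_diff0 d : 'd phi 0 d = 0.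
Proof.
have d0 := graph_differentiable graph_norm0.
have [L LE] : exists L : {linear 'rV[R]_2 -> R}, forall v, 'd phi 0 v = L v.
  by exists ('d phi 0).
have tg v : T m v -> exists d : 'rV[R]_2, v = d 0 0 *: v1 + d 0 1 *: v2 + L d *: n.
  rewrite -(graph_base gG) => /(graph_tangent gG graph_norm0)[e ->].
  by exists e; rewrite LE.
have h1 : L (pt2 1 0) = 0.
  have [e E] := tg _ Tv1.
  have E' : 1 *: v1 + 0 *: v2 + 0 *: n = e 0 0 *: v1 + e 0 1 *: v2 + L e *: n.
    by rewrite scale1r !scale0r !addr0.
  have [e0 e1 Le] := frame_coord_inj (graph_frame gG) E'.
  by rewrite [RHS]Le (pt2_eta e) -e0 -e1.
have h2 : L (pt2 0 1) = 0.
  have [e E] := tg _ Tv2.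
  have E' : 0 *: v1 + 1 *: v2 + 0 *: n = e 0 0 *: v1 + e 0 1 *: v2 + L e *: n.
    by rewrite scale1r !scale0r add0r !addr0.
  have [e0 e1 Le] := frame_coord_inj (graph_frame gG) E'.
  by rewrite [RHS]Le (pt2_eta e) -e0 -e1.
rewrite LE.
have -> : d = d 0 0 *: pt2 1 0 + d 0 1 *: pt2 0 1.
  by rewrite [LHS]pt2_eta; apply/rowP => i; rewrite !mxE; case: ifP => _; ring.
by rewrite linearD !linearZ/= h1 h2 !scaler0 addr0.
Qed.

Lemma graph_span w : T m w <-> exists a b : R, w = a *: v1 + b *: v2.
Proof.
rewrite -{1}(graph_base gG); split.
  move=> /(graph_tangent gG graph_norm0)[d ->]; exists (d 0 0), (d 0 1).
  by rewrite graph_diff0 scale0r addr0.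
move=> [a [b ->]]; apply/(graph_tangent gG graph_norm0); exists (pt2 a b).
by rewrite graph_diff0 scale0r addr0 !pt2E.
Qed.

End Graph.

Lemma tangent_span m v1 v2 n : T m v1 -> T m v2 -> frame v1 v2 n \in unitmx ->
  forall w, T m w <-> exists a b : R, w = a *: v1 + b *: v2.
Proof.
move=> Tv1 Tv2 uB w.
have [r [G [phi [N gG]]]] := local_graph hM hf Tv1 Tv2 uB.
exact: (graph_span gG Tv1 Tv2).
Qed.

Lemma tangentD m v w : T m v -> T m w -> T m (v + w).
Proof.
move=> Tv Tw; have [w0 Tw0 w0n] := tangent_neq0 m.
have [v2 [n [Tv2 uB]]] := tangent_basis Tw0 w0n.
move: Tv Tw => /(tangent_span Tw0 Tv2 uB)[a [b ->]] /(tangent_span Tw0 Tv2 uB)[c [d ->]].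
apply/(tangent_span Tw0 Tv2 uB); exists (a + c), (b + d).
by rewrite !scalerDl addrACA.
Qed.

Lemma tangentZ m (k : R) v : T m v -> T m (k *: v).
Proof.
move=> Tv; have [w0 Tw0 w0n] := tangent_neq0 m.
have [v2 [n [Tv2 uB]]] := tangent_basis Tw0 w0n.
move: Tv => /(tangent_span Tw0 Tv2 uB)[a [b ->]].
apply/(tangent_span Tw0 Tv2 uB); exists (k * a), (k * b).
by rewrite scalerDr !scalerA.
Qed.

Lemma singularP m v1 v2 n : T m v1 -> T m v2 -> frame v1 v2 n \in unitmx ->
  Theta (f m) v1 = 0 -> Theta (f m) v2 = 0 -> singular A f m.
Proof.
move=> Tv1 Tv2 uB T1 T2; rewrite /singular; apply/seteqP; split => w /=.
  move=> /(tangent_span Tv1 Tv2 uB)[a [b ->]].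
  by rewrite ThetaD !ThetaZ T1 T2 !mulr0 addr0.
have [a [b [c ->]]] := frame_span w uB.
rewrite !ThetaD !ThetaZ T1 T2 !mulr0 !add0r => /eqP; rewrite mulf_eq0 => /orP[/eqP->|/eqP n0].
  by rewrite scale0r addr0; apply/(tangent_span Tv1 Tv2 uB); exists a, b.
have [v /eqP[]] := Theta_neq0 (f m).
have [a' [b' [c' ->]]] := frame_span v uB.
by rewrite !ThetaD !ThetaZ T1 T2 n0 !mulr0 !addr0.
Qed.

Lemma nonsingularP m : ~ singular A f m <-> exists2 v, T m v & Theta (f m) v != 0.
Proof.
split=> [ns|[v Tv tv] s]; last first.
  by move: Tv; rewrite s /= => /eqP; rewrite (negbTE tv).
apply: contrapT => H; apply: ns.
have {}H v : T m v -> Theta (f m) v = 0.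
  by move=> Tv; apply/eqP/negPn/negP => tv; apply: H; exists v.
have [w0 Tw0 w0n] := tangent_neq0 m.
have [v2 [n [Tv2 uB]]] := tangent_basis Tw0 w0n.
by apply: (singularP Tw0 Tv2 uB); exact: H.
Qed.

End Tangent.

(** * Curves in a graph *)

Section GraphCurve.
Context {R : realType} {M : topologicalType}.
Context (A : set (chart R M)) (f : M -> 'rV[R]_3).
Context (hM : C2_2manifold A) (hf : C2_immersion A f).

Notation T := (tangent_plane A f).

Lemma is_derive_entry n (Q : R -> 'rV[R]_n) (t : R) i : differentiable Q t ->
  is_derive t (1 : R) (fun t => Q t 0 i) ('D_1 Q t 0 i).
Proof.
move=> dQ; apply: DeriveDef.
  by apply: diff_derivable; exact: differentiable_entry.
apply: (etrans (deriveE _ (differentiable_entry i dQ))).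
apply: (etrans (diff_entry i _ dQ)).
by rewrite (deriveE (1 : R) dQ).
Qed.

Lemma is_derive_comp_curve n (c : R -> 'rV[R]_n) (g : 'rV[R]_n -> R) t :
  differentiable c t -> differentiable g (c t) ->
  is_derive t (1 : R) (fun t => g (c t)) ('d g (c t) ('D_1 c t)).
Proof.
move=> dc dg; apply: DeriveDef.
  by apply: diff_derivable; exact: (differentiable_comp dc dg).
apply: (etrans (deriveE _ (differentiable_comp dc dg))).
apply: (etrans (diff_compE _ dc dg)).
by rewrite (deriveE (1 : R) dc).
Qed.

Context (m : M) (v1 v2 n : 'rV[R]_3) (r : R) (G : 'rV[R]_2 -> M)
  (phi : 'rV[R]_2 -> R) (N : set M).
Hypothesis gG : is_graph A f m v1 v2 n r G phi N.

Context (k : nat) (k2 : (k <= 1)%N) (I : set R) (oI : open I) (c : R -> 'rV[R]_2).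
Hypotheses (Cc : Ck_on k.+1 I c) (cr : forall t, I t -> `|c t| < r).

Let dc t : I t -> differentiable c t.
Proof. by have [+ _] := Cc; exact. Qed.

Lemma graph_curve_continuous t : I t -> {for t, continuous (G \o c)}.
Proof.
move=> It; apply: continuous_comp; last exact: (graph_cont gG (cr It)).
exact: (Ck_on0 Cc It).
Qed.

Lemma graph_curve_Ck : Ck_curve A k.+1 I (G \o c).
Proof.
split=> [t It|ch Ac]; first exact: graph_curve_continuous.
have [od _ _ _ _] := chartP hM Ac.
have oJ : open (I `&` (G \o c) @^-1` dom ch).
  rewrite openE => t [It dt]; apply: filterI; first exact: open_nbhs_nbhs.
  by apply: (graph_curve_continuous It); apply: open_nbhs_nbhs.
have oD : open ([set y | `|y| < r] `&` G @^-1` dom ch).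
  rewrite openE => y [yr Gy]; apply: filterI.
    by apply: open_nbhs_nbhs; split => //; exact: open_norm_lt.
  by apply: (graph_cont gG yr); apply: open_nbhs_nbhs.
have Cg := Ck_on_leq (k2 : (k.+1 <= 2)%N) (graph_charts gG Ac).
apply: (@Ck_on_comp_rV R R 2 2 k.+1 _ _ c (coord ch \o G) oJ oD _ _ Cg).
  by move=> t [It dt]; split => //; exact: cr.
by apply: (Ck_on_sub _ Cc) => t [].
Qed.

Lemma graph_curve_immersed : Ck_on k.+1 I (f \o (G \o c)).
Proof.
have C0 i : Ck_on k.+1 I (fun t => c t 0 i) by exact: (Ck_on_entry i oI Cc).
have Cphi : Ck_on k.+1 I (phi \o c).
  apply: (@Ck_on_comp R R 2 k.+1 I [set y | `|y| < r] c phi oI cr Cc).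
  exact: Ck_on_leq (graph_C2 gG).
have C := Ck_onD oI (Ck_on_cst k.+1 I (f m)) (Ck_onD oI
  (Ck_onD oI (Ck_onZl v1 oI (C0 0)) (Ck_onZl v2 oI (C0 1))) (Ck_onZl n oI Cphi)).
by apply: (Ck_on_eq oI _ C) => t It; rewrite /= (graph_eq gG (cr It)).
Qed.

Lemma graph_curve_derive t : I t ->
  'D_1 (f \o (G \o c)) t =
   'D_1 c t 0 0 *: v1 + 'D_1 c t 0 1 *: v2 + 'd phi (c t) ('D_1 c t) *: n.
Proof.
move=> It.
have dfc : differentiable (f \o (G \o c)) t by have [+ _] := graph_curve_immersed; exact.
have dphi := is_derive_comp_curve (dc It) (graph_differentiable gG (cr It)).
have d0 := is_derive_entry 0 (dc It); have d1 := is_derive_entry 1 (dc It).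
apply/rowP => i.
have [_ <-] := is_derive_entry i dfc.
have H : is_derive t (1 : R) (fun t => f m 0 i + (c t 0 0 * v1 0 i + c t 0 1 * v2 0 i + phi (c t) * n 0 i))
   ('D_1 c t 0 0 * v1 0 i + 'D_1 c t 0 1 * v2 0 i + 'd phi (c t) ('D_1 c t) * n 0 i).
  by apply: is_derive_eq; rewrite /GRing.scale/=; ring.
have [_ HE] := H.
rewrite [RHS]mxE [in RHS]mxE [X in X + _ + _]mxE [X in _ + X + _]mxE [X in _ + X]mxE -HE.
apply: near_eq_derive; have := open_nbhs_nbhs (conj oI It); apply: filterS => s Is.
by rewrite /= (graph_eq gG (cr Is)) !mxE.
Qed.

(** The velocity of a curve of parameters is a tangent vector, so that curves
    with a prescribed direction are obtained by solving an equation in the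
    parameters only. *)
Lemma graph_curve_tangent t : I t -> T (G (c t)) ('D_1 (f \o (G \o c)) t).
Proof.
move=> It; apply/(graph_tangent gG (cr It)).
by exists ('D_1 c t); exact: graph_curve_derive.
Qed.

End GraphCurve.

(** * Straight characteristic curves *)

Section CharacteristicLines.
Context {R : realType} {M : topologicalType}.
Context (A : set (chart R M)) (f : M -> 'rV[R]_3).
Context (hM : C2_2manifold A) (hf : C2_immersion A f).

Notation T := (tangent_plane A f).

Lemma derive1_entry n (I : set R) (Q : R -> 'rV[R]_n) i t : open I -> I t ->
  Ck_on 2 I Q ->
  derive1 (fun t => Q t 0 i) t = 'D_1 Q t 0 i /\
  derive1 (derive1 (fun t => Q t 0 i)) t = 'D_1 ('D_1 Q) t 0 i.
Proof.
move=> oI It [dQ CQ]; have [dQ' _] := CQ (1 : R).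
have E s : I s -> derive1 (fun t => Q t 0 i) s = 'D_1 Q s 0 i.
  by move=> Is; rewrite derive1E; have [_ ->] := is_derive_entry i (dQ s Is).
split; first exact: E.
have [_ <-] := is_derive_entry i (dQ' t It).
rewrite derive1E; apply: near_eq_derive.
by have := open_nbhs_nbhs (conj oI It); apply: filterS => s /E.
Qed.

(** The velocity of the projection of a Legendrian curve does not vanish, so
    that the quotient defining the curvature vanishes with its numerator. *)
Lemma curvature0 (I : set R) (Q : R -> 'rV[R]_3) t : open I -> I t ->
  Ck_on 2 I Q -> Theta (Q t) ('D_1 Q t) = 0 -> 'D_1 Q t != 0 ->
  plane_curvature (xco \o Q) (yco \o Q) t = 0 ->
  xco ('D_1 Q t) * yco ('D_1 ('D_1 Q) t) - yco ('D_1 Q t) * xco ('D_1 ('D_1 Q) t) = 0.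
Proof.
move=> oI It CQ T0 Q0; rewrite /plane_curvature.
have [-> ->] : derive1 (xco \o Q) t = xco ('D_1 Q t) /\
    derive1 (derive1 (xco \o Q)) t = xco ('D_1 ('D_1 Q) t).
  exact: (derive1_entry 0 oI It CQ).
have [-> ->] : derive1 (yco \o Q) t = yco ('D_1 Q t) /\
    derive1 (derive1 (yco \o Q)) t = yco ('D_1 ('D_1 Q) t).
  exact: (derive1_entry 1 oI It CQ).
have q0 := legendrian_xy T0 Q0.
move=> /eqP; rewrite mulf_eq0 invr_eq0 expf_eq0 /= sqrtr_eq0 leNgt q0 orbF.
by move=> /eqP.
Qed.

Lemma straight_characteristic (e : R) (Q : R -> 'rV[R]_3) : 0 < e ->
  Ck_on 2 `]- e, e[%classic Q ->
  (forall t, - e < t < e -> [/\ Theta (Q t) ('D_1 Q t) = 0, 'D_1 Q t != 0 &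
     plane_curvature (xco \o Q) (yco \o Q) t = 0]) ->
  exists2 e' : R, 0 < e' <= e & exists s : R -> R, forall t, - e' < t < e' ->
    Q t = Q 0 + s t *: 'D_1 Q 0.
Proof.
move=> e0 CQ H; set I := `]- e, e[%classic in CQ.
have oI : open I by exact: itv_open.
have IP t : - e < t < e -> I t by rewrite /I /= in_itv.
have [dQ CQ1] := CQ; have [dQ' _] := CQ1 (1 : R).
have z0 : - e < 0 < e by rewrite oppr_lt0 e0.
have [Th0 Q0 _] := H 0 z0.
have [t te||e' e'e [s Hs]] := @straight_legendrian R (fun t => xco (Q t)) (fun t => yco (Q t))
  (fun t => zco (Q t)) (fun t => xco ('D_1 Q t)) (fun t => yco ('D_1 Q t))
  (fun t => zco ('D_1 Q t)) (fun t => xco ('D_1 ('D_1 Q) t))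
  (fun t => yco ('D_1 ('D_1 Q) t)) e e0.
- have It := IP t te; have [Th Qn k] := H t te.
  have dd i := is_derive_entry i (dQ t It).
  have dd' i := is_derive_entry i (dQ' t It).
  split; first by split; exact: dd.
  by split; [exact: dd'|exact: dd'|exact: Th|exact: curvature0 CQ Th Qn k].
- exact: legendrian_xy Th0 Q0.
exists e' => //; exists s => t te; have [hx hy hz] := Hs t te.
have [X Y Z] := coD (Q 0) (s t *: 'D_1 Q 0); have [X' Y' Z'] := coZ (s t) ('D_1 Q 0).
by apply: row3P; rewrite ?X ?Y ?Z ?X' ?Y' ?Z'.
Qed.

Lemma graph_velocity_Ck (m : M) (v1 v2 n : 'rV[R]_3) (r : R) (G : 'rV[R]_2 -> M)
    (phi : 'rV[R]_2 -> R) (N : set M) (d : 'rV[R]_2) (w : 'rV[R]_3) :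
  is_graph A f m v1 v2 n r G phi N ->
  Ck_on 1 [set y | `|y| < r] (fun y => Theta (f (G y)) (w + 'D_d phi y *: n)).
Proof.
move=> gG; set D := [set y : 'rV[R]_2 | `|y| < r].
have oD : open D by exact: open_norm_lt.
have Cphi := graph_C2 gG; have Cd : Ck_on 1 D ('D_d phi) := proj2 Cphi d.
have C0 i : Ck_on 1 D (fun y : 'rV[R]_2 => y 0 i) by exact: (Ck_on_entry i oD (Ck_on_id 1 D)).
have CV := Ck_onD oD (Ck_on_cst 1 D w) (Ck_onZl n oD Cd).
have CQ := Ck_onD oD (Ck_on_cst 1 D (f m)) (Ck_onD oD
  (Ck_onD oD (Ck_onZl v1 oD (C0 0)) (Ck_onZl v2 oD (C0 1))) (Ck_onZl n oD (Ck_on_pred Cphi))).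
apply: (Ck_on_eq oD _ (Ck_on_Theta oD CQ CV)) => y yr.
by rewrite (graph_eq gG yr).
Qed.

(** Through a nonsingular point there is a characteristic curve (solve the
    ordinary differential equation of the line field in a graph chart), and
    p-minimality makes it a straight segment, whose parameter, the graph
    coordinate along [w], makes [w] the velocity. *)
Lemma nonsingular_lift m w : p_minimal A f -> ~ singular A f m ->
  T m w -> Theta (f m) w = 0 -> w != 0 ->
  exists2 e : R, 0 < e & exists2 g : R -> M, g 0 = m &
    forall t, - e < t < e -> {for t, continuous g} /\ f (g t) = f m + t *: w.
Proof.
move=> hmin nsm Tw Thw wn.
have [v2 [n [Tv2 uB]]] := tangent_basis hM hf Tw wn.
have [r [G [phi [N gG]]]] := local_graph hM hf Tw Tv2 uB.
have Th2 : Theta (f m) v2 != 0.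
  by apply/eqP => Th2; apply: nsm; exact: (singularP hM hf Tw Tv2 uB Thw Th2).
have r0 := graph_gt0 gG.
have z0 := graph_norm0 gG.
pose D := [set y : 'rV[R]_2 | `|y| < r].
have oD : open D by exact: open_norm_lt.
pose w1 y := Theta (f (G y)) (w + 'D_('e_0) phi y *: n).
pose w2 y := Theta (f (G y)) (v2 + 'D_('e_1) phi y *: n).
have C1 : Ck_on 1 D w1 by exact: graph_velocity_Ck gG.
have C2 : Ck_on 1 D w2 by exact: graph_velocity_Ck gG.
have dphi0 d : 'D_d phi 0 = 0.
  apply: (etrans (deriveE d (graph_differentiable gG z0))).
  exact: (graph_diff0 gG Tw Tv2).
pose D2 := D `&` [set y | w2 y != 0].
have oD2 : open D2.
  rewrite openE => y [Dy wy]; apply: filterI; first exact: open_nbhs_nbhs.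
  have cw : {for y, continuous w2} by exact: (Ck_on0 C2 Dy).
  have cw' : w2 u @[u --> y] --> w2 y := cw.
  apply: (cw' [set x : R | x != 0]); apply: open_nbhs_nbhs; split.
    exact: (@open_neq R 0).
  exact: wy.
have D20 : D2 0.
  by split; [exact: z0|rewrite /= /w2 (graph_base gG) dphi0 scale0r addr0].
have D2D y : D2 y -> D y by case.
(* the slope of the characteristic direction in the graph parameters *)
pose H y := - (w1 y * (w2 y)^-1).
have CH : Ck_on 1 D2 H.
  apply: (Ck_onN oD2); apply: (Ck_onM oD2); first exact: Ck_on_sub C1.
  apply: (Ck_onV oD2); last exact: Ck_on_sub C2.
  by move=> y [].
have [e e0 [y y0 Hy]] := planar_ODE oD2 D20 CH.
have Cy := planar_ODE_C2 oD2 CH Hy.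
pose I := `]- e, e[%classic.
have oI : open I by exact: itv_open.
have IP t : I t <-> - e < t < e by rewrite /I /= in_itv.
pose c t := pt2 t (y t).
have Cc : Ck_on 2 I c.
  exact: (@Ck_on_pt2 R 2 I (fun t => t) y oI (@Ck_on_id R R 2 I) Cy).
have cD2 t : I t -> D2 (c t) by move=> /IP /Hy[].
have cr t : I t -> `|c t| < r by move=> /cD2 /D2D.
have [dc _] := Cc.
have dcE t : I t -> 'D_1 c t = pt2 1 (H (c t)).
  move=> It; have [_ [_ yE]] := Hy t ((IP t).1 It).
  have [_ E0] := is_derive_entry 0 (dc t It).
  have [_ E1] := is_derive_entry 1 (dc t It).
  rewrite [LHS]pt2_eta -E0 -E1; congr pt2.
    have -> : (fun t => c t 0 0) = id by apply/funext => s; rewrite pt2E.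
    exact: derive_id.
  by have -> : (fun t => c t 0 1) = y by apply/funext => s; rewrite pt2E.
pose g := G \o c.
have Cg : Ck_curve A 2 I g by exact: (graph_curve_Ck hM gG (leqnn 1) oI Cc cr).
pose Q := f \o g.
have CQ : Ck_on 2 I Q by exact: (graph_curve_immersed gG (leqnn 1) oI Cc cr).
have dQ t : I t -> 'D_1 Q t = w + H (c t) *: v2 + 'd phi (c t) (pt2 1 (H (c t))) *: n.
  move=> It; have := graph_curve_derive gG (leqnn 1) oI Cc cr It.
  by rewrite dcE// !pt2E scale1r.
have TQ t : I t -> T (g t) ('D_1 Q t).
  by move=> It; exact: (graph_curve_tangent gG (leqnn 1) oI Cc cr It).
have ThQ t : I t -> Theta (Q t) ('D_1 Q t) = 0.
  move=> It; have w2n : w2 (c t) != 0 by have [] := cD2 t It.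
  rewrite dQ//.
  have -> : 'd phi (c t) (pt2 1 (H (c t))) =
      'D_('e_0) phi (c t) + H (c t) * 'D_('e_1) phi (c t).
    apply: (etrans (diff_pt2 _ (graph_differentiable gG (cr t It)))).
    by rewrite !pt2E scale1r.
  have -> : w + H (c t) *: v2 + ('D_('e_0) phi (c t) + H (c t) * 'D_('e_1) phi (c t)) *: n =
    (w + 'D_('e_0) phi (c t) *: n) + H (c t) *: (v2 + 'D_('e_1) phi (c t) *: n).
    by rewrite scalerDl scalerDr scalerA addrACA.
  have E : w1 (c t) + H (c t) * w2 (c t) = 0 by rewrite /H mulNr mulfVK// subrr.
  apply: (etrans (ThetaD _ _ _)).
  by apply: (etrans _ E); congr (_ + _); exact: ThetaZ.
have Qn t : I t -> 'D_1 Q t != 0.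
  move=> It; apply/eqP => E.
  have E' : 1 *: w + H (c t) *: v2 + 'd phi (c t) (pt2 1 (H (c t))) *: n =
      0 *: w + 0 *: v2 + 0 *: n.
    by rewrite scale1r -dQ// E !scale0r !addr0.
  have [/eqP] := frame_coord_inj uB E'.
  by rewrite oner_eq0.
have ns t : I t -> ~ singular A f (g t).
  move=> It; apply/(nonsingularP hM hf).
  exists (v2 + 'D_('e_1) phi (c t) *: n).
    apply/(graph_tangent gG (cr t It)); exists (pt2 0 1).
    rewrite !pt2E scale0r add0r scale1r.
    have E := diff_pt2 (pt2 0 1) (graph_differentiable gG (cr t It)).
    by rewrite !pt2E scale0r add0r scale1r in E; rewrite E.
  by have [] := cD2 t It.
have char : characteristic_curve A f (- e) e g.
  split; first exact: Cg.
  move=> t; rewrite in_itv /= => te; have It := (IP t).2 te.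
  rewrite derive1E; split; [exact: ns|exact: Qn|exact: TQ|exact: ThQ].
have curv := hmin _ _ _ char.
have [t te|e' /andP[e'0 e'e] [s Hs]] := straight_characteristic e0 CQ.
  have It := (IP t).2 te; split; [exact: ThQ|exact: Qn|].
  by apply: curv; rewrite in_itv.
have I0 : I 0 by apply/IP; rewrite oppr_lt0 e0.
have c0 : c 0 = 0 by rewrite /c y0 pt20.
have Q0 : Q 0 = f m by rewrite /Q /g /= c0 (graph_base gG).
have dQ0 : 'D_1 Q 0 = w.
  rewrite dQ// c0 [H 0](_ : _ = 0).
    by rewrite (graph_diff0 gG Tw Tv2) !scale0r !addr0.
  by rewrite /H /w1 (graph_base gG) dphi0 scale0r addr0 Thw mul0r oppr0.
exists e' => //; exists g; first by rewrite /g /= c0 (graph_base gG).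
move=> t te; have It : I t by apply/IP; move: te => /andP[t1 t2]; apply/andP; split; lra.
split; first exact: (graph_curve_continuous gG Cc cr It).
have := Hs t te; rewrite Q0 dQ0 => E; apply: (etrans E).
have : Q t = f m + (t *: w + y t *: v2 + phi (c t) *: n).
  by rewrite /Q /g /= (graph_eq gG (cr t It)) !pt2E.
rewrite E => /addrI E2.
have E3 : s t *: w + 0 *: v2 + 0 *: n = t *: w + y t *: v2 + phi (c t) *: n.
  by rewrite !scale0r !addr0.
by have [->] := frame_coord_inj uB E3.
Qed.

End CharacteristicLines.

(** * Characteristic lines near a zero of the plane field *)

Section RealInduction.
Context {R : realType}.

(** Induction on a segment: the supremum of the points up to which the
    property holds can be neither missed nor stopped at. *)
Lemma real_induction (P : R -> Prop) (a b : R) : P a ->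
  (forall t, a <= t < b -> P t -> exists2 e : R, 0 < e & forall s, t < s < t + e -> P s) ->
  (forall t, a < t <= b -> (forall s, a <= s < t -> P s) -> P t) ->
  forall t, a <= t <= b -> P t.
Proof.
move=> Pa Pr Pc t /andP[at_ tb].
pose S := [set u | a <= u <= b /\ forall s, a <= s <= u -> P s].
have ab : a <= b by exact: le_trans tb.
have Sa : S a.
  split; first by rewrite lexx ab.
  by move=> s /andP[as_ sa]; have -> : s = a by apply/eqP; rewrite eq_le sa as_.
have supS : has_sup S by split; [exists a|exists b => u [/andP[]]].
pose u := sup S.
have au : a <= u by apply: sup_upper_bound.
have ub : u <= b by apply: ge_sup; [exists a|move=> v [/andP[]]].
have below s : a <= s < u -> P s.
  move=> /andP[as_ su].
  have [v [_ Hv] sv] := sup_adherent (ltac:(by rewrite subr_gt0; exact: su) : 0 < u - s) supS.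
  by apply: Hv; rewrite as_ ltW//; move: sv; rewrite -/u; lra.
have Pu : P u.
  move: au; rewrite le_eqVlt => /orP[/eqP <- //|au].
  by apply: Pc => //; rewrite au ub.
move: ub; rewrite le_eqVlt => /orP[/eqP ub|ub].
  move: tb; rewrite le_eqVlt => /orP[/eqP ->|tb]; first by rewrite -ub.
  by apply: below; rewrite at_ ub.
have [|e e0 He] := Pr u _ Pu; first by rewrite au ub.
pose v := Num.min b (u + e / 2).
have uv : u < v by rewrite lt_min ub/=; lra.
have Sv : S v.
  split; first by rewrite (le_trans au (ltW uv)) ge_min lexx.
  move=> s /andP[as_ sv]; case: (ltrgtP s u) => [su|us|->//].
    by apply: below; rewrite as_ su.
  apply: He; rewrite us; apply: (le_lt_trans sv).
  by rewrite gt_min; apply/orP; right; lra.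
by have := sup_upper_bound supS Sv; rewrite -/u leNgt uv.
Qed.

End RealInduction.

(** The contact form restricted to a p-minimal graph, near a singular point
    placed at the origin, is [F1 da + F2 db].  Its null lines are straight
    away from the zeros, its linear part at the origin has the matrix
    [(p, k; c, d)], and the contact condition forces the curl [c - k] to be
    nonzero.  Strict differentiability is what C^2 regularity of the graph
    gives. *)
Record plane_field {R : realType} (F1 F2 : R -> R -> R) (r p k c d N : R) : Prop :=
  PlaneField {
  pf_straight : forall a b e1 e2, `|a| < r /\ `|b| < r -> ~ (F1 a b = 0 /\ F2 a b = 0) ->
    F1 a b * e1 + F2 a b * e2 = 0 ->
    exists2 e : R, 0 < e & forall s, `|s| < e ->
      F1 (a + s * e1) (b + s * e2) * e1 + F2 (a + s * e1) (b + s * e2) * e2 = 0;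
  pf_cont1 : forall a b e1 e2 s, `|a + s * e1| < r /\ `|b + s * e2| < r ->
    {for s, continuous (fun s : R => F1 (a + s * e1) (b + s * e2))};
  pf_cont2 : forall a b e1 e2 s, `|a + s * e1| < r /\ `|b + s * e2| < r ->
    {for s, continuous (fun s : R => F2 (a + s * e1) (b + s * e2))};
  pf_radius : 0 < r;
  pf_pos : 0 < N;
  pf_curl : c - k = 2 * N;
  pf_zero : F1 0 0 = 0 /\ F2 0 0 = 0;
  pf_strict : forall e : R, 0 < e -> exists2 D : R, 0 < D &
    forall a b a' b', `|a| < D -> `|b| < D -> `|a'| < D -> `|b'| < D ->
    `|F1 a b - F1 a' b' - (p * (a - a') + k * (b - b'))| <= e * (`|a - a'| + `|b - b'|) /\
    `|F2 a b - F2 a' b' - (c * (a - a') + d * (b - b'))| <= e * (`|a - a'| + `|b - b'|) }.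

(** A null direction stays null along its own line as long as no zero is met,
    and, by continuity, at the first zero too. *)
Lemma segment_straight (R : realType) (F1 F2 : R -> R -> R) (r p k c d N : R) a b e1 e2 :
  plane_field F1 F2 r p k c d N ->
  (forall s, 0 <= s <= 1 -> `|a + s * e1| < r /\ `|b + s * e2| < r) ->
  (forall s, 0 <= s < 1 -> ~ (F1 (a + s * e1) (b + s * e2) = 0 /\ F2 (a + s * e1) (b + s * e2) = 0)) ->
  F1 a b * e1 + F2 a b * e2 = 0 ->
  F1 (a + e1) (b + e2) * e1 + F2 (a + e1) (b + e2) * e2 = 0.
Proof.
move=> [F_straight F1_cont F2_cont _ _ _ _ _] bx nz F0.
pose psi (s : R) : R := F1 (a + s * e1) (b + s * e2) * e1 + F2 (a + s * e1) (b + s * e2) * e2.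
have cpsi (s : R) : 0 <= s <= 1 -> psi u @[u --> s] --> psi s.
  move=> s01; apply: cvgD; apply: cvgMr_tmp.
    exact: F1_cont _ _ _ _ _ (bx s s01).
  exact: F2_cont _ _ _ _ _ (bx s s01).
suff : forall s, 0 <= s <= 1 -> psi s = 0.
  by move=> /(_ 1); rewrite ler01 lexx /psi !mul1r; exact.
apply: real_induction.
- by rewrite /psi !mul0r !addr0.
- move=> t /andP[t0 t1] pt.
  have t01 : 0 <= t <= 1 by rewrite t0 ltW.
  have t01' : 0 <= t < 1 by rewrite t0.
  have [e e0 He] := F_straight _ _ _ _ (bx t t01) (nz t t01') pt.
  exists e => // s /andP[ts ste].
  have := He (s - t); rewrite /psi.
  have -> : a + t * e1 + (s - t) * e1 = a + s * e1 by ring.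
  have -> : b + t * e2 + (s - t) * e2 = b + s * e2 by ring.
  by apply; rewrite ger0_norm; lra.
- move=> t /andP[t0 t1] H.
  have t01 : 0 <= t <= 1 by rewrite t1 ltW.
  apply/eqP/negPn/negP => pt.
  have pt0 : 0 < `|psi t| by rewrite normr_gt0.
  have : \forall u \near t, `|psi t - psi u| < `|psi t|.
    exact: cvgr_dist_lt (cpsi t t01) _ pt0.
  move=> /nbhs_normP[D /= D0 HD].
  pose u := Num.max 0 (t - D / 2).
  have ut : u < t by rewrite gt_max t0/=; lra.
  have : ball_ Num.Def.normr t D u.
    rewrite /ball_ /= ger0_norm; last by rewrite subr_ge0 ltW.
    have : t - D / 2 <= u by rewrite le_max lexx orbT.
    by lra.
  move=> /HD; rewrite (H u) ?subr0 ?ltxx// ut andbT.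
  by rewrite le_max lexx.
Qed.

(** A null line ending at the origin along the negative first axis makes the
    origin critical for [F1] in that direction. *)
Lemma arrival_p0 (R : realType) (F1 F2 : R -> R -> R) (r p k c d N : R) t0 :
  plane_field F1 F2 r p k c d N ->
  0 < t0 -> (forall t, 0 < t < t0 -> F1 (- t) 0 = 0) ->
  p = 0.
Proof.
move=> [_ _ _ _ _ _ F_zero F_strict] t0_gt0 F1_arrival.
apply/eqP; rewrite -normr_le0; apply/ler_addgt0Pr => e e0.
have [D D0 HD] := F_strict e e0; have [Fz _] := F_zero.
pose t := Num.min D t0 / 2.
have m0 : 0 < Num.min D t0 by rewrite lt_min D0 t0_gt0.
have tD : t < D by have : Num.min D t0 <= D by [rewrite ge_min lexx]; rewrite /t; lra.
have tt : t < t0 by have : Num.min D t0 <= t0 by [rewrite ge_min lexx orbT]; rewrite /t; lra.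
have t1 : 0 < t by rewrite divr_gt0.
have nt : `|- t| < D by rewrite normrN gtr0_norm.
have n0 : `|0 : R| < D by rewrite normr0.
have [+ _] := HD (- t) 0 0 0 nt n0 n0 n0.
rewrite Fz F1_arrival ?t1// !subr0 mulr0 addr0 sub0r normr0 addr0 mulrN opprK.
by rewrite normrM normrN (gtr0_norm t1) add0r ler_pM2r.
Qed.

(** The curl decides the sign of [c].  Were [c] nonpositive, the curl would make
    [F1] negative just above the line, and the null line through a point at
    height [be] would come down to the axis at a point [al t] having two null
    directions, that is, at a zero of the form.  As [al] is continuous these
    zeros fill an interval, which density of the nonzero values excludes. *)
Lemma arrival_transversal (R : realType) (F1 F2 : R -> R -> R) (r p k c d N : R) t0 :
  plane_field F1 F2 r p k c d N ->
  0 < t0 -> (forall t, 0 < t < t0 -> F1 (- t) 0 = 0) ->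
  (forall t1 t2, 0 < t1 -> t1 < t2 -> t2 < t0 ->
     exists2 t, t1 < t < t2 & F2 (- t) 0 <> 0) ->
  0 < c.
Proof.
move=> HF t0_gt0 F1_arrival dense; rewrite ltNge; apply/negP => c0.
have p0 := arrival_p0 HF t0_gt0 F1_arrival.
have [_ F1_cont F2_cont r0 N0 curl [_ Fz2] F_strict] := HF.
pose e := N / 8.
have e0 : 0 < e by rewrite divr_gt0.
have eN : N = 8 * e by rewrite /e; lra.
have kE : k = c - 16 * e by move: curl; rewrite eN; lra.
have [D D0 HD] := F_strict e e0.
pose m := Num.min D (Num.min r t0).
have m0 : 0 < m by rewrite !lt_min D0 r0 t0_gt0.
have mD : m <= D by rewrite ge_min lexx.
have mr : m <= r by rewrite !ge_min lexx orbT.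
have mt : m <= t0 by rewrite !ge_min lexx !orbT.
have n0D : `|0 : R| < D by rewrite normr0.
pose t1 := m / 4.
have t10 : 0 < t1 by rewrite divr_gt0.
pose t2 := t1 / 8.
have t20 : 0 < t2 by rewrite divr_gt0.
pose K := `|d| + e.
have K0 : 0 < K by rewrite ltr_wpDl.
pose be := Num.min (e * t2 / K) t2.
have be0 : 0 < be by rewrite lt_min t20 divr_gt0// mulr_gt0.
have beK : K * be <= e * t2 by rewrite mulrC -ler_pdivlMr// ge_min lexx.
have bet : be <= t2 by rewrite ge_min lexx orbT.
have t1m : 4 * t1 = m by rewrite /t1; lra.
have t2m : 8 * t2 = t1 by rewrite /t2; lra.
(* above the line the curl dominates the first coefficient, of size [k * b] *)
have F1neg a b : 0 < b -> b <= be -> - (2 * t1) <= a -> a < 0 ->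
    `|F1 a b - k * b| <= e * b.
  move=> b0 bbe a1 a0.
  have na : `|a| < D by rewrite ltr0_norm//; move: a1 t1m t10 mD; clear; lra.
  have nb : `|b| < D by rewrite gtr0_norm//; move: bbe bet t2m t1m t10 mD; clear; lra.
  have [+ _] := HD a b a 0 na nb na n0D.
  have -> : F1 a 0 = 0.
    have <- : F1 (- - a) 0 = F1 a 0 by rewrite opprK.
    by apply: F1_arrival; apply/andP; split; move: a0 a1 t1m t10 mt; clear; lra.
  by rewrite !subrr mulr0 add0r !subr0 normr0 add0r (gtr0_norm b0).
have F1lt a b : 0 < b -> b <= be -> - (2 * t1) <= a -> a < 0 -> F1 a b < 0.
  move=> b0 bbe a1 a0; have := F1neg a b b0 bbe a1 a0; rewrite ler_norml kE => /andP[_ h].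
  have cb : c * b <= 0 by rewrite mulr_le0_ge0// ltW.
  have eb : 0 < e * b by rewrite mulr_gt0.
  by move: h cb eb; clear; lra.
(* where the null line through [(- t, be)] meets the first axis *)
pose al t := - t + be * (F2 (- t) be / F1 (- t) be).
have al_bound t : t2 <= t <= t1 -> - (2 * t) < al t /\ al t < - (t / 2).
  move=> /andP[h1 h2].
  have na : `|- t| < D.
    by rewrite normrN gtr0_norm; move: h1 h2 t20 t1m t10 mD; clear; lra.
  have nb : `|be| < D by rewrite gtr0_norm//; move: bet t2m t1m t10 mD; clear; lra.
  have [_] := HD (- t) be 0 0 na nb n0D n0D.
  rewrite Fz2 !subr0 normrN (gtr0_norm (lt_le_trans t20 h1)) (gtr0_norm be0).
  have ta1 : - (2 * t1) <= - t by move: h2 t10; clear; lra.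
  have ta0 : - t < 0 by move: h1 t20; clear; lra.
  have hF1 := F1neg (- t) be be0 (lexx _) ta1 ta0.
  have hF1n := F1lt (- t) be be0 (lexx _) ta1 ta0.
  move: hF1; rewrite !ler_norml => /andP[q1 q2] /andP[q3 q4].
  have dbe : `|d * be| + e * be <= e * t.
    rewrite normrM (gtr0_norm be0) -mulrDl; apply: (le_trans beK).
    by rewrite ler_pM2l.
  have [db1 db2] : d * be <= `|d * be| /\ - (d * be) <= `|d * be|.
    by split; [exact: ler_norm|rewrite -normrN; exact: ler_norm].
  set X := F1 (- t) be in q1 q2 hF1n *; set Y := F2 (- t) be in q3 q4 *.
  have X0 : X != 0 by rewrite lt_eqF.
  have E : al t * X = - t * X + be * Y.
    by rewrite /al -/X -/Y; field.
  have t_0 : 0 < t by rewrite -oppr_lt0.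
  have hX : X <= (c - 15 * e) * be by rewrite kE in q2; move: q2; clear; lra.
  have hY : Y <= (- c + 2 * e) * t by move: q4 dbe db1; clear; lra.
  have ct : c * t <= 0 by rewrite mulr_le0_ge0// ltW.
  have hY' : - (2 * e) * t <= Y by move: q3 dbe db2 ct; clear; lra.
  have XN : 0 < - X by rewrite oppr_gt0.
  have tX : t * X <= t * ((c - 15 * e) * be) by rewrite ler_pM2l.
  have bY : be * Y <= be * ((- c + 2 * e) * t) by rewrite ler_pM2l.
  have bY' : be * (- (2 * e) * t) <= be * Y by rewrite ler_pM2l.
  have tbe : 0 < t * be * e by rewrite !mulr_gt0.
  have ctb : t * be * c <= 0 by rewrite mulr_ge0_le0// mulr_ge0// ltW.
  split.
    have : al t * X < - (2 * t) * X by rewrite E; move: tX bY tbe ctb; clear; lra.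
    by rewrite ltr_nM2r.
  have : - (t / 2) * X < al t * X by rewrite E; move: tX bY' tbe ctb; clear; lra.
  by rewrite ltr_nM2r.
have al_zero t : t2 <= t <= t1 -> F2 (al t) 0 = 0.
  move=> tt; have [b1 b2] := al_bound t tt; move: tt => /andP[h1 h2].
  have ta1 : - (2 * t1) <= - t by move: h2 t10; clear; lra.
  have ta0 : - t < 0 by move: h1 t20; clear; lra.
  have hF1n := F1lt (- t) be be0 (lexx _) ta1 ta0.
  have X0 : F1 (- t) be != 0 by rewrite lt_eqF.
  pose e1 := al t + t.
  have conv s : 0 <= s <= 1 -> - (2 * t1) <= - t + s * e1 /\ - t + s * e1 < 0.
    move=> /andP[s0 s1]; rewrite /e1.
    have -> : - t + s * (al t + t) = s * al t + (1 - s) * - t by ring.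
    have q1 : s * (- (2 * t1)) <= s * al t.
      by rewrite ler_wpM2l//; move: b1 h2; clear; lra.
    have q2 : (1 - s) * (- (2 * t1)) <= (1 - s) * - t by rewrite ler_wpM2l// subr_ge0.
    have q3 : s * al t <= s * - (t2 / 2).
      by rewrite ler_wpM2l//; move: b2 h1; clear; lra.
    have q4 : (1 - s) * - t <= (1 - s) * - (t2 / 2).
      by rewrite ler_wpM2l ?subr_ge0//; move: h1 t20; clear; lra.
    by split; move: q1 q2 q3 q4 t20; clear; lra.
  have bconv s : 0 <= s <= 1 -> 0 <= be + s * - be <= be.
    move=> /andP[s0 s1].
    have -> : be + s * - be = (1 - s) * be by ring.
    by rewrite mulr_ge0 ?subr_ge0 ?(ltW be0)//= ger_pMl// lerBlDr lerDl.
  have : F1 (- t + e1) (be - be) * e1 + F2 (- t + e1) (be - be) * - be = 0.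
    apply: (segment_straight HF).
    - move=> s s01; have [c1 c2] := conv s s01; have /andP[c3 c4] := bconv s s01.
      split; first by rewrite ltr0_norm//; move: c1 t1m t10 mr; clear; lra.
      by rewrite ger0_norm//; move: c4 bet t2m t1m t10 mr; clear; lra.
    - move=> s /andP[s0 s1] [z1 _].
      have s01 : 0 <= s <= 1 by rewrite s0 ltW.
      have [c1 c2] := conv s s01; have /andP[c3 c4] := bconv s s01.
      have bp : 0 < be + s * - be.
        by have -> : be + s * - be = (1 - s) * be; [ring|rewrite mulr_gt0 ?subr_gt0].
      by have := F1lt _ _ bp c4 c1 c2; rewrite z1 ltxx.
    - by rewrite /e1 /al addrAC addNr add0r; field.
  have -> : - t + e1 = al t by rewrite /e1; ring.
  rewrite subrr => h.
  have F1z : F1 (al t) 0 = 0.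
    have <- : F1 (- - al t) 0 = F1 (al t) 0 by rewrite opprK.
    by apply: F1_arrival; apply/andP; split; move: b1 b2 h1 h2 t20 t1m t10 mt; clear; lra.
  move/eqP: h; rewrite F1z mul0r add0r mulf_eq0 oppr_eq0 (gt_eqF be0) orbF.
  by move/eqP.
have [|||t /andP[ta tb] Ft] := dense (t1 / 4) (t1 / 2).
- by rewrite divr_gt0.
- by move: t10; clear; lra.
- by move: t1m t10 mt; clear; lra.
have t12 : t2 <= t1 by move: t2m t20; clear; lra.
have cal : {within `[t2, t1], continuous al}.
  apply: continuous_in_subspaceT => u; rewrite inE /= in_itv /= => /andP[u1 u2].
  have bx : `|0 + u * (- 1)| < r /\ `|be + u * 0| < r.
    rewrite add0r mulrN mulr1 mulr0 addr0; split; rewrite ?normrN gtr0_norm//.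
    - by move: u2 t1m t10 mr; clear; lra.
    - by move: u1 t20; clear; lra.
    - by move: bet t2m t1m t10 mr; clear; lra.
  have E1 : (fun s => F1 (0 + s * (- 1)) (be + s * 0)) = (fun s => F1 (- s) be).
    by apply/funext => s; congr F1; ring.
  have E2 : (fun s => F2 (0 + s * (- 1)) (be + s * 0)) = (fun s => F2 (- s) be).
    by apply/funext => s; congr F2; ring.
  have h1 := F1_cont _ _ _ _ _ bx; have h2 := F2_cont _ _ _ _ _ bx; rewrite E1 in h1; rewrite E2 in h2.
  have ua1 : - (2 * t1) <= - u by move: u2 t10; clear; lra.
  have ua0 : - u < 0 by move: u1 t20; clear; lra.
  have hF1n := F1lt (- u) be be0 (lexx _) ua1 ua0.
  apply: cvgD; first exact: cvgN.
  apply: cvgMl_tmp; apply: cvgM; first exact: h2.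
  by apply: cvgV; [rewrite lt_eqF|exact: h1].
have [l1 l2] := al_bound t2 ltac:(by rewrite lexx t12).
have [l3 l4] := al_bound t1 ltac:(by rewrite lexx t12).
(* every point [- t] with [t1 / 4 < t < t1 / 2] is some [al u] *)
have [|u uin Eu] := @IVT R al t2 t1 (- t) t12 cal.
  by rewrite ge_min le_max; apply/andP; split; apply/orP; [right|left]; [move: l4 tb|move: l1 t2m ta]; clear; lra.
by apply: Ft; rewrite -Eu; apply: al_zero; move: uin; rewrite in_itv.
Qed.

(** Past a transversal zero the null line goes on.  In a narrow cone around the
    positive first axis [F2] is positive, so that null lines are graphs there.
    Were the slope [mu1] at [(t1, 0)] nonzero, the line through that point
    would meet the line through a point [(t, 0)] much closer to the origin,
    whose slope is much smaller; the meeting point is in the cone, and two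
    null directions there would force a zero. *)
Lemma departure (R : realType) (F1 F2 : R -> R -> R) (r p k c d N : R) t0 :
  plane_field F1 F2 r p k c d N ->
  0 < t0 -> (forall t, 0 < t < t0 -> F1 (- t) 0 = 0) ->
  0 < c ->
  exists2 e : R, 0 < e & forall t, 0 < t < e -> F1 t 0 = 0 /\ 0 < F2 t 0.
Proof.
move=> HF t0_gt0 F1_arrival c0.
have p0 := arrival_p0 HF t0_gt0 F1_arrival.
have [_ _ _ r0 _ _ [Fz1 Fz2] F_strict] := HF.
have n0 : `|0 : R| = 0 by rewrite normr0.
(* the opening of the cone, small enough for [c * a] to dominate [d * b] *)
pose la := c / (4 * (`|d| + c)).
have dc0 : 0 < `|d| + c by rewrite ltr_wpDl.
have la0 : 0 < la by rewrite divr_gt0// mulr_gt0.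
have laE : la * (`|d| + c) = c / 4 by rewrite /la; field; rewrite gt_eqF.
have d0 := normr_ge0 d.
have la1 : la <= 1 / 4.
  by rewrite -(ler_pM2r dc0) laE; move: d0; clear; lra.
have lad : la * `|d| <= c / 4.
  by rewrite -laE ler_pM2l// lerDl ltW.
pose e := Num.min (c / 16) (c * la / 8).
have e0 : 0 < e by rewrite lt_min !divr_gt0// mulr_gt0.
have e1 : e <= c / 16 by rewrite ge_min lexx.
have e2 : e <= c * la / 8 by rewrite ge_min lexx orbT.
have [D D0 HD] := F_strict e e0.
pose m := Num.min D r.
have m0 : 0 < m by rewrite lt_min D0 r0.
have mD : m <= D by rewrite ge_min lexx.
have mr : m <= r by rewrite ge_min lexx orbT.
have zD : `|0 : R| < D by rewrite normr0.
have cone a b : 0 < a -> a < m -> `|b| <= la * a -> (`|a| < r /\ `|b| < r) /\ c / 2 * a <= F2 a b.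
  move=> a0 am bla.
  have ba : `|b| <= a / 4.
    apply: (le_trans bla); rewrite mulrC -[a / 4]mulr1 -mulrA ler_pM2l//.
    by move: la1; clear; lra.
  have na : `|a| < m by rewrite gtr0_norm.
  have nb : `|b| < m by apply: (le_lt_trans ba); move: a0 am; clear; lra.
  split; first by split; exact: lt_le_trans mr.
  have [_] := HD a b 0 0 (lt_le_trans na mD) (lt_le_trans nb mD) zD zD.
  rewrite Fz2 !subr0 (gtr0_norm a0) ler_norml => /andP[h _].
  have db : - (`|d| * `|b|) <= d * b by rewrite -normrM lerNl -normrN ler_norm.
  have db' : `|d| * `|b| <= `|d| * (la * a) by rewrite ler_wpM2l.
  have db2 : `|d| * (la * a) <= c / 4 * a.
    by rewrite mulrA ler_pM2r// mulrC.
  have eb : e * (a + `|b|) <= c / 16 * (5 / 4 * a).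
    by apply: ler_pM => //; [exact: ltW|by rewrite addr_ge0// ltW|by move: ba; clear; lra].
  have ca : 0 < c * a by rewrite mulr_gt0.
  by move: h db db' db2 eb ca; clear; lra.
have axis (t : R) : 0 < t -> t < m -> c / 2 * t <= F2 t 0.
  by move=> t0' tm; have [] := cone t 0 t0' tm; rewrite // normr0 mulr_ge0// ltW.
have F1axis (q : R) : 0 < q -> exists2 m' : R, 0 < m' & forall t, 0 < t -> t < m' ->
    `|F1 t 0| <= q * t.
  move=> q0; have [D' D'0 HD'] := F_strict q q0; exists D' => // t t1 t2.
  have z' : `|0 : R| < D' by rewrite normr0.
  have tD : `|t| < D' by rewrite gtr0_norm.
  have [+ _] := HD' t 0 0 0 tD z' z' z'.
  by rewrite Fz1 p0 !subr0 mul0r mulr0 add0r subr0 normr0 addr0 (gtr0_norm t1).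
have [m1 m10 Hm1] := F1axis (c * la / 8) (ltac:(by rewrite divr_gt0// mulr_gt0)).
pose eta := Num.min m1 (m / 2).
exists eta; first by rewrite lt_min m10 divr_gt0.
move=> t1 /andP[t10 t1e].
have t1m1 : t1 < m1 by apply: (lt_le_trans t1e); rewrite ge_min lexx.
have t1m : 2 * t1 < m.
  have : t1 < m / 2 by apply: (lt_le_trans t1e); rewrite ge_min lexx orbT.
  by move: m0; clear; lra.
have t1m' : t1 < m by move: t1m t10; clear; lra.
have F2t1 := axis t1 t10 t1m'.
have F2t1' : 0 < F2 t1 0 by apply: lt_le_trans F2t1; rewrite mulr_gt0// divr_gt0.
split=> //; apply/eqP/negPn/negP => F1t1.
pose mu1 := - (F1 t1 0 / F2 t1 0).
have mu1n : mu1 != 0 by rewrite oppr_eq0 mulf_neq0// invr_neq0// gt_eqF.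
have mu1F : F1 t1 0 + F2 t1 0 * mu1 = 0.
  by rewrite /mu1; field; rewrite gt_eqF.
have slope_le (t q : R) : 0 < t -> t < m -> 0 <= q -> `|F1 t 0| <= q * t ->
    `|F1 t 0 / F2 t 0| <= 2 * q / c.
  move=> s0 sm q0 Hq; have Fp : 0 < F2 t 0.
    by apply: lt_le_trans (axis t s0 sm); rewrite mulr_gt0// divr_gt0.
  rewrite normrM normfV (gtr0_norm Fp) ler_pdivrMr//; apply: (le_trans Hq).
  have -> : q * t = 2 * q / c * (c / 2 * t) by field; rewrite gt_eqF.
  by rewrite ler_wpM2l ?axis// divr_ge0 ?mulr_ge0// ltW.
have cla0 : 0 <= c * la / 8 by rewrite divr_ge0// mulr_ge0// ltW.
have mu1la : `|mu1| <= la / 4.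
  rewrite normrN; apply: (le_trans (slope_le t1 _ t10 t1m' cla0 (Hm1 t1 t10 t1m1))).
  by have -> : 2 * (c * la / 8) / c = la / 4 by field; rewrite gt_eqF.
have mu1p : 0 < `|mu1| by rewrite normr_gt0.
have q0 : 0 < c * `|mu1| / 8 by rewrite divr_gt0// mulr_gt0.
have [m2 m20 Hm2] := F1axis _ q0.
pose t := Num.min (t1 / 4) (m2 / 2).
have tp : 0 < t by rewrite lt_min !divr_gt0.
have tt1 : t <= t1 / 4 by rewrite ge_min lexx.
have tm2 : t < m2.
  have : t <= m2 / 2 by rewrite ge_min lexx orbT.
  by move: m20; clear; lra.
have tm : t < m by move: tt1 t1m' t10; clear; lra.
have F2t : 0 < F2 t 0.
  by apply: lt_le_trans (axis t tp tm); rewrite mulr_gt0// divr_gt0.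
pose mu := - (F1 t 0 / F2 t 0).
have muF : F1 t 0 + F2 t 0 * mu = 0.
  by rewrite /mu; field; rewrite gt_eqF.
have mu4 : `|mu| <= `|mu1| / 4.
  rewrite normrN; apply: (le_trans (slope_le t _ tp tm (ltW q0) (Hm2 t tp tm2))).
  by have -> : 2 * (c * `|mu1| / 8) / c = `|mu1| / 4 by field; rewrite gt_eqF.
pose dm := mu1 - mu.
have dmge : `|mu1| * (3 / 4) <= `|dm|.
  by have := ler_dist_dist mu1 mu; rewrite -/dm ler_norml => /andP[_]; move: mu4; clear; lra.
have dmp : 0 < `|dm| by apply: lt_le_trans dmge; rewrite mulr_gt0.
have dmn : dm != 0 by rewrite -normr_gt0.
(* the lines with slopes [mu1] through [(t1, 0)] and [mu] through [(t, 0)]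
   meet at the abscissa [t1 + x] *)
pose x := mu * (t1 - t) / dm.
have xb : `|x| <= t1 / 3.
  rewrite /x normrM normfV ler_pdivrMr// normrM.
  have tt : `|t1 - t| <= t1 by rewrite ger0_norm; move: tt1 tp t10; clear; lra.
  have h1 : `|mu| * `|t1 - t| <= `|mu1| / 4 * t1 by apply: ler_pM.
  have h2 : t1 / 3 * (`|mu1| * (3 / 4)) <= t1 / 3 * `|dm|.
    by rewrite ler_wpM2l// divr_ge0// ltW.
  by move: h1 h2; clear; lra.
have xdm : x * dm = mu * (t1 - t) by rewrite /x mulfVK.
move: (xb); rewrite ler_norml => /andP[xb1 xb2].
pose a := t1 + x.
have bE : mu1 * x = mu * (a - t).
  have -> : mu * (a - t) = mu * (t1 - t) + mu * x by rewrite /a; ring.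
  by rewrite -xdm /dm; ring.
have cone1 s : 0 <= s <= 1 -> (`|t1 + s * x| < r /\ `|0 + s * (mu1 * x)| < r) /\
    0 < F2 (t1 + s * x) (0 + s * (mu1 * x)).
  move=> /andP[s0 s1].
  have sx : `|s * x| <= t1 / 3.
    by rewrite normrM (ger0_norm s0); apply: le_trans xb; rewrite ler_piMl.
  move: (sx); rewrite ler_norml => /andP[sx1 sx2].
  have sp : 0 < t1 + s * x by move: sx1 t10; clear; lra.
  have [||b1 b2] := cone (t1 + s * x) (0 + s * (mu1 * x)) sp.
  - by move: t1m sx2 t10; clear; lra.
  - rewrite add0r mulrCA normrM.
    have h : `|mu1| * `|s * x| <= la / 4 * (t1 / 3) by apply: ler_pM.
    apply: (le_trans h); rewrite -mulrA ler_pM2l//.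
    by move: t10 sx1; clear; lra.
  by split=> //; apply: lt_le_trans b2; rewrite mulr_gt0// divr_gt0.
have cone2 s : 0 <= s <= 1 -> (`|t + s * (a - t)| < r /\ `|0 + s * (mu * (a - t))| < r) /\
    0 < F2 (t + s * (a - t)) (0 + s * (mu * (a - t))).
  move=> /andP[s0 s1].
  have at0 : 0 <= a - t by rewrite /a; move: xb1 tt1 t10; clear; lra.
  have sa : 0 <= s * (a - t) by rewrite mulr_ge0.
  have sa1 : s * (a - t) <= a - t by rewrite ler_piMl.
  have sp : 0 < t + s * (a - t) by move: tp sa; clear; lra.
  have [||b1 b2] := cone (t + s * (a - t)) (0 + s * (mu * (a - t))) sp.
  - by move: t1m sa1 xb2 t10; rewrite /a; clear; lra.
  - rewrite add0r mulrCA normrM (ger0_norm sa).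
    apply: ler_pM => //; last by move: tp; clear; lra.
    by move: mu4 mu1la la0 mu1p; clear; lra.
  by split=> //; apply: lt_le_trans b2; rewrite mulr_gt0// divr_gt0.
have nz1 : F1 (t1 + x) (0 + mu1 * x) * x + F2 (t1 + x) (0 + mu1 * x) * (mu1 * x) = 0.
  apply: (segment_straight HF); first by move=> s /cone1[].
    move=> s /andP[s0 s1] [_ z2].
    have s01 : 0 <= s <= 1 by rewrite s0 ltW.
    by have [_] := cone1 s s01; rewrite z2 ltxx.
  rewrite [F2 t1 0 * _]mulrA -[LHS]mulrDl.
  by rewrite mu1F mul0r.
have nz2 : F1 (t + (a - t)) (0 + mu * (a - t)) * (a - t) +
    F2 (t + (a - t)) (0 + mu * (a - t)) * (mu * (a - t)) = 0.
  apply: (segment_straight HF); first by move=> s /cone2[].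
    move=> s /andP[s0 s1] [_ z2].
    have s01 : 0 <= s <= 1 by rewrite s0 ltW.
    by have [_] := cone2 s s01; rewrite z2 ltxx.
  rewrite [F2 t 0 * _]mulrA -[LHS]mulrDl.
  by rewrite muF mul0r.
rewrite subrKC -bE -/a add0r in nz2.
have {}nz2 : F1 a (mu1 * x) + F2 a (mu1 * x) * mu = 0.
  have at0 : a - t != 0 by rewrite gt_eqF// /a; move: xb1 tt1 t10; clear; lra.
  apply: (mulIf at0); rewrite mul0r mulrDl -mulrA -bE.
  exact: nz2.
have {}nz1 : F1 a (mu1 * x) + F2 a (mu1 * x) * mu1 = 0.
  have [x0|xn] := eqVneq x 0; first by rewrite /a x0 mulr0 addr0.
  apply: (mulIf xn); rewrite mul0r mulrDl -mulrA.
  by move: nz1; rewrite add0r.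
have [|_] := cone1 1; first by rewrite ler01 lexx.
rewrite !mul1r add0r -/a => Fp.
have : F2 a (mu1 * x) * dm = 0.
  by rewrite /dm mulrBr; move: nz1 nz2; clear; lra.
by move=> /eqP; rewrite mulf_eq0 (negbTE dmn) orbF gt_eqF.
Qed.

(** * Lifts of lines *)

Section Lifts.
Context {R : realType} {M : topologicalType}.
Context (A : set (chart R M)) (f : M -> 'rV[R]_3).
Context (hM : C2_2manifold A) (hf : C2_immersion A f).

Notation T := (tangent_plane A f).

Lemma graph_coord_eq (m : M) (v1 v2 n : 'rV[R]_3) (r : R) (G : 'rV[R]_2 -> M)
    (phi : 'rV[R]_2 -> R) (N : set M) (y : 'rV[R]_2) (a b z : R) :
  is_graph A f m v1 v2 n r G phi N -> `|y| < r ->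
  f (G y) = f m + (a *: v1 + b *: v2 + z *: n) -> y = pt2 a b /\ phi y = z.
Proof.
move=> gG yr; rewrite (graph_eq gG yr) => /addrI E.
by have [y0 y1 ->] := frame_coord_inj (graph_frame gG) E; rewrite [y]pt2_eta y0 y1.
Qed.

Section Follow.
Context (m : M) (v1 v2 n : 'rV[R]_3) (r : R) (G : 'rV[R]_2 -> M)
  (phi : 'rV[R]_2 -> R) (N : set M).
Hypothesis gG : is_graph A f m v1 v2 n r G phi N.
Context (g : R -> M) (q : 'rV[R]_3) (d0 d1 nu t : R) (y : 'rV[R]_2).
Let w := d0 *: v1 + d1 *: v2 + nu *: n.
Hypotheses (yr : `|y| < r) (gt : g t = G y) (cg : {for t, continuous g}).
Hypothesis gl : \forall s \near t, f (g s) = q + s *: w.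

Let ys (s : R) := pt2 (y 0 0 + (s - t) * d0) (y 0 1 + (s - t) * d1).

(** A lift of a line, that is a continuous curve of the surface above it, is
    read off from the graph chart by projecting the line. *)
Lemma graph_follow : \forall s \near t,
  [/\ `|ys s| < r, g s = G (ys s) & phi (ys s) = phi y + (s - t) * nu].
Proof.
have Nt : N (g t) by rewrite gt; exact: graph_in gG _ yr.
have Ns : \forall s \near t, N (g s).
  by apply: cg; apply: open_nbhs_nbhs; split => //; exact: graph_open gG.
have gtl := nbhs_singleton gl.
near=> s.
have Ngs : N (g s) by near: s.
have gsl : f (g s) = q + s *: w by near: s.
have [y' y'r Gy'] := graph_surj gG Ngs.
have E : f (G y') = f m + ((y 0 0 + (s - t) * d0) *: v1 + (y 0 1 + (s - t) * d1) *: v2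
   + (phi y + (s - t) * nu) *: n).
  have := graph_eq gG yr; rewrite -gt gtl Gy' gsl => e0.
  have -> : q + s *: w = q + t *: w + (s - t) *: w by apply/rowP => i; rewrite !mxE; ring.
  rewrite e0 /w; apply/rowP => i; rewrite !mxE; ring.
by have [y'E pe] := graph_coord_eq gG y'r E; rewrite /ys -y'E.
Unshelve. all: by end_near. Qed.

Lemma graph_follow_diff : 'd phi y (pt2 d0 d1) = nu.
Proof.
have dphi := graph_differentiable gG yr.
have Ct : Ck_on 1 setT ys.
  apply: (@Ck_on_pt2 R 1 setT (fun s => y 0 0 + (s - t) * d0) (fun s => y 0 1 + (s - t) * d1) openT).
    apply: (Ck_onD openT); first exact: Ck_on_cst.
    apply: (Ck_onM openT); last exact: Ck_on_cst.
    by apply: (Ck_onB openT); [exact: Ck_on_id|exact: Ck_on_cst].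
  apply: (Ck_onD openT); first exact: Ck_on_cst.
  apply: (Ck_onM openT); last exact: Ck_on_cst.
  by apply: (Ck_onB openT); [exact: Ck_on_id|exact: Ck_on_cst].
have dys : differentiable ys t by have [+ _] := Ct; exact.
have yst : ys t = y by rewrite /ys subrr !mul0r !addr0 -pt2_eta.
have dysE : 'D_1 ys t = pt2 d0 d1.
  have [_ E0] := is_derive_entry 0 dys; have [_ E1] := is_derive_entry 1 dys.
  have aff (a b : R) : 'D_1 (fun s : R => a + (s - t) * b) t = b.
    have h : is_derive t (1 : R) (fun s : R => a + (s - t) * b) b.
      by apply: is_derive_eq; rewrite /GRing.scale/=; ring.
    by have [_ ->] := h.
  rewrite [LHS]pt2_eta -E0 -E1; congr pt2.
    by rewrite -[RHS](aff (y 0 0)); congr ('D_1 _ t); apply/funext => s; rewrite pt2E.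
  by rewrite -[RHS](aff (y 0 1)); congr ('D_1 _ t); apply/funext => s; rewrite pt2E.
have h : differentiable phi (ys t) by rewrite yst.
have [_ E] := is_derive_comp_curve dys h.
rewrite -dysE -[in LHS]yst -E.
have h2 : is_derive t (1 : R) (fun s : R => phi y + (s - t) * nu) nu.
  by apply: is_derive_eq; rewrite /GRing.scale/=; ring.
have [_ <-] := h2; apply: near_eq_derive.
by apply: filterS graph_follow => s [].
Qed.

Lemma graph_follow_tangent : T (g t) w.
Proof.
rewrite gt; apply/(graph_tangent gG yr); exists (pt2 d0 d1).
by rewrite !pt2E graph_follow_diff.
Qed.

End Follow.

Lemma graph_axis_continuous (m : M) (v1 v2 n : 'rV[R]_3) (r : R) (G : 'rV[R]_2 -> M)
    (phi : 'rV[R]_2 -> R) (N : set M) (s : R) :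
  is_graph A f m v1 v2 n r G phi N -> `|pt2 s 0| < r ->
  {for s, continuous (fun s => G (pt2 s 0))}.
Proof.
move=> gG sr.
have -> : (fun s : R => G (pt2 s 0)) = G \o (fun s => pt2 (0 + s * 1) (0 + s * 0)).
  by apply/funext => u /=; rewrite !add0r mulr1 mulr0.
apply: continuous_comp; first exact: segment_continuous.
by apply: (graph_cont gG); rewrite !add0r mulr1 mulr0.
Qed.

Lemma graph_at m : exists v1 v2 n r G phi N,
  [/\ T m v1, T m v2 & is_graph A f m v1 v2 n r G phi N].
Proof.
have [w Tw wn] := tangent_neq0 hM hf m.
have [v2 [n [Tv2 uB]]] := tangent_basis hM hf Tw wn.
have [r [G [phi [N gG]]]] := local_graph hM hf Tw Tv2 uB.
by exists w, v2, n, r, G, phi, N.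
Qed.

(** Lifts are only assumed continuous; their regularity comes from the graph
    chart. *)
Lemma lift_tangent (g : R -> M) q w t : {for t, continuous g} ->
  (\forall s \near t, f (g s) = q + s *: w) -> T (g t) w.
Proof.
move=> cg gl; have [v1 [v2 [n [r [G [phi [N [Tv1 Tv2 gG]]]]]]]] := graph_at (g t).
have [a [b [c wE]]] := frame_span w (graph_frame gG).
rewrite wE in gl *.
exact: (graph_follow_tangent gG (graph_norm0 gG) (esym (graph_base gG)) cg gl).
Qed.

Lemma f_continuous m : {for m, continuous f}.
Proof.
have [c Ac dm] := chart_of hM m; have [od ocd cc cp pK] := chartP hM Ac.
have cu : cdom c (coord c m) by exists m.
have cX : {for coord c m, continuous (f \o param c)}.
  by apply: differentiable_continuous; exact: (immersion_differentiable hf Ac cu).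
have cY : {for m, continuous ((f \o param c) \o coord c)}.
  by apply: continuous_comp; [exact: cc|exact: cX].
have E : \forall m' \near m, ((f \o param c) \o coord c) m' = f m'.
  by have := open_nbhs_nbhs (conj od dm); apply: filterS => m' dm' /=; rewrite pK.
have Em := nbhs_singleton E; rewrite /= in Em.
rewrite /prop_for /continuous_at -[X in _ --> X]Em.
exact: (cvg_trans (near_eq_cvg E) cY).
Qed.

Lemma line_near (g : R -> M) q w a b t :
  (forall s, a < s < b -> {for s, continuous g} /\ f (g s) = q + s *: w) ->
  a < t < b -> \forall s \near t, f (g s) = q + s *: w.
Proof.
move=> Hg tab; have tin : t \in `]a, b[ by rewrite in_itv.
by apply: filterS (near_in_itvoo tin) => s; rewrite in_itv/= => /Hg[].
Qed.

Lemma line_tangent (g : R -> M) q w a b t :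
  (forall s, a < s < b -> {for s, continuous g} /\ f (g s) = q + s *: w) ->
  a < t < b -> T (g t) w.
Proof.
by move=> Hg tab; exact: (lift_tangent (Hg t tab).1 (line_near Hg tab)).
Qed.

(** Tangent planes vary continuously: the slope of the graph in the direction
    of [w] is a continuous function of the point. *)
Lemma tangent_closed (I : Type) (F : set_system I) (PF : ProperFilter F)
    (g : I -> M) m w :
  g i @[i --> F] --> m -> (\forall i \near F, T (g i) w) -> T m w.
Proof.
move=> gm Tg; have [v1 [v2 [n [r [G [phi [N [Tv1 Tv2 gG]]]]]]]] := graph_at m.
have [a [b [c wE]]] := frame_span w (graph_frame gG).
suff E : 'd phi 0 (pt2 a b) = c.
  rewrite -(graph_base gG); apply/(graph_tangent gG (graph_norm0 gG)).
  by exists (pt2 a b); rewrite !pt2E E.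
have [dphi Cd] := graph_C2 gG.
pose k y := a * 'D_('e_0) phi y + b * 'D_('e_1) phi y.
have kE y : `|y| < r -> 'd phi y (pt2 a b) = k y.
  move=> yr; apply: (etrans (diff_pt2 _ (dphi y yr))); by rewrite !pt2E.
have Ck0 : Ck_on 1 [set y | `|y| < r] k.
  have oD := @open_norm_lt R 2 r.
  apply: (Ck_onD oD); apply: (Ck_onM oD); try exact: Ck_on_cst; exact: Cd.
have ck : {for (0 : 'rV[R]_2), continuous k} by exact: (Ck_on0 Ck0 (graph_norm0 gG)).
rewrite kE; last exact: graph_norm0 gG.
have Nm : N m by rewrite -(graph_base gG); exact: graph_in gG _ (graph_norm0 gG).
have NF : \forall i \near F, N (g i).
  by apply: gm; apply: open_nbhs_nbhs; split => //; exact: graph_open gG.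
pose yc i := plane_coord (frame v1 v2 n) (f (g i) - f m).
have ycE i : N (g i) -> `|yc i| < r /\ G (yc i) = g i.
  move=> /(graph_surj gG)[y yr Gy].
  suff -> : yc i = y by [].
  rewrite /yc -Gy (graph_eq gG yr) addrAC subrr add0r.
  have [h0 h1 _] := plane_coord_frame (y 0 0) (y 0 1) (phi y) (graph_frame gG).
  by rewrite [LHS]pt2_eta h0 h1 -pt2_eta.
have ycc : yc i @[i --> F] --> (0 : 'rV[R]_2).
  have [L LE] := plane_coord_mulmx (frame v1 v2 n).
  have cfm : f (g i) - f m @[i --> F] --> f m - f m.
    apply: cvgB; last exact: cvg_cst.
    by apply: continuous_cvg; [exact: f_continuous|exact: gm].
  rewrite subrr in cfm.
  have -> : yc = (fun i => mulmxr L (f (g i) - f m)) by apply/funext => i; exact: LE.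
  have L0 : mulmxr L (0 : 'rV[R]_3) = 0 by exact: mul0mx.
  rewrite -[X in _ --> X]L0.
  apply: (cvg_comp (fun i => f (g i) - f m) (mulmxr L) cfm).
  exact: mulmxr_continuous.
have kc : k (yc i) @[i --> F] --> k 0 by apply: continuous_cvg; [exact: ck|exact: ycc].
have kcst : k (yc i) @[i --> F] --> c.
  apply: cvg_near_cst; near=> i.
  have Ngi : N (g i) by near: i.
  have Ti : T (g i) w by near: i.
  have [yr Gy] := ycE i Ngi; rewrite -kE//.
  move: Ti; rewrite -Gy => /(graph_tangent gG yr)[d]; rewrite wE.
  move=> /(frame_coord_inj (graph_frame gG))[-> -> ->].
  by rewrite -pt2_eta.
exact: (cvg_unique _ kc kcst).
Unshelve. all: by end_near. Qed.

Lemma line_limit_tangent (g : R -> M) q w a b m : a < b ->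
  (forall s, a < s < b -> {for s, continuous g} /\ f (g s) = q + s *: w) ->
  g t @[t --> b^'-] --> m -> T m w.
Proof.
move=> ab Hg gm; apply: (@tangent_closed R (b^'-) _ g m w gm); near=> t.
apply: (line_tangent Hg); apply/andP; split.
  by near: t; exact: nbhs_left_gt.
by near: t; exact: nbhs_left_lt.
Unshelve. all: by end_near. Qed.

End Lifts.

(** * The plane field at a singular point *)

Section SingularPoints.
Context {R : realType} {M : topologicalType}.
Context (A : set (chart R M)) (f : M -> 'rV[R]_3).
Context (hM : C2_2manifold A) (hf : C2_immersion A f).
Context (hmin : p_minimal A f).

Notation T := (tangent_plane A f).

(** The coefficients of the contact form restricted to the graph of [phi] over
    a contact plane: the gradient of [phi] plus the linear field whose curl is
    that of the contact form. *)
Definition field1 (phi : 'rV[R]_2 -> R) (N : R) (a b : R) : R :=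
  'D_('e_0) phi (pt2 a b) - N * b.
Definition field2 (phi : 'rV[R]_2 -> R) (N : R) (a b : R) : R :=
  'D_('e_1) phi (pt2 a b) + N * a.

(** In the frame made of [w], the horizontal lift of its rotation by a right
    angle and the vertical, the restricted form is the one above with
    [N = |w|^2] (projected norm); the curl is twice this number because the
    second derivatives of [phi] are symmetric. *)
Lemma singular_plane_field m w :
  singular A f m -> Theta (f m) w = 0 -> w != 0 ->
  let N := xco w ^+ 2 + yco w ^+ 2 in
  exists v2 n r G phi U p k c d,
  [/\ T m w, T m v2, is_graph A f m w v2 n r G phi U,
      plane_field (field1 phi N) (field2 phi N) r p k c d N &
      forall a b e1 e2, `|a| < r -> `|b| < r ->
        Theta (f (G (pt2 a b))) (e1 *: w + e2 *: v2 + 'd phi (pt2 a b) (pt2 e1 e2) *: n) =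
        field1 phi N a b * e1 + field2 phi N a b * e2].
Proof.
move=> sm Thw wn N; have N0 : 0 < N := legendrian_xy Thw wn.
have Tsing v : Theta (f m) v = 0 -> T m v by rewrite sm.
pose v2 := row3 (- yco w) (xco w) (- (xco (f m) * xco w + yco (f m) * yco w)).
pose n : 'rV[R]_3 := row3 0 0 1.
have [v2x v2y v2z] : [/\ xco v2 = - yco w, yco v2 = xco w &
    zco v2 = - (xco (f m) * xco w + yco (f m) * yco w)] by exact: row3E.
have [nx ny nz] : [/\ xco n = 0, yco n = 0 & zco n = 1] by exact: row3E.
have Thv2 : Theta (f m) v2 = 0 by rewrite /Theta v2x v2y v2z; ring.
have Thn q : Theta q n = 1 by rewrite /Theta nx ny nz; ring.
have uB : frame w v2 n \in unitmx.
  apply: frame_unit; rewrite /det3 nx ny nz v2x v2y.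
  have -> : xco w * (xco w * 1 - zco v2 * 0) - yco w * (- yco w * 1 - zco v2 * 0) +
    zco w * (- yco w * 0 - xco w * 0) = N by rewrite /N; ring.
  by rewrite gt_eqF.
have Tw := Tsing _ Thw; have Tv2 := Tsing _ Thv2.
have [r [G [phi [U gG]]]] := local_graph hM hf Tw Tv2 uB.
have z0 := graph_norm0 gG.
have oD := @open_norm_lt R 2 r; set D := [set y : 'rV[R]_2 | `|y| < r] in oD.
have Cphi := graph_C2 gG; rewrite -/D in Cphi.
have bD a b : `|a| < r -> `|b| < r -> D (pt2 a b) by move=> *; exact: pt2_norm_lt.
have C1 d : Ck_on 1 D ('D_d phi) := proj2 Cphi d.
have dphi0 d : 'D_d phi 0 = 0.
  apply: (etrans (deriveE d (graph_differentiable gG z0))).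
  exact: (graph_diff0 gG Tw Tv2).
have dphiE a b e1 e2 : `|a| < r -> `|b| < r -> 'd phi (pt2 a b) (pt2 e1 e2) =
    e1 * 'D_('e_0) phi (pt2 a b) + e2 * 'D_('e_1) phi (pt2 a b).
  move=> ar br; apply: (etrans (diff_pt2 _ (graph_differentiable gG (bD a b ar br)))).
  by rewrite !pt2E.
have ThE a b e1 e2 : `|a| < r -> `|b| < r ->
    Theta (f (G (pt2 a b))) (e1 *: w + e2 *: v2 + 'd phi (pt2 a b) (pt2 e1 e2) *: n) =
    field1 phi N a b * e1 + field2 phi N a b * e2.
  move=> ar br; rewrite (graph_eq gG (bD a b ar br)) dphiE//.
  set q := f m in Thw Thv2 *; set k := _ + e2 * 'D_('e_1) phi _.
  rewrite ThetaD ThetaZ Thn mulr1.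
  have -> : Theta (q + (pt2 a b 0 0 *: w + pt2 a b 0 1 *: v2 + phi (pt2 a b) *: n))
     (e1 *: w + e2 *: v2) = N * (a * e2 - b * e1).
    rewrite !pt2E /Theta.
    have lin (s1 s2 s3 : R) (u1 u2 u3 : 'rV[R]_3) :
       [/\ xco (s1 *: u1 + s2 *: u2 + s3 *: u3) = s1 * xco u1 + s2 * xco u2 + s3 * xco u3,
           yco (s1 *: u1 + s2 *: u2 + s3 *: u3) = s1 * yco u1 + s2 * yco u2 + s3 * yco u3 &
           zco (s1 *: u1 + s2 *: u2 + s3 *: u3) = s1 * zco u1 + s2 * zco u2 + s3 * zco u3].
      by rewrite /xco /yco /zco !mxE.
    have [-> -> _] := coD q (a *: w + b *: v2 + phi (pt2 a b) *: n).
    have [-> -> _] := lin a b (phi (pt2 a b)) w v2 n.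
    have [X Y Z] := lin e1 e2 0 w v2 n; rewrite !scale0r !addr0 in X Y Z.
    rewrite X Y Z nx ny.
    have Tw' : zco w = yco q * xco w - xco q * yco w by move: Thw; rewrite /Theta; lra.
    by rewrite Tw' v2x v2y v2z /N; ring.
  by rewrite /k /field1 /field2; ring.
(* the linear part of the two coefficients at the origin *)
pose p := 'D_('e_0) ('D_('e_0) phi) 0.
pose k := 'D_('e_1) ('D_('e_0) phi) 0 - N.
pose c := 'D_('e_0) ('D_('e_1) phi) 0 + N.
pose d := 'D_('e_1) ('D_('e_1) phi) 0.
exists v2, n, r, G, phi, U, p, k, c, d; split => //; split.
- move=> a b e1 e2 [ar br] nz' F0.
  pose y := pt2 a b; have yr : `|y| < r by exact: bD.
  have [E|en] := eqVneq (pt2 e1 e2) 0.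
    exists 1 => // s _.
    have -> : e1 = 0 by have := pt2E e1 e2; rewrite E !mxE => -[].
    have -> : e2 = 0 by have := pt2E e1 e2; rewrite E !mxE => -[].
    by rewrite !mulr0 addr0.
  pose nu := 'd phi y (pt2 e1 e2).
  pose w' := e1 *: w + e2 *: v2 + nu *: n.
  have Tw' : T (G y) w'.
    by apply/(graph_tangent gG yr); exists (pt2 e1 e2); rewrite !pt2E.
  have Thw' : Theta (f (G y)) w' = 0 by rewrite (ThE a b e1 e2 ar br).
  have wn' : w' != 0.
    apply: contra en => /eqP E.
    have E0 : w' = 0 *: w + 0 *: v2 + 0 *: n by rewrite E !scale0r !addr0.
    by have [-> -> _] := frame_coord_inj uB E0; rewrite pt20.
  have ns : ~ singular A f (G y).
    apply/(nonsingularP hM hf).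
    have tg u1 u2 : T (G y) (u1 *: w + u2 *: v2 + 'd phi y (pt2 u1 u2) *: n).
      by apply/(graph_tangent gG yr); exists (pt2 u1 u2); rewrite !pt2E.
    have [F10|F1n] := eqVneq (field1 phi N a b) 0.
      exists (0 *: w + 1 *: v2 + 'd phi y (pt2 0 1) *: n); first exact: tg.
      rewrite (ThE a b 0 1 ar br) mulr0 add0r mulr1.
      by apply/eqP => F20; apply: nz'.
    exists (1 *: w + 0 *: v2 + 'd phi y (pt2 1 0) *: n); first exact: tg.
    by rewrite (ThE a b 1 0 ar br) mulr0 addr0 mulr1.
  have [e e0 [g g0 Hg]] := nonsingular_lift hM hf hmin ns Tw' Thw' wn'.
  have near_line t : - e < t < e -> \forall s \near t, f (g s) = f (G y) + s *: w'.
    exact: line_near Hg.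
  have ze : - e < 0 < e by rewrite oppr_lt0 e0.
  have := graph_follow gG yr g0 (Hg 0 ze).1 (near_line 0 ze).
  move=> /nbhs_normP[e' /= e'0 He'].
  exists (Num.min e e'); first by rewrite lt_min e0 e'0.
  move=> s; rewrite lt_min => /andP[se se'].
  have {}se : - e < s < e by rewrite -ltr_norml.
  have [] := He' s; first by rewrite /ball_ /= sub0r normrN.
  rewrite !pt2E !subr0 => ysr gs _.
  have [asr bsr] := norm_pt2 ysr; rewrite !pt2E in asr bsr.
  have dnu := graph_follow_diff gG ysr gs (Hg s se).1 (near_line s se).
  apply: (etrans (esym (ThE _ _ _ _ asr bsr))).
  transitivity (Theta (f (g s)) w').
    apply: (congr2 Theta (congr1 f (esym gs))).
    exact: (congr1 (fun x => e1 *: w + e2 *: v2 + x *: n) dnu).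
  by rewrite (Hg s se).2; apply: (etrans (Theta_line _ _ _)).
- move=> a b e1 e2 s [ar br]; rewrite /field1.
  apply: cvgB.
    have c1 := @segment_continuous R a b e1 e2 s.
    have c2 := Ck_on0 (C1 'e_0) (bD _ _ ar br).
    exact: (cvg_comp (fun s : R => pt2 (a + s * e1) (b + s * e2)) _ c1 c2).
  apply: cvgMl_tmp; apply: cvgD; first exact: cvg_cst.
  by apply: cvgMr_tmp; exact: cvg_id.
- move=> a b e1 e2 s [ar br]; rewrite /field2.
  apply: cvgD.
    have c1 := @segment_continuous R a b e1 e2 s.
    have c2 := Ck_on0 (C1 'e_1) (bD _ _ ar br).
    exact: (cvg_comp (fun s : R => pt2 (a + s * e1) (b + s * e2)) _ c1 c2).
  apply: cvgMl_tmp; apply: cvgD; first exact: cvg_cst.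
  by apply: cvgMr_tmp; exact: cvg_id.
- exact: graph_gt0 gG.
- exact: N0.
- rewrite /c /k (Schwarz _ _ oD z0 Cphi); ring.
- by rewrite /field1 /field2 pt20 !dphi0 !mulr0 subr0 addr0.
- move=> e e0.
  have [D1 D10 HD1] := C1_strict_scalar oD z0 (C1 'e_0) e0.
  have [D2 D20 HD2] := C1_strict_scalar oD z0 (C1 'e_1) e0.
  exists (Num.min D1 D2); first by rewrite lt_min D10 D20.
  move=> a b a' b'; rewrite !lt_min => /andP[a1 a2] /andP[b1 b2] /andP[a1' a2'] /andP[b1' b2'].
  have dd (u : 'rV[R]_2) : (differentiable ('D_u phi) 0) by exact: (proj1 (C1 u) 0 z0).
  have ab : e * `|pt2 a b - pt2 a' b'| <= e * (`|a - a'| + `|b - b'|).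
    by rewrite ler_pM2l// pt2B pt2_norm_le.
  split; apply: le_trans ab.
    have := HD1 (pt2 a b) (pt2 a' b'); rewrite !subr0 => /(_ (pt2_norm_lt a1 b1) (pt2_norm_lt a1' b1')).
    have -> : 'd ('D_('e_0) phi) 0 (pt2 a b - pt2 a' b') = (a - a') * p + (b - b') * (k + N).
      rewrite pt2B; apply: (etrans (diff_pt2 _ (dd 'e_0))); rewrite !pt2E.
      by rewrite /p /k subrK.
    congr (`|_| <= _); rewrite /field1; ring.
  have := HD2 (pt2 a b) (pt2 a' b'); rewrite !subr0 => /(_ (pt2_norm_lt a2 b2) (pt2_norm_lt a2' b2')).
  have -> : 'd ('D_('e_1) phi) 0 (pt2 a b - pt2 a' b') = (a - a') * (c - N) + (b - b') * d.
    rewrite pt2B; apply: (etrans (diff_pt2 _ (dd 'e_1))); rewrite !pt2E.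
    by rewrite /d /c addrK.
  congr (`|_| <= _); rewrite /field2; ring.
Qed.

End SingularPoints.

(** * Length of curves *)

Section Lengths.
Context {R : realType} {M : topologicalType}.
Context (A : set (chart R M)) (f : M -> 'rV[R]_3).
Context (hM : C2_2manifold A) (hf : C2_immersion A f).

Lemma entry_le_euclidean (v : 'rV[R]_3) i : `|v 0 i| <= euclidean_norm v.
Proof.
rewrite /euclidean_norm -sqrtr_sqr ler_sqrt ?sumr_ge0//; last by move=> j _; exact: sqr_ge0.
by rewrite (bigD1 i)//= lerDl sumr_ge0// => j _; exact: sqr_ge0.
Qed.

Lemma euclidean_le_norm (v : 'rV[R]_3) : euclidean_norm v <= 2 * `|v|.
Proof.
have n0 : 0 <= 2 * `|v| by rewrite mulr_ge0.
rewrite /euclidean_norm -(ger0_norm n0) -sqrtr_sqr ler_sqrt ?sqr_ge0//.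
apply: (@le_trans _ _ (\sum_(i < 3) `|v| ^+ 2)).
  apply: ler_sum => i _; rewrite -normr_id -real_normK ?num_real//.
  by rewrite lerXn2r ?nnegrE ?normr_id ?entry_le_norm.
rewrite sumr_const card_ord exprMn -[_ *+ 3]mulr_natl ler_wpM2r ?sqr_ge0//.
by rewrite -natrX ler_nat.
Qed.

Lemma euclidean_norm_continuous : continuous (@euclidean_norm R).
Proof.
move=> v; rewrite /euclidean_norm.
apply: (@continuous_comp _ _ _ (fun v : 'rV[R]_3 => \sum_(i < 3) v 0 i ^+ 2) Num.sqrt).
  have C : Ck_on 0 setT (fun v : 'rV[R]_3 => \sum_(i < 3) v 0 i * v 0 i).
    apply: Ck_on_sum => [|i]; first exact: openT.
    by apply: (Ck_onM openT); exact: (Ck_on_entry i openT (Ck_on_id 0 setT)).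
  have <- : (fun v : 'rV[R]_3 => \sum_(i < 3) v 0 i * v 0 i) =
      (fun v : 'rV[R]_3 => \sum_(i < 3) v 0 i ^+ 2).
    by apply/funext => u; apply: eq_bigr => i _; rewrite expr2.
  exact: (C v Logic.I).
exact: sqrt_continuous.
Qed.

Lemma curve_immersed (g : R -> M) : Ck_curve A 1 setT g -> Ck_on 1 setT (f \o g).
Proof.
move=> [cg Cg]; apply: Ck_on_local => t _.
have [c Ac dc] := chart_of hM (g t); have [od ocd _ _ pK] := chartP hM Ac.
exists (setT `&` g @^-1` dom c).
  rewrite openE => s [_ ds]; apply: filterI; first exact: filterT.
  by apply: (cg s Logic.I); apply: open_nbhs_nbhs.
split=> //.
have oI : open (setT `&` g @^-1` dom c).
  rewrite openE => s [_ ds]; apply: filterI; first exact: filterT.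
  by apply: (cg s Logic.I); apply: open_nbhs_nbhs.
have [CX _] := hf Ac.
have C := @Ck_on_comp_rV R R 2 3 1 _ (cdom c) (coord c \o g) (f \o param c) oI ocd.
apply: (Ck_on_eq oI _ (C _ (Cg c Ac) (Ck_on_leq (isT : (1 <= 2)%N) CX))).
  by move=> s [_ ds] /=; rewrite pK.
by move=> s [_ ds]; exists (g s).
Qed.

Section Curve.
Context (g : R -> M) (Cg : Ck_curve A 1 setT g).
Let Q := f \o g.
Let dQ := derive1 Q.

Lemma curve_derive_continuous : continuous dQ.
Proof.
have [_ /(_ 1) C] := curve_immersed Cg.
move=> t; have := C t Logic.I.
by have -> : dQ = 'D_1 Q by apply/funext => s; rewrite /dQ derive1E.
Qed.

Lemma curve_entry_derive t i : is_derive t (1 : R) (fun t => Q t 0 i) (dQ t 0 i).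
Proof.
have [dC _] := curve_immersed Cg.
by rewrite /dQ derive1E; apply: is_derive_entry; exact: dC.
Qed.

Lemma speed_continuous : continuous (fun t => euclidean_norm (dQ t)).
Proof.
move=> t; apply: (@continuous_comp _ _ _ dQ (@euclidean_norm R)).
  exact: curve_derive_continuous.
exact: euclidean_norm_continuous.
Qed.

Lemma speed_measurable (D : set (measurableTypeR R)) : measurable D ->
  measurable_fun D (fun t : measurableTypeR R => (euclidean_norm (dQ t) : measurableTypeR R)).
Proof.
move=> mD.
by apply: measurable_funTS; apply: continuous_measurable_fun; exact: speed_continuous.
Qed.

Lemma curve_length_le (K : R) :
  (forall t, 0 <= t <= 1 -> euclidean_norm (dQ t) <= K) ->
  (curve_length f g <= K%:E)%E.
Proof.
move=> HK; rewrite /curve_length.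
apply: (@le_trans _ _ (\int[lebesgue_measure]_(t in `[0%R, 1%R]) (cst K%:E) t)%E).
  apply: ge0_le_integral => //.
  - by move=> t _; rewrite lee_fin sqrtr_ge0.
  - by apply/measurable_EFinP; exact: speed_measurable.
rewrite integral_cst//= lebesgue_measure_itv/= lte_fin ltr01 -EFinB subr0 mule1.
by [].
Qed.

(** The length bounds the displacement of every coordinate from the end
    point, hence keeps the whole curve near it. *)
Lemma curve_length_ge t i : 0 <= t <= 1 ->
  ((`|Q 1 0 i - Q t 0 i|%R)%:E <= curve_length f g)%E.
Proof.
move=> /andP[t0 t1]; rewrite /curve_length.
have L0 : (0 <= \int[lebesgue_measure]_(t in `[0%R, 1%R]) (euclidean_norm (dQ t))%:E)%E.
  by apply: integral_ge0 => s _; rewrite lee_fin sqrtr_ge0.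
move: t1; rewrite le_eqVlt => /orP[/eqP ->|t1]; first by rewrite subrr normr0.
pose u (s : R) := Q s 0 i; pose du (s : R) := dQ s 0 i.
have du' (s : R) : is_derive s (1 : R) u (du s) by exact: curve_entry_derive.
have cu : continuous u.
  move=> s; apply: differentiable_continuous; apply/derivable1_diffP.
  by case: (du' s).
have cdu : continuous du.
  move=> s; apply: (@continuous_comp _ _ _ dQ (fun v : 'rV[R]_3 => v 0 i)).
    exact: curve_derive_continuous.
  exact: coord_continuous.
have E : (\int[lebesgue_measure]_(x in `[t, 1%R]) (du x)%:E = (u 1)%:E - (u t)%:E)%E.
  apply: continuous_FTC2 => //.
  - exact: continuous_subspaceT.
  - split; first by move=> s _; case: (du' s).
      by apply: cvg_at_right_filter; exact: cu.
    by apply: cvg_at_left_filter; exact: cu.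
  - by move=> s _; rewrite derive1E; case: (du' s).
have mdu (D : set (measurableTypeR R)) : measurable D ->
    measurable_fun D (fun t : measurableTypeR R => (du t : measurableTypeR R)).
  move=> mD.
  by apply: measurable_funTS; apply: continuous_measurable_fun.
rewrite -/(u 1) -/(u t).
have -> : ((`|u 1 - u t|%R)%:E = `| (u 1)%:E - (u t)%:E |)%E by [].
rewrite -E; apply: (le_trans (le_abse_integral _ _ _)) => //; first by apply/measurable_EFinP; exact: mdu.
apply: (@le_trans _ _ (\int[lebesgue_measure]_(s in `[t, 1%R]) (euclidean_norm (dQ s))%:E)%E).
  apply: ge0_le_integral => //.
  - by apply: measurableT_comp => //; apply/measurable_EFinP; exact: mdu.
  - by apply/measurable_EFinP; exact: speed_measurable.
  - by move=> s _; rewrite lee_fin; exact: entry_le_euclidean.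
apply: ge0_subset_integral => //.
- by apply/measurable_EFinP; exact: speed_measurable.
- by move=> s _; rewrite lee_fin sqrtr_ge0.
- by move=> s; rewrite /= !in_itv/= => /andP[h1 ->]; rewrite (le_trans t0 h1).
Qed.

End Curve.

End Lengths.

(** * Induced distance and graph charts *)

Section Completeness.
Context {R : realType} {M : topologicalType}.
Context (A : set (chart R M)) (f : M -> 'rV[R]_3).
Context (hM : C2_2manifold A) (hf : C2_immersion A f).

Section GraphUnique.
Context (m : M) (v1 v2 n : 'rV[R]_3) (r : R) (G : 'rV[R]_2 -> M)
  (phi : 'rV[R]_2 -> R) (N : set M).
Hypothesis gG : is_graph A f m v1 v2 n r G phi N.
Let pc (m' : M) := plane_coord (frame v1 v2 n) (f m' - f m).

Lemma graph_pc m' : N m' -> `|pc m'| < r /\ G (pc m') = m'.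
Proof.
move=> /(graph_surj gG)[y yr Gy].
suff -> : pc m' = y by [].
rewrite /pc -Gy (graph_eq gG yr) addrAC subrr add0r.
have [h0 h1 _] := plane_coord_frame (y 0 0) (y 0 1) (phi y) (graph_frame gG).
by rewrite [LHS]pt2_eta h0 h1 -pt2_eta.
Qed.

Lemma plane_coord_lip (B : 'M[R]_3) : exists2 K : R, 0 < K &
  forall u, `|plane_coord B u| <= K * `|u|.
Proof.
have [L LE] := plane_coord_mulmx B.
exists (3%:R * `|L| + 1); first by rewrite ltr_wpDl// mulr_ge0.
move=> u; rewrite LE.
by rewrite (le_trans (mulmx_norm_le _ _))// ler_wpM2r// lerDl.
Qed.

Lemma plane_coordB (B : 'M[R]_3) u u' :
  plane_coord B u - plane_coord B u' = plane_coord B (u - u').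
Proof. by apply/rowP => j; rewrite [RHS]mxE mulmxBl !mxE. Qed.

Lemma pc_continuous (g : R -> M) (t : R) : {for t, continuous g} ->
  {for t, continuous (pc \o g)}.
Proof.
move=> cg; have [K K0 HK] := plane_coord_lip (frame v1 v2 n).
have cfg : f (g s) @[s --> t] --> f (g t).
  exact: (@continuous_comp _ _ _ g f t cg (@f_continuous R M A f hM hf (g t))).
apply/(@cvgrPdist_le _ _ _ (nbhs t)) => e e0.
have e'0 : 0 < K^-1 * e by rewrite mulr_gt0// invr_gt0.
near=> s.
rewrite /pc /= plane_coordB (le_trans (HK _))// -ler_pdivlMl//.
rewrite opprB addrA subrK.
by near: s; exact: cvgr_dist_le cfg _ e'0.
Unshelve. all: by end_near. Qed.

(** A curve whose projection stays in the domain of the graph cannot leave the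
    sheet where it starts: the sheet is open, and the limit of its points lies
    on it by separation. *)
Lemma graph_unique (g : R -> M) (a b : R) : a <= b ->
  (forall t, a <= t <= b -> {for t, continuous g}) ->
  (forall t, a <= t <= b -> `|pc (g t)| < r) -> N (g a) ->
  forall t, a <= t <= b -> g t = G (pc (g t)).
Proof.
move=> ab cg gr Na; have [hH _ _] := hM.
apply: real_induction.
- by have [_ ->] := graph_pc Na.
- move=> t /andP[ta tb] gt.
  have tab : a <= t <= b by rewrite ta ltW.
  have Nt : N (g t) by rewrite gt; apply: (graph_in gG); exact: gr.
  have : \forall s \near t, N (g s).
    by apply: (cg t tab); apply: open_nbhs_nbhs; split => //; exact: graph_open gG.
  move=> /nbhs_normP[e /= e0 He]; exists e => // s /andP[ts ste].
  have Ngs : N (g s) by apply: He; rewrite /ball_ /= ltr0_norm; lra.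
  by have [_ ->] := graph_pc Ngs.
- move=> t /andP[ta tb] H.
  have tab : a <= t <= b by rewrite tb ltW.
  have c1 : g s @[s --> t^'-] --> g t by apply: cvg_at_left_filter; exact: cg.
  have c2 : G (pc (g s)) @[s --> t^'-] --> G (pc (g t)).
    apply: cvg_at_left_filter.
    apply: (@continuous_comp _ _ _ (pc \o g) G); first exact/pc_continuous/cg.
    exact: (graph_cont gG (gr t tab)).
  have c3 : g s @[s --> t^'-] --> G (pc (g t)).
    apply: cvg_trans c2; apply: near_eq_cvg; near=> s.
    apply/esym/H; apply/andP; split; last by near: s; exact: nbhs_left_lt.
    by near: s; exact: nbhs_left_ge.
  exact: (cvg_unique hH c1 c3).
Unshelve. all: by end_near. Qed.

End GraphUnique.

(** The induced distance is fine enough to separate sheets: a short curve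
    stays above a small disk, hence in one graph chart. *)
Lemma dist_near m (U : set M) : nbhs m U -> exists2 e : R, 0 < e &
  forall m', (induced_dist A f m' m < e%:E)%E -> U m'.
Proof.
move=> Um; have [v1 [v2 [n [r [G [phi [N [Tv1 Tv2 gG]]]]]]]] := graph_at hM hf m.
have [K K0 HK] := plane_coord_lip (frame v1 v2 n).
have z0 := graph_norm0 gG.
have : nbhs (0 : 'rV[R]_2) (G @^-1` U).
  by apply: (graph_cont gG z0); rewrite (graph_base gG).
move=> /nbhs_normP[rho /= rho0 Hrho].
pose d := Num.min rho r.
have d0 : 0 < d by rewrite lt_min rho0 (graph_gt0 gG).
have e0 : 0 < d / K by rewrite divr_gt0.
exists (d / K) => // m' /ereal_inf_lt[_ [g [Cg g0 g1] <-] Hg].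
(* reversed, so that it starts at [m] *)
pose h s := g (1 - s).
have cg t : {for t, continuous g} by have [+ _] := Cg; exact.
have ch t : {for t, continuous h}.
  apply: (@continuous_comp _ _ _ (fun s : R => 1 - s) g); last exact: cg.
  by apply: cvgB; [exact: cvg_cst|exact: cvg_id].
have hd t : 0 <= t <= 1 -> `|plane_coord (frame v1 v2 n) (f (h t) - f m)| < d.
  move=> /andP[t0 t1].
  apply: (le_lt_trans (HK _)); rewrite -ltr_pdivlMl// mulrC.
  apply: norm_rV_lt => // i.
  have t01 : 0 <= 1 - t <= 1 by rewrite subr_ge0 t1 lerBlDr lerDl.
  have := curve_length_ge hM hf Cg i t01.
  rewrite /= g1 => /le_lt_trans/(_ Hg); rewrite lte_fin !mxE.
  by rewrite distrC.
have hr t : 0 <= t <= 1 -> `|plane_coord (frame v1 v2 n) (f (h t) - f m)| < r.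
  by move=> /hd /lt_le_trans; apply; rewrite ge_min lexx orbT.
have Nh0 : N (h 0).
  by rewrite /h subr0 g1 -(graph_base gG); exact: graph_in gG _ z0.
have I1 : 0 <= (1 : R) <= 1 by rewrite ler01 lexx.
have E := graph_unique gG ler01 (fun t _ => ch t) hr Nh0 I1.
have : G (plane_coord (frame v1 v2 n) (f (h 1) - f m)) = m'.
  by rewrite -E /h subrr g0.
move=> <-; apply: Hrho; rewrite /ball_ /= sub0r normrN.
by apply: (lt_le_trans (hd 1 I1)); rewrite ge_min lexx.
Qed.



(** Lifts of lines are regular enough to be measured by the induced distance. *)
Lemma lift_curve (g : R -> M) (q w : 'rV[R]_3) (a b : R) (p : R -> R) :
  (forall t, a < t < b -> {for t, continuous g} /\ f (g t) = q + t *: w) ->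
  Ck_on 1 setT p -> (forall s, a < p s < b) -> Ck_curve A 1 setT (g \o p).
Proof.
move=> Hg Cp pab.
have cp s : {for s, continuous p} by exact: (Ck_on0 (Ck_on_leq (leqnSn 0) Cp)).
have cgp s : {for s, continuous (g \o p)}.
  by apply: continuous_comp; [exact: cp|exact: (Hg _ (pab s)).1].
split=> // c Ac; apply: Ck_on_local => s [_ ds].
have [v1 [v2 [n [r [G [phi [N [Tv1 Tv2 gG]]]]]]]] := graph_at hM hf (g (p s)).
have [d0 [d1 [nu wE]]] := frame_span w (graph_frame gG).
have z0 := graph_norm0 gG.
have gl : \forall t \near p s, f (g t) = q + t *: (d0 *: v1 + d1 *: v2 + nu *: n).
  by rewrite -wE; exact: line_near Hg (pab s).
have := graph_follow gG z0 (esym (graph_base gG)) (Hg _ (pab s)).1 gl.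
pose y (t : R) : 'rV[R]_2 := pt2 ((t - p s) * d0) ((t - p s) * d1).
move=> Hy.
have Hy' : \forall t \near p s, `|y t| < r /\ g t = G (y t).
  by apply: filterS Hy => t; rewrite /y !mxE !add0r => -[].
have Hs : \forall u \near s, `|y (p u)| < r /\ g (p u) = G (y (p u)).
  exact: (cp s _ Hy').
pose U : set R := [set u | `|y (p u)| < r /\ g (p u) = G (y (p u))]^°.
have oU : open U by exact: open_interior.
have UP u : U u -> `|y (p u)| < r /\ g (p u) = G (y (p u)).
  by move=> /interior_subset.
have Cy : Ck_on 1 U (y \o p).
  have aff d : Ck_on 1 U (fun u => (p u - p s) * d).
    apply: (Ck_onM oU); last exact: Ck_on_cst.
    apply: (Ck_onB oU); last exact: Ck_on_cst.
    exact: (Ck_on_sub _ Cp).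
  exact: (@Ck_on_pt2 R 1 U _ _ oU (aff d0) (aff d1)).
have [_ C] := graph_curve_Ck hM gG (isT : (0 <= 1)%N) oU Cy (fun u Uu => (UP u Uu).1).
have oV : open (U `&` (g \o p) @^-1` dom c).
  have [od _ _ _ _] := chartP hM Ac.
  rewrite openE => u [Uu du]; apply: filterI; first exact: open_nbhs_nbhs.
  by apply: (cgp u); apply: open_nbhs_nbhs.
exists (U `&` (g \o p) @^-1` dom c); first exact: oV.
split; first by split; [exact: Hs|exact: ds].
apply: (Ck_on_eq oV _ (Ck_on_sub _ (C c Ac))).
  by move=> u [Uu _]; rewrite /= (UP u Uu).2.
by move=> u [Uu du]; split => //; move: du; rewrite /= (UP u Uu).2.
Qed.
End Completeness.

(** * End points of lifted segments *)

Section Smoothstep.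
Context {R : realType}.

(** The curves measured by the induced distance are defined on the whole line,
    but lifts are not: this function maps the line onto the unit interval,
    fixing 0 and 1. *)
Definition smoothstep (s : R) : R :=
  (2 * s * (1 + s * s)^-1) * (2 * s * (1 + s * s)^-1).

Let den_gt0 (s : R) : 0 < 1 + s * s.
Proof. by rewrite ltr_wpDr// -expr2 sqr_ge0. Qed.

Lemma smoothstep0 : smoothstep 0 = 0.
Proof. by rewrite /smoothstep mulr0 !mul0r. Qed.

Lemma smoothstep1 : smoothstep 1 = 1.
Proof. by rewrite /smoothstep; field. Qed.

Lemma smoothstep_bound s : 0 <= smoothstep s <= 1.
Proof.
rewrite /smoothstep -expr2 sqr_ge0/=.
have d0 := den_gt0 s.
rewrite exprMn exprVn ler_pdivrMr ?exprn_gt0// mul1r.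
have := sqr_ge0 (1 - s * s); rewrite !expr2; nra.
Qed.

Lemma smoothstep_C1 k : Ck_on k setT smoothstep.
Proof.
have C : Ck_on k setT (fun s : R => 2 * s * (1 + s * s)^-1).
  apply: (Ck_onM openT).
    by apply: (Ck_onM openT); [exact: Ck_on_cst|exact: Ck_on_id].
  apply: (Ck_onV openT); first by move=> s _; rewrite gt_eqF.
  apply: (Ck_onD openT); first exact: Ck_on_cst.
  by apply: (Ck_onM openT); exact: Ck_on_id.
exact: (Ck_onM openT C C).
Qed.

Lemma smoothstep_derive (s : R) : 0 <= s <= 1 ->
  exists2 k : R, `|k| <= 8 & is_derive s (1 : R) smoothstep k.
Proof.
move=> /andP[s0 s1]; have d0 := den_gt0 s.
pose D := 1 + s * s.
have dD : is_derive s (1 : R) (fun s : R => 1 + s * s) (2 * s).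
  by apply: is_derive_eq; rewrite /GRing.scale /=; ring.
have Dn : D != 0 by rewrite gt_eqF.
have dV : is_derive s (1 : R) (fun s : R => (1 + s * s)^-1) (- D ^- 2 * (2 * s)).
  have [dd <-] := dD; apply: DeriveDef; first exact: derivableV.
  exact: deriveV.
exists (8 * s * (1 - s * s) / D ^+ 3).
  have D1 : 1 <= D by rewrite lerDl -expr2 sqr_ge0.
  have ss : s * s <= 1 by rewrite mulr_ile1.
  rewrite ger0_norm; last by rewrite divr_ge0 ?exprn_ge0 ?mulr_ge0 ?subr_ge0// ltW.
  rewrite ler_pdivrMr ?exprn_gt0//.
  apply: (@le_trans _ _ (8 * 1)); last by rewrite ler_wpM2l// exprn_ege1.
  rewrite -mulrA ler_wpM2l// mulr_ile1// ?subr_ge0// lerBlDr lerDl.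
  by rewrite -expr2 sqr_ge0.
have dk : is_derive s (1 : R) (fun s : R => 2 * s * (1 + s * s)^-1)
    (2 * (1 - s * s) / D ^+ 2).
  have d2 : is_derive s (1 : R) (fun s : R => 2 * s) 2.
    by apply: is_derive_eq; rewrite /GRing.scale /=; ring.
  apply: (is_derive_eq (is_deriveM d2 dV)).
  by rewrite /GRing.scale /= -/D /D; field; rewrite gt_eqF.
apply: (is_derive_eq (is_deriveM dk dk)).
by rewrite /GRing.scale /= -/D /D; field; rewrite gt_eqF.
Qed.

End Smoothstep.
Section LiftLimit.
Context {R : realType} {M : topologicalType}.
Context (A : set (chart R M)) (f : M -> 'rV[R]_3).
Context (hM : C2_2manifold A) (hf : C2_immersion A f).
Context (g : R -> M) (q w : 'rV[R]_3) (a T : R).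
Hypothesis Hg : forall t, a < t < T -> {for t, continuous g} /\ f (g t) = q + t *: w.

(** The factor 16 is 8, the bound on the derivative of the smooth step, times 2
    for the comparison of the Euclidean norm with the sup norm. *)
Lemma lift_dist t t' : a < t < T -> a < t' < T ->
  (induced_dist A f (g t) (g t') <= (16 * `|t' - t| * `|w|)%:E)%E.
Proof.
move=> /andP[at_ tT] /andP[at' t'T].
pose p s := t + (t' - t) * smoothstep s.
have Cp : Ck_on 1 setT p.
  apply: (Ck_onD openT); first exact: Ck_on_cst.
  by apply: (Ck_onM openT); [exact: Ck_on_cst|exact: smoothstep_C1].
have pab s : a < p s < T.
  have /andP[s0 s1] := smoothstep_bound s.
  have -> : p s = t + (t' - t) * smoothstep s by [].
  have -> : t + (t' - t) * smoothstep s = (1 - smoothstep s) * t + smoothstep s * t' by ring.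
  by case: (leP t t') => tt; apply/andP; split; nra.
have Cgp := lift_curve hM hf Hg Cp pab.
apply: (@le_trans _ _ (curve_length f (g \o p))).
  apply: ereal_inf_lbound; exists (g \o p) => //; split => //=.
    by rewrite /p smoothstep0 mulr0 addr0.
  by rewrite /p smoothstep1 mulr1 addrC subrK.
apply: (curve_length_le hM hf Cgp) => s s01.
have [k k8 dk] := smoothstep_derive s01.
have -> : derive1 (f \o (g \o p)) s = ((t' - t) * k) *: w.
  have -> : f \o (g \o p) = (fun s => q + p s *: w).
    by apply/funext => u; rewrite /= (Hg (pab u)).2.
  rewrite derive1E.
  have dp : is_derive s (1 : R) p ((t' - t) * k).
    by apply: is_derive_eq; rewrite /GRing.scale /=; ring.
  have dpw : is_derive s (1 : R) (fun s => q + p s *: w) (((t' - t) * k) *: w).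
    have [/derivable1_diffP dp1 dp2] := dp.
    have dZ : is_derive s (1 : R) (fun s => p s *: w) (((t' - t) * k) *: w).
      apply: DeriveDef.
        by apply: diff_derivable; exact: differentiableZl.
      by rewrite deriveE ?diffZl -?deriveE ?dp2//; exact: differentiableZl.
    have := is_deriveD (is_derive_cst q s (1 : R)) dZ.
    by rewrite add0r.
  by have [_ ->] := dpw.
apply: (le_trans (euclidean_le_norm _)); rewrite normrZ normrM.
have w0 := normr_ge0 w; have tt := normr_ge0 (t' - t).
have : `|t' - t| * `|k| * `|w| <= `|t' - t| * 8 * `|w|.
  by rewrite ler_wpM2r// ler_wpM2l.
lra.
Qed.

Hypotheses (hcompl : complete_surface A f) (aT : a < T).

(** Completeness gives a limit along a sequence of times, since the induced
    distance along a lift is controlled by the time; near the limit the whole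
    lift stays in one sheet. *)
Lemma lift_limit : exists m, g t @[t --> T^'-] --> m /\ f m = q + T *: w.
Proof.
pose d := (T - a) / 2.
have d0 : 0 < d by rewrite divr_gt0// subr_gt0.
pose u (i : nat) := T - d / i.+1%:R.
have uT i : a < u i < T.
  have i1 : 1 <= i.+1%:R :> R by rewrite ler1n.
  have i0 : 0 < d / i.+1%:R by rewrite divr_gt0.
  have : d / i.+1%:R <= d by rewrite ler_pdivrMr ?ler_peMr// ltW.
  rewrite /u; set x := d / _ in i0 *; move: i0 aT; rewrite /d => *.
  by apply/andP; split; lra.
have ucv : u i @[i --> \oo] --> T.
  rewrite -[X in _ --> X]subr0 -[X in _ - X](mulr0 d).
  apply: cvgB; first exact: cvg_cst.
  by apply: cvgMl_tmp; exact: cvg_harmonic.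
have [m Hm] : exists m : M, forall e : R, 0 < e -> exists N, forall i, (N <= i)%N ->
    (induced_dist A f (g (u i)) m < e%:E)%E.
  apply: hcompl => e e0.
  pose k := e / (64 * (`|w| + 1)).
  have w1 : 0 < `|w| + 1 by rewrite ltr_wpDl.
  have k0 : 0 < k by rewrite divr_gt0// mulr_gt0.
  have [N _ HN] : \forall i \near \oo, `|T - u i| < k by exact: cvgr_dist_lt ucv _ k0.
  exists N => i j Ni Nj; apply: (le_lt_trans (lift_dist (uT i) (uT j))).
  rewrite lte_fin.
  have hi := HN i Ni; have hj := HN j Nj; rewrite /= in hi hj.
  have hij : `|u j - u i| <= 2 * k.
    have -> : u j - u i = (T - u i) - (T - u j) by ring.
    by apply: (le_trans (ler_normB _ _)); move: hi hj; lra.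
  apply: (@le_lt_trans _ _ (16 * (2 * k) * (`|w| + 1))).
    by apply: ler_pM; rewrite ?mulr_ge0// ?ler_wpM2l// lerDl.
  have -> : 16 * (2 * k) * (`|w| + 1) = e / 2 by rewrite /k; field; rewrite gt_eqF.
  by move: e0; lra.
have um : g (u i) @[i --> \oo] --> m.
  move=> U /(dist_near hM hf)[e e0 He].
  have [N HN] := Hm e e0; exists N => // i Ni.
  by apply: He; exact: HN.
have fmE : f m = q + T *: w.
  have c1 : f (g (u i)) @[i --> \oo] --> f m.
    by apply: continuous_cvg; [exact: (@f_continuous R M A f hM hf m)|exact: um].
  have c2 : f (g (u i)) @[i --> \oo] --> q + T *: w.
    have -> : (fun i => f (g (u i))) = (fun i => q + u i *: w).
      by apply/funext => i; rewrite (Hg (uT i)).2.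
    by apply: cvgD; [exact: cvg_cst|exact: cvgZr_tmp].
  exact: (cvg_unique _ c1 c2).
exists m; split => //.
have [v1 [v2 [n [r [G [phi [N [Tv1 Tv2 gG]]]]]]]] := graph_at hM hf m.
pose B := frame v1 v2 n.
have [K K0 HK] := plane_coord_lip B.
have r0 := graph_gt0 gG.
have w1 : 0 < `|w| + 1 by rewrite ltr_wpDl.
pose de := r / (K * (`|w| + 1)).
have de0 : 0 < de by rewrite divr_gt0// mulr_gt0.
have Nm : nbhs m N.
  apply: open_nbhs_nbhs; split; first exact: graph_open gG.
  by rewrite -(graph_base gG); exact: graph_in gG _ (graph_norm0 gG).
have [i [Ni ui]] : exists i, N (g (u i)) /\ `|T - u i| < de.
  have h1 : \forall i \near \oo, N (g (u i)) by exact: um.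
  have h2 : \forall i \near \oo, `|T - u i| < de by exact: cvgr_dist_lt ucv _ de0.
  by have [i _ Hi] := filterI h1 h2; exists i; exact: (Hi i (leqnn i)).
have /andP[aui uiT] := uT i.
pose pc t := plane_coord B ((t - T) *: w).
have pcE t : u i <= t < T -> plane_coord B (f (g t) - f m) = pc t.
  move=> /andP[ut tT]; rewrite (Hg _).2 ?(lt_le_trans aui ut)// fmE.
  by rewrite /pc; congr plane_coord; apply/rowP => j; rewrite !mxE; ring.
have pcr t : u i <= t < T -> `|pc t| < r.
  move=> /andP[ut tT]; apply: (le_lt_trans (HK _)); rewrite normrZ.
  have tl : `|t - T| < de.
    rewrite distrC ger0_norm ?subr_ge0 ?(ltW tT)//.
    move: ui; rewrite ger0_norm ?subr_ge0 ?(ltW uiT)// => /(le_lt_trans _); apply.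
    by rewrite lerD2l lerN2.
  have : `|t - T| * `|w| <= `|t - T| * (`|w| + 1) by rewrite ler_wpM2l// lerDl.
  move=> h; rewrite -ltr_pdivlMl//; apply: (le_lt_trans h).
  rewrite -ltr_pdivlMr// (_ : _ / _ = de)//.
  by rewrite /de; field; rewrite !gt_eqF.
have gE t : u i <= t < T -> g t = G (pc t).
  move=> /andP[ut tT].
  have su s : u i <= s <= t -> u i <= s < T.
    by move=> /andP[-> st]; exact: le_lt_trans tT.
  have it : u i <= t <= t by rewrite ut lexx.
  rewrite (graph_unique hM hf gG ut _ _ Ni it) ?pcE ?ut//.
    by move=> s /su /andP[us sT]; apply: (Hg _).1; rewrite sT (lt_le_trans aui us).
  by move=> s /su h; rewrite pcE//; exact: pcr.
have [L LE] := plane_coord_mulmx B.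
have cpc : {for T, continuous (G \o pc)}.
  apply: continuous_comp; last first.
    apply: (graph_cont gG); rewrite /pc subrr scale0r LE mul0mx normr0.
    exact: graph_gt0 gG.
  have -> : pc = (fun t => (t - T) *: (w *m L)).
    by apply/funext => t; rewrite /pc LE scalemxAl.
  apply: cvgZr_tmp; apply: cvgB; [exact: cvg_id|exact: cvg_cst].
have : G (pc t) @[t --> T^'-] --> m.
  have <- : G (pc T) = m.
    by rewrite /pc subrr scale0r -[RHS](graph_base gG); rewrite LE mul0mx.
  exact: (cvg_at_left_filter cpc).
apply: cvg_trans; apply: near_eq_cvg; near=> t.
apply/esym/gE; apply/andP; split; last by near: t; exact: nbhs_left_lt.
by near: t; exact: nbhs_left_ge.
Unshelve. all: by end_near. Qed.


End LiftLimit.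

(** * Continuation of lifts *)

Section Continuation.
Context {R : realType} {M : topologicalType}.
Context (A : set (chart R M)) (f : M -> 'rV[R]_3).
Context (hM : C2_2manifold A) (hf : C2_immersion A f).

(** Locally both lifts are read off from the same graph chart, so that they
    cannot branch. *)
Lemma lift_unique (g1 g2 : R -> M) (q w : 'rV[R]_3) (t0 T : R) :
  (forall t, t0 <= t < T -> {for t, continuous g1} /\ \forall s \near t, f (g1 s) = q + s *: w) ->
  (forall t, t0 <= t < T -> {for t, continuous g2} /\ \forall s \near t, f (g2 s) = q + s *: w) ->
  g1 t0 = g2 t0 -> forall t, t0 <= t < T -> g1 t = g2 t.
Proof.
move=> H1 H2 E0 t /andP[t0t tT]; have [hH _ _] := hM.
suff : forall s, t0 <= s <= t -> g1 s = g2 s by apply; rewrite t0t lexx.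
have inT s : s <= t -> t0 <= s -> t0 <= s < T.
  by move=> st ->; exact: le_lt_trans tT.
apply: real_induction => //.
- move=> s /andP[t0s st] E; have sin := inT s (ltW st) t0s.
  have [v1 [v2 [n [r [G [phi [N [Tv1 Tv2 gG]]]]]]]] := graph_at hM hf (g1 s).
  have [a [b [c wE]]] := frame_span w (graph_frame gG).
  have [c1 l1] := H1 s sin; have [c2 l2] := H2 s sin; rewrite wE in l1 l2.
  have F1 := graph_follow gG (graph_norm0 gG) (esym (graph_base gG)) c1 l1.
  have E' : g2 s = G 0 by rewrite -E (graph_base gG).
  have F2 := graph_follow gG (graph_norm0 gG) E' c2 l2.
  have : \forall u \near s, g1 u = g2 u.
    by apply: filterS2 F1 F2 => u [_ -> _] [_ -> _].
  move=> /nbhs_normP[e /= e0 He].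
  exists e => // u /andP[su use]; apply: He.
  by rewrite /ball_ /= distrC ger0_norm ?subr_ge0 ?(ltW su)// ltrBlDl.
- move=> s /andP[t0s st] H; have sin := inT s st (ltW t0s).
  have l1 : g1 u @[u --> s^'-] --> g1 s by apply: cvg_at_left_filter; exact: (H1 s sin).1.
  have l2 : g2 u @[u --> s^'-] --> g2 s by apply: cvg_at_left_filter; exact: (H2 s sin).1.
  apply: (cvg_unique hH l1); apply: cvg_trans l2; apply: near_eq_cvg; near=> u.
  apply/esym/H; apply/andP; split; last by near: u; exact: nbhs_left_lt.
  by near: u; exact: nbhs_left_ge.
Unshelve. all: by end_near. Qed.

Section Lift.
Context (S : M -> Prop) (q w : 'rV[R]_3) (a : R).

(** [S] is a property of the points that the continuation has to carry along.
    For characteristic lines it is nonsingularity, which fails where the line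
    crosses a singular point, whence a dense set of times. *)
Definition dense_lift (T : R) (g : R -> M) :=
  (forall t, a < t < T -> {for t, continuous g} /\ f (g t) = q + t *: w) /\
  (forall t1 t2, 0 < t1 -> t1 < t2 -> t2 < T -> exists2 t, t1 < t < t2 & S (g t)).

Hypothesis hcompl : complete_surface A f.
Hypothesis a0 : a < 0.
Hypothesis ext : forall T g m, 0 < T -> dense_lift T g -> g t @[t --> T^'-] --> m ->
  f m = q + T *: w -> exists2 e : R, 0 < e & exists2 h : R -> M, h 0 = m &
  (forall s, `|s| < e -> {for s, continuous h} /\ f (h s) = f m + s *: w) /\
  (forall s, 0 < s < e -> S (h s)).

Lemma glue_continuous (g h : R -> M) T m : g t @[t --> T^'-] --> m -> h 0 = m ->
  {for 0, continuous h} ->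
  {for T, continuous (fun t => if t < T then g t else h (t - T))}.
Proof.
move=> gm h0 ch U /=; rewrite ltxx subrr h0 => Um.
have hU : \forall s \near (0 : R), U (h s) by apply: ch; rewrite h0.
have gU : \forall t \near T^'-, U (g t) by exact: gm.
have : \forall t \near T, t < T -> U (g t) by [].
have cT : t - T @[t --> T] --> (0 : R).
  by rewrite -[X in _ --> X](subrr T); apply: cvgB; [exact: cvg_id|exact: cvg_cst].
have : \forall t \near T, U (h (t - T)) by exact: cT _ hU.
by apply: filterS2 => t H1 H2 /=; case: ltP => // /H2.
Qed.

Lemma lift_extend T g : 0 < T -> dense_lift T g ->
  exists2 e : R, 0 < e & exists g', (forall t, t < T -> g' t = g t) /\ dense_lift (T + e) g'.
Proof.
move=> T0 Hg; have aT : a < T by apply: lt_trans T0.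
have [m [gm fm]] := lift_limit hM hf Hg.1 hcompl aT.
have [e e0 [h h0 [Hh Sh]]] := ext T0 Hg gm fm.
exists e => //; exists (fun t => if t < T then g t else h (t - T)).
split; first by move=> t ->.
have z0 : `|0 : R| < e by rewrite normr0.
split=> [t /andP[at_ tT]|t1 t2 t10 t12 t2T].
  case: (ltrgtP t T) => [tlt|tgt|tE].
  - split; last by have [_ ->] := Hg.1 t ltac:(by rewrite at_ tlt).
    have c := (Hg.1 t ltac:(by rewrite at_ tlt)).1.
    rewrite /prop_for /continuous_at tlt; apply: cvg_trans c; apply: near_eq_cvg.
    have tin : t \in `]a, T[ by rewrite in_itv/= at_ tlt.
    by apply: filterS (near_in_itvoo tin) => s; rewrite in_itv/= => /andP[_ ->].
  - have tTe : `|t - T| < e by rewrite gtr0_norm ?subr_gt0// ltrBlDl.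
    have [c fl] := Hh _ tTe; split; last first.
      by rewrite fl fm -addrA -scalerDl (addrC T) subrK.
    have ct : {for t, continuous (fun t => h (t - T))}.
      apply: (@continuous_comp _ _ _ (fun t : R => t - T) h); last exact: c.
      by apply: cvgB; [exact: cvg_id|exact: cvg_cst].
    rewrite /prop_for /continuous_at ltNge (ltW tgt) /=.
    apply: cvg_trans ct; apply: near_eq_cvg.
    have tin : t \in `]T, t + 1[ by rewrite in_itv/= tgt ltrDl ltr01.
    by apply: filterS (near_in_itvoo tin) => s; rewrite in_itv/= => /andP[/ltW Ts _]; rewrite ltNge Ts.
  - split; first by rewrite tE; apply: (glue_continuous gm h0); exact: (Hh 0 z0).1.
    by rewrite tE subrr h0 fm.
case: (ltP t1 T) => t1T.
  have [||t /andP[h1 h2] St] := Hg.2 t1 (Num.min t2 ((t1 + T) / 2)) t10.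
  - by rewrite lt_min t12; lra.
  - by rewrite gt_min; apply/orP; right; lra.
  move: h2; rewrite lt_min => /andP[h2 h3].
  have tT : t < T by apply: lt_trans h3 _; lra.
  by exists t; rewrite ?h1 ?h2// tT.
exists ((t1 + t2) / 2); first by apply/andP; split; lra.
rewrite ltNge (_ : (T <= (t1 + t2) / 2) = true)/=; last by lra.
by apply: Sh; apply/andP; split; lra.
Qed.

(** A lift that can be pushed past every end point has no last time: its pieces
    agree by uniqueness and glue together. *)
Theorem lift_continuation T0 g0 B : 0 < T0 -> dense_lift T0 g0 -> T0 <= B ->
  exists g, (forall t, t < T0 -> g t = g0 t) /\ dense_lift B g.
Proof.
move=> T0p Hg0 T0B.
pose P T := exists g, (forall t, t < T0 -> g t = g0 t) /\ dense_lift T g.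
suff : forall T, T0 <= T <= B -> P T by apply; rewrite T0B lexx.
apply: real_induction; first by exists g0.
  move=> T /andP[T0T _] [g [gE Hg]].
  have [e e0 [g' [g'E Hg']]] := lift_extend (lt_le_trans T0p T0T) Hg.
  exists e => // T' /andP[TT' T'e]; exists g'; split.
    by move=> t tT0; rewrite g'E ?gE//; exact: lt_le_trans T0T.
  split=> [t /andP[at_ tT]|t1 t2 t10 t12 t2T].
    by apply: Hg'.1; rewrite at_ (lt_trans tT).
  by apply: Hg'.2 => //; exact: lt_trans T'e.
move=> T /andP[T0T _] H.
have H' T' : exists g, T0 <= T' < T -> (forall t, t < T0 -> g t = g0 t) /\ dense_lift T' g.
  have [/H[g Hg]|nT] := pselect (T0 <= T' < T); first by exists g.
  by exists g0 => /nT.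
have [G HG] := choice H'.
(* the partial lifts agree, so that the diagonal is a lift *)
pose mid t := Num.max T0 ((t + T) / 2).
have midP t : t < T -> T0 <= mid t < T /\ t < mid t.
  move=> tT; rewrite /mid le_max lexx gt_max T0T /= lt_max; split; first by lra.
  by apply/orP; right; lra.
have Geq T1 T2 t : T0 <= T1 < T -> T0 <= T2 < T -> t < T1 -> t < T2 -> G T1 t = G T2 t.
  move=> h1 h2 t1 t2; have [E1 D1] := HG T1 h1; have [E2 D2] := HG T2 h2.
  have [tT0|tT0] := ltP t T0; first by rewrite E1 ?E2.
  have hT0 : 0 < T0 := T0p.
  have in_a s T' : 0 <= s < Num.min T1 T2 -> Num.min T1 T2 <= T' -> a < s < T'.
    by move=> /andP[s0 sT] h; rewrite (lt_le_trans a0 s0) (lt_le_trans sT h).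
  apply: (@lift_unique _ _ q w 0 (Num.min T1 T2)).
  - move=> s /in_a h; have {}h : a < s < T1 by apply: h; rewrite ge_min lexx.
    by split; [exact: (D1.1 s h).1|exact: line_near D1.1 h].
  - move=> s /in_a h; have {}h : a < s < T2 by apply: h; rewrite ge_min lexx orbT.
    by split; [exact: (D2.1 s h).1|exact: line_near D2.1 h].
  - by rewrite E1 ?E2.
  - by rewrite (le_trans (ltW T0p) tT0) lt_min t1.
exists (fun t => G (mid t) t); split.
  by move=> t tT0; have [h _] := midP t (lt_trans tT0 T0T); exact: (HG _ h).1.
have near_mid t : t < T -> \forall s \near t, s < mid t.
  by move=> tT; have [_ h] := midP t tT; apply: open_nbhs_nbhs; split => //; exact: open_lt.
split=> [t /andP[at_ tT]|t1 t2 t10 t12 t2T].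
  have [h1 h2] := midP t tT.
  have := (HG _ h1).2.1 t ltac:(by rewrite at_ h2) => -[c fl]; split => //.
  rewrite /prop_for /continuous_at; apply: cvg_trans c; apply: near_eq_cvg.
  near=> s; have sm : s < mid t by near: s; exact: near_mid.
  have sT : s < T by apply: lt_trans sm _; case/andP: h1.
  by have [h3 h4] := midP s sT; exact: Geq.
have [h1 h2] := midP t2 t2T.
have [t /andP[h3 h4] St] := (HG _ h1).2.2 t1 t2 t10 t12 h2.
exists t; first by rewrite h3.
have tT := lt_trans h4 t2T.
have [h5 h6] := midP t tT.
by rewrite (Geq (mid t) (mid t2))//; exact: lt_trans h2.
Unshelve. all: by end_near. Qed.

End Lift.
End Continuation.

(** * Completeness of characteristic lines *)

Section CharacteristicComplete.
Context {R : realType} {M : topologicalType}.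
Context (A : set (chart R M)) (f : M -> 'rV[R]_3).
Context (hM : C2_2manifold A) (hf : C2_immersion A f).
Context (hmin : p_minimal A f) (hcompl : complete_surface A f).

Notation T := (tangent_plane A f).

Lemma plane_coord_near (B : 'M[R]_3) m : plane_coord B (f m' - f m) @[m' --> m] --> (0 : 'rV[R]_2).
Proof.
have [L LE] := plane_coord_mulmx B.
have cfm : f m' - f m @[m' --> m] --> f m - f m.
  by apply: cvgB; [exact: (@f_continuous R M A f hM hf m)|exact: cvg_cst].
rewrite subrr in cfm.
have -> : (fun m' => plane_coord B (f m' - f m)) = (fun m' => mulmxr L (f m' - f m)).
  by apply/funext => m'; exact: LE.
have L0 : mulmxr L (0 : 'rV[R]_3) = 0 by exact: mul0mx.
rewrite -[X in _ --> X]L0.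
exact: (cvg_comp (fun m' => f m' - f m) (mulmxr L) cfm (@mulmxr_continuous _ _ _ _ 0)).
Qed.

(** The contact form evaluated on a moving tangent vector is continuous. *)
Lemma nonsingular_near m : ~ singular A f m -> \forall m' \near m, ~ singular A f m'.
Proof.
move=> /(nonsingularP hM hf)[v Tv Thv].
have vn : v != 0.
  by apply: contraNneq Thv => ->; rewrite Theta0.
have [v2 [n [Tv2 uB]]] := tangent_basis hM hf Tv vn.
have [r [G [phi [N gG]]]] := local_graph hM hf Tv Tv2 uB.
pose k y := Theta (f (G y)) (v + 'D_('e_0) phi y *: n).
have z0 := graph_norm0 gG.
have k0 : k 0 != 0.
  rewrite /k (graph_base gG).
  have -> : 'D_('e_0) phi 0 = 0.
    apply: (etrans (deriveE _ (graph_differentiable gG z0))).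
    exact: (graph_diff0 gG Tv Tv2).
  by rewrite scale0r addr0.
have ck : {for (0 : 'rV[R]_2), continuous k}.
  exact: (Ck_on0 (graph_velocity_Ck 'e_0 v gG) z0).
have kn : \forall y \near (0 : 'rV[R]_2), k y != 0.
  by apply: (ck [set x : R | x != 0]); apply: open_nbhs_nbhs; split => //; exact: open_neq.
have Nm : \forall m' \near m, N m'.
  apply: open_nbhs_nbhs; split; first exact: graph_open gG.
  by rewrite -(graph_base gG); exact: graph_in gG _ z0.
have kn' : \forall m' \near m, k (plane_coord (frame v v2 n) (f m' - f m)) != 0.
  exact: (@plane_coord_near _ m _ kn).
apply: filterS2 Nm kn' => m' /(graph_pc gG)[].
move: (plane_coord _ _) => y yr <- ky.
apply/(nonsingularP hM hf); exists (v + 'D_('e_0) phi y *: n); last exact: ky.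
apply/(graph_tangent gG yr); exists (pt2 1 0).
rewrite !pt2E scale0r addr0 scale1r.
have E := diff_pt2 (pt2 1 0) (graph_differentiable gG yr).
by rewrite !pt2E scale0r addr0 scale1r in E; rewrite E.
Qed.

Section Line.
Context (q w : 'rV[R]_3) (a : R).
Hypotheses (Thq : Theta q w = 0) (wn : w != 0) (a0 : a < 0).

Let S m := ~ singular A f m.

(** At a singular limit point the lift is an arriving null line of the plane
    field; density of its nonsingular times makes the zero transversal, and
    the null line departs on the other side at height zero over the contact
    plane, that is along the same straight line. *)
Lemma extend_singular t1 g m : 0 < t1 -> dense_lift f S q w a t1 g ->
  g t @[t --> t1^'-] --> m -> f m = q + t1 *: w -> singular A f m ->
  exists2 e : R, 0 < e & exists2 h : R -> M, h 0 = m &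
  (forall s, `|s| < e -> {for s, continuous h} /\ f (h s) = f m + s *: w) /\
  (forall s, 0 < s < e -> S (h s)).
Proof.
move=> t10 [Hg Dg] gm fm sm.
have Thm : Theta (f m) w = 0 by rewrite fm Theta_line.
have [v2 [n [r [G [phi [U [p [k [c [d]]]]]]]]]] := singular_plane_field hM hf hmin sm Thm wn.
set N := _ + _ => -[Tw Tv2 gG HF ThE].
have r0 := graph_gt0 gG.
have Um : nbhs m U.
  apply: open_nbhs_nbhs; split; first exact: graph_open gG.
  by rewrite -(graph_base gG); exact: graph_in gG _ (graph_norm0 gG).
have [t0 [t0_gt0 t0t1 t0r Ut]] : exists t0 : R,
    [/\ 0 < t0, t0 <= t1, t0 <= r & forall t, 0 < t < t0 -> U (g (t1 - t))].
  have : \forall t \near t1, t < t1 -> U (g t) by exact: gm.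
  move=> /nbhs_normP[d' /= d'0 Hd'].
  exists (Num.min d' (Num.min t1 r)); rewrite !ge_min !lexx ?orbT; split=> //.
    by rewrite !lt_min d'0 t10.
  move=> t /andP[t_0]; rewrite !lt_min => /andP[td' _].
  apply: Hd'; last by rewrite ltrBlDr ltrDl.
  by rewrite /ball_ /= opprB addrCA subrr addr0 gtr0_norm.
have n0r : `|0 : R| < r by rewrite normr0.
have gE t : 0 < t < t0 -> [/\ `|- t| < r, g (t1 - t) = G (pt2 (- t) 0),
    phi (pt2 (- t) 0) = 0 & field1 phi N (- t) 0 = 0].
  move=> /andP[t_0 tt0]; have t01 : 0 < t < t0 by rewrite t_0.
  have tr : `|- t| < r by rewrite normrN gtr0_norm// (lt_le_trans tt0).
  have tin : a < t1 - t < t1.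
    by apply/andP; split; move: a0 t_0 tt0 t0t1 => *; lra.
  have [y yr Gy] := graph_surj gG (Ut t t01).
  have [cg fg] := Hg _ tin.
  have E : f (G y) = f m + (- t *: w + 0 *: v2 + 0 *: n).
    by rewrite Gy fg fm !scale0r !addr0 scalerDl addrA.
  have [yE py] := graph_coord_eq gG yr E; rewrite yE in Gy py yr.
  split => //.
  have Tg : T (g (t1 - t)) w := line_tangent hM hf Hg tin.
  move: Tg; rewrite -Gy => /(graph_tangent gG yr)[d' wE].
  have wE' : 1 *: w + 0 *: v2 + 0 *: n = d' 0 0 *: w + d' 0 1 *: v2 + 'd phi (pt2 (- t) 0) d' *: n.
    by rewrite -wE !scale0r !addr0 scale1r.
  have [d0 d1 dn] := frame_coord_inj (graph_frame gG) wE'.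
  have d'E : d' = pt2 1 0 by rewrite [d']pt2_eta -d0 -d1.
  have := ThE (- t) 0 1 0 tr n0r.
  rewrite -d'E -dn !scale0r !addr0 scale1r mulr1 mulr0 addr0 Gy fg => <-.
  by rewrite Theta_line.
have arr t : 0 < t < t0 -> field1 phi N (- t) 0 = 0 by move=> /gE[].
have dense s1 s2 : 0 < s1 -> s1 < s2 -> s2 < t0 ->
    exists2 t, s1 < t < s2 & field2 phi N (- t) 0 <> 0.
  move=> s10 s12 s2t.
  have [|||u /andP[u1 u2] Su] := Dg (t1 - s2) (t1 - s1).
  - by rewrite subr_gt0 (lt_le_trans s2t).
  - by rewrite ltrD2l ltrN2.
  - by rewrite ltrBlDr ltrDl.
  pose t := t1 - u.
  have tE : u = t1 - t by rewrite /t opprB addrC subrK.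
  have ts : s1 < t < s2 by rewrite /t; apply/andP; split; move: u1 u2; lra.
  exists t => // F20; apply: Su.
  have t01 : 0 < t < t0.
    by move: ts => /andP[h1 h2]; rewrite (lt_trans s10 h1) (lt_trans h2 s2t).
  have [tr gt _ F10] := gE t t01.
  have yr : `|pt2 (- t) 0| < r by exact: pt2_norm_lt.
  rewrite tE gt; apply: contrapT => /(nonsingularP hM hf)[v].
  move=> /(graph_tangent gG yr)[d' ->].
  have -> : 'd phi (pt2 (- t) 0) d' = 'd phi (pt2 (- t) 0) (pt2 (d' 0 0) (d' 0 1)).
    by rewrite -pt2_eta.
  have -> := ThE (- t) 0 (d' 0 0) (d' 0 1) tr n0r.
  by rewrite F10 F20 !mul0r addr0 eqxx.
have c0 := arrival_transversal HF t0_gt0 arr dense.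
have [e e0 He] := departure HF t0_gt0 arr c0.
pose e1 := Num.min e t0.
have e10 : 0 < e1 by rewrite lt_min e0.
have e1r s : - e1 < s < e1 -> `|s| < r.
  by rewrite -ltr_norml => h; rewrite (lt_le_trans h)// (le_trans _ t0r)// ge_min lexx orbT.
have F10 s : - e1 < s < e1 -> field1 phi N s 0 = 0.
  move=> /andP[s1 s2]; case: (ltrgtP s 0) => [sn|sp|->]; last by case: (pf_zero HF).
    rewrite -[s]opprK; apply: arr; rewrite oppr_gt0 sn ltrNl (le_lt_trans _ s1)//.
    by rewrite lerN2 ge_min lexx orbT.
  by apply: (He s _).1; rewrite sp (lt_le_trans s2)// ge_min lexx.
have phi0 s : - e1 < s < e1 -> phi (pt2 s 0) = 0.
  move=> /andP[s1 s2]; transitivity (phi (0 + pt2 s 0)); first by rewrite add0r.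
  transitivity (phi 0); last exact: graph_phi0 gG.
  have line u : 0 <= u <= 1 -> - e1 < u * s < e1 /\ 0 + u *: pt2 s 0 = pt2 (u * s) 0.
    move=> /andP[u0 u1]; split; first by apply/andP; split; nra.
    by rewrite add0r; apply/rowP => i; rewrite !mxE; case: ifP; rewrite ?mulr0.
  have lr u : 0 <= u <= 1 -> `|0 + u *: pt2 s 0| < r.
    by move=> /line[/e1r us ->]; exact: pt2_norm_lt.
  apply: segment_constant => [u /lr ur|u /andP[u0 u1]].
    exact: (graph_differentiable gG ur).
  have u01 : 0 <= u <= 1 by rewrite !ltW.
  have [us uE] := line u u01.
  apply: (etrans (diff_pt2 _ (graph_differentiable gG (lr u u01)))).
  rewrite uE !pt2E scale0r addr0; have := F10 _ us.
  by rewrite /field1 mulr0 subr0 => ->; rewrite scaler0.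
exists e1 => //; exists (fun s => G (pt2 s 0)); first by rewrite pt20 (graph_base gG).
split=> [s|s /andP[s0 se]].
  rewrite ltr_norml => se; have sr := pt2_norm_lt (e1r s se) n0r; split.
    exact: (graph_axis_continuous gG sr).
  by rewrite (graph_eq gG sr) !pt2E phi0// !scale0r !addr0.
have se' : - e1 < s < e1 by rewrite se (lt_trans _ s0)// oppr_lt0.
have sr := e1r s se'; have yr := pt2_norm_lt sr n0r.
have [_ F2] := He s ltac:(by rewrite s0 (lt_le_trans se)// ge_min lexx).
apply/(nonsingularP hM hf); exists (0 *: w + 1 *: v2 + 'd phi (pt2 s 0) (pt2 0 1) *: n).
  by apply/(graph_tangent gG yr); exists (pt2 0 1); rewrite !pt2E.
by have -> := ThE s 0 0 1 sr n0r; rewrite mulr0 add0r mulr1 gt_eqF.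
Qed.

Lemma extend_nonsingular t1 g m : 0 < t1 -> dense_lift f S q w a t1 g ->
  g t @[t --> t1^'-] --> m -> f m = q + t1 *: w -> S m ->
  exists2 e : R, 0 < e & exists2 h : R -> M, h 0 = m &
  (forall s, `|s| < e -> {for s, continuous h} /\ f (h s) = f m + s *: w) /\
  (forall s, 0 < s < e -> S (h s)).
Proof.
move=> t10 [Hg _] gm fm nm.
have Thm : Theta (f m) w = 0 by rewrite fm Theta_line.
have Tm : T m w := line_limit_tangent hM hf (lt_trans a0 t10) Hg gm.
have [e e0 [h h0 Hh]] := nonsingular_lift hM hf hmin nm Tm Thm wn.
have z0 : - e < 0 < e by rewrite oppr_lt0 e0.
have : \forall s \near (0 : R), S (h s).
  by apply: (Hh 0 z0).1; rewrite h0; exact: nonsingular_near.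
move=> /nbhs_normP[e' /= e'0 He'].
exists (Num.min e e'); first by rewrite lt_min e0.
exists h => //; split=> s.
  by rewrite lt_min => /andP[se _]; apply: Hh; rewrite -ltr_norml.
rewrite lt_min => /and3P[s0 se se']; apply: He'.
by rewrite /ball_ /= sub0r normrN gtr0_norm.
Qed.

End Line.

(** Characteristic lines are complete: p-minimality continues them past regular
    end points, and the analysis of the plane field past singular ones. *)
Theorem characteristic_line m w B : ~ singular A f m -> T m w ->
  Theta (f m) w = 0 -> w != 0 ->
  exists2 a : R, a < 0 & exists2 g, g 0 = m &
    dense_lift f (fun m => ~ singular A f m) (f m) w a B g.
Proof.
move=> nm Tw Thw wn.
have [e e0 [h h0 Hh]] := nonsingular_lift hM hf hmin nm Tw Thw wn.
have z0 : - e < 0 < e by rewrite oppr_lt0 e0.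
have : \forall s \near (0 : R), ~ singular A f (h s).
  by apply: ((Hh 0 z0).1 [set m' | ~ singular A f m']); rewrite h0; exact: nonsingular_near.
move=> /nbhs_normP[e' /= e'0 He'].
pose T0 := Num.min e e'.
have T00 : 0 < T0 by rewrite lt_min e0.
have ne : - e < 0 by rewrite oppr_lt0.
have Hh' : dense_lift f (fun m => ~ singular A f m) (f m) w (- e) T0 h.
  split=> [t /andP[t1]|t1 t2 t10 t12].
    by rewrite lt_min => /andP[t2 _]; apply: Hh; rewrite t1.
  rewrite lt_min => /andP[_ t2e]; exists ((t1 + t2) / 2); first by apply/andP; split; lra.
  by apply: He'; rewrite /ball_ /= sub0r normrN gtr0_norm; lra.
have [||g [gE Hg]] := @lift_continuation R M A f hM hf _ (f m) w (- e) hcompl ne _ T0 h (Num.max B T0) T00 Hh'.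
- move=> t1 g m' t10 Hg gm' fm'; have [sm|sm] := pselect (singular A f m').
    exact: (extend_singular Thw wn ne t10 Hg gm' fm' sm).
  exact: (extend_nonsingular Thw wn ne t10 Hg gm' fm' sm).
- by rewrite le_max lexx orbT.
exists (- e) => //; exists g; first by rewrite gE.
have BB : B <= Num.max B T0 by rewrite le_max lexx.
split=> [t /andP[t1 t2]|t1 t2 t10 t12 t2B].
  by apply: Hg.1; rewrite t1 (lt_le_trans t2).
by apply: Hg.2 => //; exact: lt_le_trans BB.
Qed.

End CharacteristicComplete.

(** * The radial field of a contact plane *)

Section ContactFrame.
Context {R : realType} (p : 'rV[R]_3).
Implicit Types (q u v w : 'rV[R]_3).

(** A basis of the contact plane of [p] completed by the vertical direction.
    In this frame the third coordinate is [Theta p], the height above planes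
    parallel to the contact plane of [p]. *)
Definition hor1 : 'rV[R]_3 := row3 1 0 (yco p).
Definition hor2 : 'rV[R]_3 := row3 0 1 (- xco p).
Definition vert : 'rV[R]_3 := row3 0 0 1.

Lemma hor1E : [/\ xco hor1 = 1, yco hor1 = 0 & zco hor1 = yco p].
Proof. exact: row3E. Qed.
Lemma hor2E : [/\ xco hor2 = 0, yco hor2 = 1 & zco hor2 = - xco p].
Proof. exact: row3E. Qed.
Lemma vertE : [/\ xco vert = 0, yco vert = 0 & zco vert = 1].
Proof. exact: row3E. Qed.

Lemma co_lin (a b c : R) u v w :
  [/\ xco (a *: u + b *: v + c *: w) = a * xco u + b * xco v + c * xco w,
      yco (a *: u + b *: v + c *: w) = a * yco u + b * yco v + c * yco w &
      zco (a *: u + b *: v + c *: w) = a * zco u + b * zco v + c * zco w].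
Proof. by rewrite /xco /yco /zco !mxE. Qed.

Lemma Theta_lin q (a b c : R) u v w :
  Theta q (a *: u + b *: v + c *: w) = a * Theta q u + b * Theta q v + c * Theta q w.
Proof. by rewrite !ThetaD !ThetaZ. Qed.

Lemma Theta_hor1 : Theta p hor1 = 0.
Proof. by have [x y z] := hor1E; rewrite /Theta x y z; ring. Qed.
Lemma Theta_hor2 : Theta p hor2 = 0.
Proof. by have [x y z] := hor2E; rewrite /Theta x y z; ring. Qed.
Lemma Theta_vert q : Theta q vert = 1.
Proof. by have [x y z] := vertE; rewrite /Theta x y z; ring. Qed.

Lemma contact_frame_unit : frame hor1 hor2 vert \in unitmx.
Proof.
apply: frame_unit; have [x1 y1 z1] := hor1E; have [x2 y2 z2] := hor2E.
have [x3 y3 z3] := vertE; rewrite /det3 x1 y1 z1 x2 y2 z2 x3 y3 z3.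
by apply/eqP => h; have := @oner_neq0 R; rewrite -(subr0 1) => /eqP; apply; lra.
Qed.

Lemma contact_decomp v : v = xco v *: hor1 + yco v *: hor2 + Theta p v *: vert.
Proof.
have [x1 y1 z1] := hor1E; have [x2 y2 z2] := hor2E; have [x3 y3 z3] := vertE.
have [X Y Z] := co_lin (xco v) (yco v) (Theta p v) hor1 hor2 vert.
by apply: row3P; rewrite ?X ?Y ?Z ?x1 ?x2 ?x3 ?y1 ?y2 ?y3 ?z1 ?z2 ?z3 /Theta; ring.
Qed.

(** The radial vector field of the contact plane of [p]: it spans the
    intersection of that plane's direction with the contact plane of [q]. *)
Definition radial q := (xco q - xco p) *: hor1 + (yco q - yco p) *: hor2.

Lemma radialE q : [/\ xco (radial q) = xco q - xco p, yco (radial q) = yco q - yco p &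
  zco (radial q) = yco p * (xco q - xco p) - xco p * (yco q - yco p)].
Proof.
have [x1 y1 z1] := hor1E; have [x2 y2 z2] := hor2E.
have [X Y Z] := co_lin (xco q - xco p) (yco q - yco p) 0 hor1 hor2 0.
rewrite scaler0 addr0 mul0r !addr0 -/(radial q) x1 y1 z1 x2 y2 z2 in X Y Z.
by rewrite X Y Z; split; ring.
Qed.

Lemma Theta_radial q : Theta q (radial q) = 0.
Proof. by have [x y z] := radialE q; rewrite /Theta x y z; ring. Qed.

Lemma Theta_p_radial q : Theta p (radial q) = 0.
Proof. by have [x y z] := radialE q; rewrite /Theta x y z; ring. Qed.

Lemma radialD q u : radial (q + u) = radial q + (u - Theta p u *: vert).
Proof.
have -> : u - Theta p u *: vert = xco u *: hor1 + yco u *: hor2.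
  by rewrite {1}[u]contact_decomp addrK.
rewrite /radial; have [-> -> _] := coD q u.
by apply/rowP => i; rewrite !mxE; ring.
Qed.

Lemma radial_span q w : Theta p w = 0 -> Theta q w = 0 -> radial q != 0 ->
  exists k, w = k *: radial q.
Proof.
move=> pw qw rn; have [x y z] := radialE q.
have N0 := legendrian_xy (Theta_p_radial q) rn; rewrite x y in N0.
set X := _ - _ in x z N0 *; set Y := _ - _ in y z N0 *.
have E : X * yco w = Y * xco w.
  by move: pw qw; rewrite /Theta /X /Y => h1 h2; lra.
exists ((X * xco w + Y * yco w) / (X ^+ 2 + Y ^+ 2)).
have N0' : X ^+ 2 + Y ^+ 2 != 0 by rewrite gt_eqF.
set k := _ / _.
have kx : xco w = k * X.
  apply: (mulIf N0'); rewrite /k [RHS]mulrAC mulfVK//.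
  by have := congr1 (fun a => Y * a) E; rewrite !expr2; lra.
have ky : yco w = k * Y.
  apply: (mulIf N0'); rewrite /k [RHS]mulrAC mulfVK//.
  by have := congr1 (fun a => X * a) E; rewrite !expr2; lra.
have [kX kY kZ] := coZ k (radial q).
apply: row3P; rewrite ?kX ?kY ?kZ ?x ?y ?z //.
have -> : zco w = yco p * xco w - xco p * yco w by move: pw; rewrite /Theta; lra.
by rewrite kx ky; ring.
Qed.

(** The contact form depends on the projection of the base point only, so that
    on the vertical axis through [p] it is the one at [p]. *)
Lemma Theta_axis q v : radial q = 0 -> Theta q v = Theta p v.
Proof.
move=> r0; have [x y _] := radialE q; have [x0 y0 _] := @co0 R.
rewrite r0 x0 in x; rewrite r0 y0 in y.
rewrite /Theta; have -> : xco q = xco p by lra.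
by have -> : yco q = yco p by lra.
Qed.

End ContactFrame.

(** * Surfaces avoiding a contact plane *)

Section HalfSpace.
Context {R : realType} {M : topologicalType}.
Context (A : set (chart R M)) (f : M -> 'rV[R]_3).
Context (hM : C2_2manifold A) (hf : C2_immersion A f).
Context (hmin : p_minimal A f) (hcompl : complete_surface A f).

Notation T := (tangent_plane A f).

(** A direction that stays tangent along its own lifts sweeps out, by
    completeness, a whole line of the surface. *)
Lemma reach m0 w :
  (forall m t, f m = f m0 + t *: w -> T m w ->
    exists2 e : R, 0 < e & exists2 h, h 0 = m &
    forall s, - e < s < e -> {for s, continuous h} /\ f (h s) = f m + s *: w) ->
  T m0 w -> exists m, f m = f m0 + w.
Proof.
move=> loc Tw.
have [|e e0 [h h0 Hh]] := loc m0 0 _ Tw; first by rewrite scale0r addr0.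
have ne : - e < 0 by rewrite oppr_lt0.
have Hh' : dense_lift f (fun=> True) (f m0) w (- e) e h.
  by split=> // t1 t2 _ t12 _; exists ((t1 + t2) / 2) => //; apply/andP; split; lra.
have [||g [gE Hg]] := @lift_continuation R M A f hM hf (fun=> True) (f m0) w (- e) hcompl ne _ e h (Num.max 2 e) e0 Hh'.
- move=> t1 g m t10 [Hg _] gm fm.
  have Tm : T m w := line_limit_tangent hM hf (lt_trans ne t10) Hg gm.
  have [e' e'0 [h' h'0 Hh'']] := loc m t1 fm Tm.
  exists e' => //; exists h' => //; split=> // s se; apply: Hh''.
  by rewrite -ltr_norml.
- by rewrite le_max lexx orbT.
exists (g 1); have [_ ->] := Hg.1 1 ltac:(by rewrite lt_max ltr1n/= (lt_trans ne)).
by rewrite scale1r.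
Qed.

Context (p : 'rV[R]_3).
Hypothesis side : forall m, Theta p (f m) <> zco p.

(** The height is affine along a characteristic line, which is complete in both
    directions; if it were not constant it would take the forbidden value. *)
Lemma Theta_char m w : ~ singular A f m -> T m w -> Theta (f m) w = 0 -> Theta p w = 0.
Proof.
move=> nm Tw Thw; apply: contrapT => /eqP pw.
have wn : w != 0.
  by apply: contraNneq pw => ->; rewrite Theta0.
have key s : s != 0 -> 0 < s * (zco p - Theta p (f m)) / Theta p w -> False.
  move=> s0; set t := _ / _ => t0.
  have Ts := tangentZ hM hf s^-1 Tw.
  have Ths : Theta (f m) (s^-1 *: w) = 0 by rewrite ThetaZ Thw mulr0.
  have sn : s^-1 *: w != 0 by rewrite scaler_eq0 invr_eq0 negb_or s0.
  have [a a0 [g g0 [Hg _]]] := characteristic_line hM hf hmin hcompl (t + 1) nm Ts Ths sn.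
  have [|_] := Hg t; first by rewrite (lt_trans a0 t0)/= ltrDl ltr01.
  move=> E; apply: (side (m := g t)); rewrite E ThetaD !ThetaZ /t; field.
  by rewrite pw s0.
have h0 : zco p - Theta p (f m) != 0 by rewrite subr_eq0; apply/eqP => /esym; exact: side.
have q0 : (zco p - Theta p (f m)) / Theta p w != 0 by rewrite mulf_neq0// invr_eq0.
case: (ltrgtP ((zco p - Theta p (f m)) / Theta p w) 0) => [qn|qp|/eqP]; last by rewrite (negbTE q0).
  by apply: (key (-1)); rewrite ?oppr_eq0 ?oner_eq0// mulN1r mulNr oppr_gt0.
by apply: (key 1); rewrite ?oner_eq0// mul1r.
Qed.

Lemma tangent_legendrian m : exists w, [/\ T m w, Theta (f m) w = 0 & w != 0].
Proof.
have [v1 [v2 [n [r [G [phi [N [Tv1 Tv2 gG]]]]]]]] := graph_at hM hf m.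
have [t1|t1] := eqVneq (Theta (f m) v1) 0.
  exists v1; split => //; apply/eqP => v10.
  have E : 1 *: v1 + 0 *: v2 + 0 *: n = 0 *: v1 + 0 *: v2 + 0 *: n.
    by rewrite !scale0r !addr0 v10 scaler0.
  by have [/eqP] := frame_coord_inj (graph_frame gG) E; rewrite oner_eq0.
exists ((- Theta (f m) v2) *: v1 + Theta (f m) v1 *: v2); split.
- by apply: (tangentD hM hf); exact: (tangentZ hM hf).
- by rewrite ThetaD !ThetaZ; ring.
apply/eqP => v0.
have E : (- Theta (f m) v2) *: v1 + Theta (f m) v1 *: v2 + 0 *: n = 0 *: v1 + 0 *: v2 + 0 *: n.
  by rewrite v0 !scale0r !addr0.
by have [_ E1 _] := frame_coord_inj (graph_frame gG) E; rewrite E1 eqxx in t1.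
Qed.

(** A characteristic direction is horizontal both at its point and, by
    [Theta_char], at [p]; away from the axis only the radial direction
    is. *)
Lemma radial_tangent m : T m (radial p (f m)).
Proof.
have [sm|nm] := pselect (singular A f m); first by rewrite sm; exact: Theta_radial.
have [r0|rn] := eqVneq (radial p (f m)) 0; first by rewrite r0; exact: (tangent0 f hM m).
have [w [Tw Thw wn]] := tangent_legendrian m.
have [k wE] := radial_span (Theta_char nm Tw Thw) Thw rn.
have k0 : k != 0 by apply: contraNneq wn => k0; rewrite wE k0 scale0r.
have -> : radial p (f m) = k^-1 *: w by rewrite wE scalerK.
exact: (tangentZ hM hf).
Qed.

Lemma frame_unit_outside m v1 v2 n u : T m v1 -> T m v2 -> frame v1 v2 n \in unitmx ->
  ~ T m u -> frame v1 v2 u \in unitmx.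
Proof.
move=> Tv1 Tv2 uB nT; have [a [b [c uE]]] := frame_span u uB.
have c0 : c != 0.
  apply/eqP => c0; apply: nT; apply/(tangent_span hM hf Tv1 Tv2 uB).
  by exists a, b; rewrite uE c0 scale0r addr0.
rewrite -row_free_unit; apply: inj_row_free => v; rewrite mul_frame uE => E.
have E' : (v 0 0 + v 0 ord_max * a) *: v1 + (v 0 1 + v 0 ord_max * b) *: v2 +
    (v 0 ord_max * c) *: n = 0 *: v1 + 0 *: v2 + 0 *: n.
  rewrite !scale0r !addr0 -E; apply/rowP => i; rewrite !mxE; ring.
have [E0 E1 /eqP] := frame_coord_inj uB E'.
rewrite mulf_eq0 (negbTE c0) orbF => /eqP E2; rewrite E2 !mul0r !addr0 in E0 E1.
by apply: row3P; rewrite /xco /yco /zco mxE.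
Qed.

(** Along the ray of the graph in the direction [v], the radial vectors are
    multiples of the horizontal part of [v]; by continuity that part is tangent
    at the base point, and so would be the vertical part if it were nonzero. *)
Lemma axis_flat m v : radial p (f m) = 0 -> ~ T m vert -> T m v -> Theta p v = 0.
Proof.
move=> ax nv Tv.
have [->|vn] := eqVneq v 0; first exact: Theta0.
have [v2 [n [Tv2 uB]]] := tangent_basis hM hf Tv vn.
have {}uB := frame_unit_outside Tv Tv2 uB nv.
have [r [G [phi [N gG]]]] := local_graph hM hf Tv Tv2 uB.
have r0 := graph_gt0 gG; have z0 := graph_norm0 gG.
have n0r : `|0 : R| < r by rewrite normr0.
have near_dir (s : R) : 0 < s < r -> T (G (pt2 s 0)) (v - Theta p v *: vert).
  move=> /andP[s0 sr]; have yr : `|pt2 s 0| < r by apply: pt2_norm_lt => //; rewrite gtr0_norm.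
  have := radial_tangent (G (pt2 s 0)).
  rewrite (graph_eq gG yr) radialD ax add0r !pt2E Theta_lin Theta_vert mul0r addr0 mulr1.
  have -> : s *: v + 0 *: v2 + phi (pt2 s 0) *: vert -
      (s * Theta p v + phi (pt2 s 0)) *: vert = s *: (v - Theta p v *: vert).
    by apply/rowP => i; rewrite !mxE; ring.
  have sn : s != 0 by rewrite gt_eqF.
  move=> H; set u := v - _; have <- : s^-1 *: (s *: u) = u by exact: scalerK.
  exact: (tangentZ hM hf _ H).
have cG : G (pt2 s 0) @[s --> (0 : R)^'+] --> m.
  have c : {for (0 : R), continuous (fun s : R => G (pt2 s 0))}.
    by apply: (graph_axis_continuous gG); rewrite pt20.
  rewrite -(graph_base gG) -[X in G X](@pt20 R).
  exact: (cvg_at_right_filter c).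
have : T m (v - Theta p v *: vert).
  apply: (@tangent_closed R M A f hM hf R ((0 : R)^'+) _ (fun s => G (pt2 s 0)) m _ cG).
  near=> s; apply: near_dir; apply/andP; split; first by near: s; exact: nbhs_right_gt.
  by near: s; exact: nbhs_right_lt.
move=> /(tangentZ hM hf (-1)) /(tangentD hM hf Tv).
rewrite scaleN1r opprB addrC subrK => Tt.
apply/eqP/negPn/negP => t0; apply: nv.
have <- : (Theta p v)^-1 *: (Theta p v *: vert) = vert :> 'rV[R]_3 by exact: scalerK.
exact: (tangentZ hM hf).
Unshelve. all: by end_near. Qed.

(** In a vertical graph over the axis the function [phi] vanishes on the axis:
    the radial vector at [(s, 0)] is [phi (s, 0)] times the transverse vector
    [n], of which only the zero multiple is tangent. *)
Lemma axis_vertical m k : radial p (f m) = 0 -> k != 0 -> T m (k *: vert) ->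
  exists2 e : R, 0 < e & exists2 h, h 0 = m &
    forall s, - e < s < e -> {for s, continuous h} /\ f (h s) = f m + s *: (k *: vert).
Proof.
set w := k *: vert => ax k0 Tw.
have pw : Theta p w = k by rewrite /w ThetaZ Theta_vert mulr1.
have wn : w != 0.
  by apply: contraNneq k0 => w0; rewrite -pw w0; rewrite Theta0.
have [v0 [n0 [Tv0 uB0]]] := tangent_basis hM hf Tw wn.
pose v := v0 - (Theta p v0 / k) *: w; pose n := n0 - (Theta p n0 / k) *: w.
have pv u : Theta p (u - (Theta p u / k) *: w) = 0.
  by rewrite -scaleNr ThetaD ThetaZ pw; field.
have Tv : T m v by rewrite /v -scaleNr; apply: (tangentD hM hf) => //; exact: (tangentZ hM hf).
have uB : frame w v n \in unitmx.
  rewrite -row_free_unit; apply: inj_row_free => u; rewrite mul_frame => E.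
  have E' : (u 0 0 - u 0 1 * (Theta p v0 / k) - u 0 ord_max * (Theta p n0 / k)) *: w +
      u 0 1 *: v0 + u 0 ord_max *: n0 = 0 *: w + 0 *: v0 + 0 *: n0.
    rewrite !scale0r !addr0 -E; apply/rowP => i; rewrite !mxE; ring.
  have [E0 E1 E2] := frame_coord_inj uB0 E'; rewrite E1 E2 !mul0r !subr0 in E0.
  by apply: row3P; rewrite /xco /yco /zco mxE.
have [r [G [phi [N gG]]]] := local_graph hM hf Tw Tv uB.
have r0 := graph_gt0 gG; have z0 := graph_norm0 gG.
have n0r : `|0 : R| < r by rewrite normr0.
have phi0 s : `|s| < r -> phi (pt2 s 0) = 0.
  move=> sr; have yr := pt2_norm_lt sr n0r.
  have := radial_tangent (G (pt2 s 0)).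
  rewrite (graph_eq gG yr) radialD ax add0r !pt2E Theta_lin !pv !mulr0 !addr0 pw.
  have -> : s *: w + 0 *: v + phi (pt2 s 0) *: n - (s * k) *: vert =
     0 *: w + 0 *: v + phi (pt2 s 0) *: n.
    by rewrite !scale0r add0r !addr0 /w scalerA addrAC subrr add0r.
  move=> /(graph_tangent gG yr)[d] /(frame_coord_inj uB)[d0 d1 ->].
  have -> : d = 0 by rewrite [d]pt2_eta -d0 -d1 pt20.
  exact: linear0.
exists r => //; exists (fun s => G (pt2 s 0)); first by rewrite pt20 (graph_base gG).
move=> s; rewrite -ltr_norml => sr; have yr := pt2_norm_lt sr n0r; split.
  exact: (graph_axis_continuous gG yr).
by rewrite (graph_eq gG yr) !pt2E phi0// !scale0r !addr0.
Qed.

(** A vertical tangent plane at a point of the axis would put the whole axis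
    into the surface, including the point of height [zco p]. *)
Lemma axis_singular m : radial p (f m) = 0 -> T m = [set v | Theta p v = 0].
Proof.
move=> ax.
have nv : ~ T m vert.
  move=> Tv; pose k := zco p - Theta p (f m).
  have k0 : k != 0 by rewrite subr_eq0; apply/eqP => /esym; exact: side.
  have [|m' fm'] := @reach m (k *: vert) _ (tangentZ hM hf k Tv).
    move=> m' t fm' Tm'; apply: axis_vertical => //.
    rewrite fm' scalerA radialD ax add0r ThetaZ Theta_vert mulr1 subrr.
    by [].
  by apply: (side (m := m')); rewrite fm' ThetaD ThetaZ Theta_vert mulr1 addrC subrK.
have [v1 [v2 [n [r [G [phi [N [Tv1 Tv2 gG]]]]]]]] := graph_at hM hf m.
have s := singularP hM hf Tv1 Tv2 (graph_frame gG) _ _.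
rewrite s ?(Theta_axis _ ax) ?(axis_flat ax nv)//.
by apply/seteqP; split=> v /=; rewrite (Theta_axis _ ax).
Qed.

End HalfSpace.

(** * Points where the height is locally constant *)

Section Level.
Context {R : realType} {M : topologicalType}.
Context (A : set (chart R M)) (f : M -> 'rV[R]_3).
Context (hM : C2_2manifold A) (hf : C2_immersion A f).
Context (hmin : p_minimal A f) (hcompl : complete_surface A f).

Notation T := (tangent_plane A f).

Context (p : 'rV[R]_3).

Notation h1 := (hor1 p).
Notation h2 := (hor2 p).

Definition flat m := T m h1 /\ T m h2.

Definition level m := \forall m' \near m, Theta p (f m') = Theta p (f m).

Lemma flatP m v : flat m -> T m v <-> Theta p v = 0.
Proof.
move=> [T1 T2]; split=> [|v0].
  move=> /(tangent_span hM hf T1 T2 (contact_frame_unit p))[a [b ->]].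
  by rewrite ThetaD !ThetaZ Theta_hor1 Theta_hor2 !mulr0 addr0.
rewrite (contact_decomp p v) v0 scale0r addr0.
by apply: (tangentD hM hf); exact: (tangentZ hM hf).
Qed.

Lemma level_near m : level m -> \forall m' \near m, level m'.
Proof.
move=> lm; apply: filterS (nbhs_interior lm) => m' lm'.
have E := nbhs_singleton lm'.
by apply: filterS lm' => m'' ->.
Qed.

Lemma level_tangent m v : level m -> T m v -> Theta p v = 0.
Proof.
move=> lm Tv; have [->|vn] := eqVneq v 0.
  exact: Theta0.
have [v2 [n [Tv2 uB]]] := tangent_basis hM hf Tv vn.
have [r [G [phi [N gG]]]] := local_graph hM hf Tv Tv2 uB.
have z0 := graph_norm0 gG; have n0r := normr0 R.
have Cl : Ck_on 1 setT (fun u : R => pt2 u (0 : R)).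
  exact: (@Ck_on_pt2 R 1 setT _ _ openT (@Ck_on_id R R 1 setT) (Ck_on_cst 1 setT (0 : R))).
have dl : differentiable (fun u : R => pt2 u (0 : R)) 0 by have [+ _] := Cl; exact.
have p00 : `|pt2 0 0| < r by rewrite pt20.
have := is_derive_comp_curve dl (graph_differentiable gG p00).
set k := 'd phi _ _; have {k} -> : k = 0.
  by rewrite /k pt20; exact: (graph_diff0 gG Tv Tv2).
move=> dphi.
have d1 : is_derive (0 : R) (1 : R) (fun s : R => Theta p (f m) + (s * Theta p v + phi (pt2 s 0) * Theta p n)) (Theta p v).
  by apply: is_derive_eq; rewrite /GRing.scale /=; ring.
have c0 : {for (0 : R), continuous (fun u : R => pt2 u (0 : R))}.
  exact: (Ck_on0 Cl Logic.I).
have [_ <-] := d1.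
transitivity ('D_1 (cst (Theta p (f m))) (0 : R)); last exact: derive_cst.
apply: near_eq_derive.
have cG : {for (0 : R), continuous (G \o (fun u : R => pt2 u (0 : R)))}.
  by apply: continuous_comp; [exact: c0|exact: (graph_cont gG p00)].
have H1 : \forall s \near (0 : R), Theta p (f (G (pt2 s 0))) = Theta p (f m).
  by apply: (cG [set m' | Theta p (f m') = Theta p (f m)]); rewrite /= pt20 (graph_base gG).
have H2 : \forall s \near (0 : R), `|s| < r.
  exact: (@nbhs0_lt R (R : normedModType R) _ (graph_gt0 gG)).
apply: filterS2 H1 H2 => s E sr.
have yr : `|pt2 s 0| < r by apply: pt2_norm_lt => //; rewrite normr0; exact: graph_gt0 gG.
apply: (etrans _ E).
by rewrite (graph_eq gG yr) ThetaD Theta_lin !pt2E mul0r addr0.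
Qed.

Lemma level_flat m : level m -> flat m.
Proof.
move=> lm; have [v1 [v2 [n [r [G [phi [N [Tv1 Tv2 gG]]]]]]]] := graph_at hM hf m.
have e1 := level_tangent lm Tv1; have e2 := level_tangent lm Tv2.
have E v : Theta p v = 0 -> T m v.
  move=> v0; have [a [b [c vE]]] := frame_span v (graph_frame gG).
  have [a' [b' [c' tE]]] := frame_span (vert : 'rV[R]_3) (graph_frame gG).
  have t1 := Theta_vert p; rewrite tE Theta_lin e1 e2 !mulr0 !add0r in t1.
  move: v0; rewrite vE Theta_lin e1 e2 !mulr0 !add0r => /eqP.
  rewrite mulf_eq0 => /orP[/eqP ->|/eqP n0].
    by rewrite scale0r addr0; apply: (tangentD hM hf); exact: (tangentZ hM hf).
  by move: t1; rewrite n0 mulr0 => /esym/eqP; rewrite oner_eq0.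
by split; apply: E; [exact: Theta_hor1|exact: Theta_hor2].
Qed.

Section FlatGraph.
Context (m : M) (r : R) (G : 'rV[R]_2 -> M) (phi : 'rV[R]_2 -> R) (N : set M).
Hypothesis gG : is_graph A f m h1 h2 vert r G phi N.

Lemma flat_graph_height y : `|y| < r -> Theta p (f (G y)) = Theta p (f m) + phi y.
Proof.
move=> yr; rewrite (graph_eq gG yr) ThetaD Theta_lin Theta_hor1 Theta_hor2 Theta_vert.
by rewrite !mulr0 !add0r mulr1.
Qed.

Lemma flat_graph_level : (\forall y \near (0 : 'rV[R]_2), phi y = 0) -> level m.
Proof.
move=> phi0.
have Nm : \forall m' \near m, N m'.
  apply: open_nbhs_nbhs; split; first exact: graph_open gG.
  by rewrite -(graph_base gG); exact: graph_in gG _ (graph_norm0 gG).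
have kn : \forall m' \near m, phi (plane_coord (frame h1 h2 vert) (f m' - f m)) = 0.
  exact: (@plane_coord_near R M A f hM hf _ m _ phi0).
apply: filterS2 Nm kn => m' /(graph_pc gG)[].
by move: (plane_coord _ _) => y yr <- y0; rewrite flat_graph_height// y0 addr0.
Qed.

(** The axis is seen at the parameter [- c], and the radial vector of the graph
    at [y] has the parameters [c + y]: tangency makes [phi] constant on the
    rays issued from [- c]. *)
Lemma flat_graph_ray (hr : forall m, T m (radial p (f m))) y (s : R) :
  let c := pt2 (xco (f m) - xco p) (yco (f m) - yco p) in
  0 <= s <= 1 -> (forall u, 0 <= u <= s -> `|y - u *: (c + y)| < r) ->
  phi (y - s *: (c + y)) = phi y.
Proof.
move=> c /andP[s0 s1] H.
have H' u : 0 <= u <= 1 -> `|y + u *: - (s *: (c + y))| < r.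
  move=> /andP[u0 u1]; rewrite scalerN scalerA; apply: H.
  by rewrite mulr_ge0//= ler_piMl.
apply: segment_constant => // [u us|u /andP[u0 u1]].
  exact: (graph_differentiable gG (H' u us)).
have {H'} := H' u ltac:(by rewrite !ltW); set z := y + _ => zr.
have us1 : u * s != 1 by rewrite lt_eqF// (le_lt_trans _ u1)// ler_piMr// ltW.
have cz : c + z = (1 - u * s) *: (c + y).
  by rewrite /z; apply/rowP => i; rewrite !mxE; ring.
have := hr (G z); rewrite (graph_eq gG zr) radialD Theta_lin Theta_hor1 Theta_hor2 Theta_vert.
rewrite !mulr0 !add0r mulr1 addrK /radial.
have -> : (xco (f m) - xco p) *: h1 + (yco (f m) - yco p) *: h2 +
    (z 0 0 *: h1 + z 0 1 *: h2) = (c + z) 0 0 *: h1 + (c + z) 0 1 *: h2 + 0 *: vert.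
  rewrite [(c + z) 0 0]mxE [(c + z) 0 1]mxE !pt2E.
  by apply/rowP => i; rewrite !mxE; ring.
move=> /(graph_tangent gG zr)[d] /(frame_coord_inj (graph_frame gG))[d0 d1].
have -> : d = (1 - u * s) *: (c + y) by rewrite -cz [d]pt2_eta -d0 -d1 -pt2_eta.
have [L LE] : exists L : {linear 'rV[R]_2 -> R}, forall v, 'd phi z v = L v.
  by exists ('d phi z).
rewrite !LE linearN linearZ [L (s *: _)]linearZ /= => /esym/eqP.
rewrite scaler_eq0 subr_eq0 eq_sym (negbTE us1) /= => /eqP ->.
by rewrite scaler0 oppr0.
Qed.

End FlatGraph.

Lemma flat_graph m : flat m -> exists r G phi N, is_graph A f m h1 h2 vert r G phi N.
Proof. by move=> [T1 T2]; exact: (local_graph hM hf T1 T2 (contact_frame_unit p)). Qed.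

Lemma level_everywhere : (forall m, flat m) -> forall m, level m.
Proof.
move=> fl m; have [r [G [phi [N gG]]]] := flat_graph (fl m).
apply: (flat_graph_level gG).
have := @nbhs0_lt R ('rV[R]_2 : normedModType R) _ (graph_gt0 gG).
apply: filterS => y yr.
rewrite -(graph_phi0 gG) -[in LHS](add0r y).
have zr u : 0 <= u <= 1 -> `|0 + u *: y| < r.
  move=> /andP[u0 u1]; rewrite add0r normrZ (ger0_norm u0) (le_lt_trans _ yr)//.
  by rewrite ler_piMl.
apply: segment_constant => // [u /zr ur|u /andP[u0 u1]].
  exact: (graph_differentiable gG ur).
have ur := zr u ltac:(by rewrite !ltW).
have fz := fl (G (0 + u *: y)).
have : T (G (0 + u *: y)) (y 0 0 *: h1 + y 0 1 *: h2 + 'd phi (0 + u *: y) y *: vert).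
  by apply/(graph_tangent gG ur); exists y.
move=> /(flatP _ fz); rewrite Theta_lin Theta_hor1 Theta_hor2 Theta_vert.
by rewrite !mulr0 !add0r mulr1.
Qed.

Hypothesis side : forall m, Theta p (f m) <> zco p.

Let hr m : T m (radial p (f m)).
Proof. exact: radial_tangent. Qed.

(** At a point of the axis the rays start at the point itself. *)
Lemma level_axis m : radial p (f m) = 0 -> level m.
Proof.
move=> ax; have Tm := axis_singular hM hf hmin hcompl side ax.
have fl : flat m by split; rewrite Tm; [exact: Theta_hor1|exact: Theta_hor2].
have [r [G [phi [N gG]]]] := flat_graph fl; apply: (flat_graph_level gG).
have := @nbhs0_lt R ('rV[R]_2 : normedModType R) _ (graph_gt0 gG).
apply: filterS => y yr.
have [x0 y0 _] := radialE p (f m); have [x00 y00 _] := @co0 R.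
rewrite ax x00 in x0; rewrite ax y00 in y0.
have c0 : pt2 (xco (f m) - xco p) (yco (f m) - yco p) = 0 by rewrite -x0 -y0 pt20.
have := @flat_graph_ray m r G phi N gG hr y 1; rewrite /= c0 add0r scale1r subrr => <-.
- exact: graph_phi0 gG.
- by rewrite ler01 lexx.
move=> u /andP[u0 u1].
have -> : y - u *: y = (1 - u) *: y by rewrite scalerBl scale1r.
rewrite normrZ ger0_norm ?subr_ge0// (le_lt_trans _ yr)// ler_piMl// lerBlDr lerDl//.
Qed.

End Level.

(** * The tangent planes are parallel to the contact plane *)

Section Conclusion.
Context {R : realType} {M : topologicalType}.
Context (A : set (chart R M)) (f : M -> 'rV[R]_3).
Context (hM : C2_2manifold A) (hf : C2_immersion A f).
Context (hmin : p_minimal A f) (hcompl : complete_surface A f).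
Context (p : 'rV[R]_3).
Hypothesis side : forall m, Theta p (f m) <> zco p.

Notation T := (tangent_plane A f).
Notation level := (level f p).
Notation flat := (flat A f p).

Let hr m : T m (radial p (f m)).
Proof. exact: (radial_tangent hM hf hmin hcompl side). Qed.

(** Moving away from the axis along a ray: the point at time [t0] is flat as a
    limit of flat points, so that the surface is a graph over the contact
    plane there; [phi] vanishes near the later point [- s *: c], and every
    parameter near 0 is joined to that neighbourhood by its ray. *)
Lemma level_back m0 (a t0 : R) (g : R -> M) : a < 0 -> 0 <= t0 < 1 ->
  (forall t, a < t < 2 -> {for t, continuous g} /\
     f (g t) = f m0 + t *: - radial p (f m0)) ->
  (forall t, t0 < t <= 1 -> level (g t)) -> level (g t0).
Proof.
move=> a0 /andP[t00 t01] Hg Hl.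
set w := - radial p (f m0) in Hg; set m := g t0.
have tin : a < t0 < 2 by apply/andP; split; lra.
have [cg fg] := Hg t0 tin.
have cgr : g t @[t --> t0^'+] --> m by apply: cvg_at_right_filter; exact: cg.
have Hr : \forall t \near t0^'+, flat (g t).
  near=> t; apply: (level_flat hM hf); apply: Hl.
  apply/andP; split; first by near: t; exact: nbhs_right_gt.
  by near: t; exact: nbhs_right_le.
have fl : flat m.
  by split; apply: (@tangent_closed R M A f hM hf R (t0^'+) _ g m _ cgr);
    apply: filterS Hr => t [].
have [r [G [phi [N gG]]]] := flat_graph hM hf fl.
apply: (flat_graph_level hM hf gG).
have [X [Y [wE cX cY]]] : exists X Y : R, [/\ w = - X *: hor1 p + - Y *: hor2 p + 0 *: vert,
    xco (f m) - xco p = (1 - t0) * X & yco (f m) - yco p = (1 - t0) * Y].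
  exists (xco (f m0) - xco p), (yco (f m0) - yco p).
  have [rx ry rz] := radialE p (f m0).
  have [x1 y1 _] := coD (f m0) (t0 *: w); have [x2 y2 _] := coZ t0 w.
  have [x3 y3 _] := coZ (-1) (radial p (f m0)); rewrite scaleN1r -/w in x3 y3.
  rewrite /m fg x1 y1 x2 y2 x3 y3 rx ry; split; last 2 first.
  - by ring.
  - by ring.
  by rewrite /w /radial; apply/rowP => i; rewrite !mxE; ring.
set c := pt2 (xco (f m) - xco p) (yco (f m) - yco p).
have gl : \forall s \near t0, f (g s) = f m0 + s *: (- X *: hor1 p + - Y *: hor2 p + 0 *: vert).
  by rewrite -wE; exact: (line_near Hg tin).
have := graph_follow gG (graph_norm0 gG) (esym (graph_base gG)) cg gl.
move=> /nbhs_normP[d /= d0 Hd].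
pose s := Num.min (d / 2) (1 / 2) : R.
have s0 : 0 < s by rewrite lt_min !divr_gt0.
have s1 : s <= 1 / 2 by rewrite ge_min lexx orbT.
have sd : s <= d / 2 by rewrite ge_min lexx.
pose t := t0 + s * (1 - t0).
have st : 0 < s * (1 - t0) by rewrite mulr_gt0// subr_gt0.
have st' : s * (1 - t0) <= s by rewrite ger_pMr// lerBlDr lerDl.
have tt : t0 < t <= 1.
  rewrite /t; apply/andP; split; first by lra.
  by have : s * (1 - t0) <= 1 * (1 - t0); [rewrite ler_wpM2r ?subr_ge0 1?ltW//; lra|lra].
have [|zr gt phit] := Hd t.
  by rewrite /ball_ /= /t opprD addrA subrr add0r normrN gtr0_norm//; lra.
have zE : pt2 ((0 : 'rV[R]_2) 0 0 + (t - t0) * - X) ((0 : 'rV[R]_2) 0 1 + (t - t0) * - Y) = - (s *: c).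
  apply/rowP => i; rewrite !mxE; case: ifP => _; rewrite /t ?cX ?cY; ring.
rewrite zE in zr gt phit; rewrite (graph_phi0 gG) mulr0 addr0 in phit.
have lt : \forall y \near - (s *: c), Theta p (f (G y)) = Theta p (f (G (- (s *: c)))).
  have := Hl t tt; rewrite gt => l.
  exact: (graph_cont gG zr l).
move: lt => /nbhs_normP[e /= e0 He].
have scr : 0 < r - `|s *: c| by rewrite subr_gt0 -normrN.
have E1 := @nbhs0_lt R ('rV[R]_2 : normedModType R) _ e0.
have E2 := @nbhs0_lt R ('rV[R]_2 : normedModType R) _ scr.
apply: filterS2 E1 E2 => y ye yr.
have zur u : 0 <= u <= s -> `|y - u *: (c + y)| < r.
  move=> /andP[u0 us].
  have -> : y - u *: (c + y) = (1 - u) *: y - u *: c.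
    by apply/rowP => i; rewrite !mxE; ring.
  apply: (le_lt_trans (ler_normB _ _)); rewrite -ltrBrDr; apply: (le_lt_trans _ (lt_le_trans yr _)).
    by rewrite normrZ ger0_norm ?ler_piMl//; lra.
  by rewrite lerD2l lerN2 !normrZ (ger0_norm u0) (gtr0_norm s0) ler_wpM2r.
have s01 : 0 <= s <= 1 by apply/andP; split; lra.
have ss : 0 <= s <= s by rewrite lexx ltW.
rewrite -(flat_graph_ray gG hr s01 zur) -/c.
have hb : ball_ Num.Def.normr (- (s *: c)) e (y - s *: (c + y)).
  rewrite /ball_ /=.
  have -> : - (s *: c) - (y - s *: (c + y)) = - ((1 - s) *: y).
    by apply/rowP => i; rewrite !mxE; ring.
  rewrite normrN normrZ ger0_norm; last by move: s1; lra.
  by rewrite (le_lt_trans _ ye)// ler_piMl// lerBlDr lerDl ltW.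
have := He _ hb.
rewrite (flat_graph_height gG (zur s ss)) (flat_graph_height gG zr) phit.
by move=> /addrI.
Unshelve. all: by end_near. Qed.

(** The radial characteristic line through [m] reaches the axis at time 1. *)
Lemma level_nonsingular m : ~ singular A f m -> level m.
Proof.
move=> nm; have [r0|rn] := eqVneq (radial p (f m)) 0.
  exact: (level_axis hM hf hmin hcompl side r0).
pose w := - radial p (f m).
have Tw : T m w by rewrite /w -scaleN1r; exact: (tangentZ hM hf).
have Thw : Theta (f m) w = 0 by rewrite /w -scaleN1r ThetaZ Theta_radial mulr0.
have wn : w != 0 by rewrite oppr_eq0.
have [a a0 [g g0 [Hg _]]] := characteristic_line hM hf hmin hcompl 2 nm Tw Thw wn.
rewrite -g0 -(subrr 1).
suff : forall s : R, 0 <= s <= 1 -> level (g (1 - s)) by apply; rewrite ler01 lexx.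
have cg t : 0 <= t <= 1 -> {for t, continuous g}.
  by move=> /andP[t0 t1]; apply: (Hg t _).1; rewrite (lt_le_trans a0)//= (le_lt_trans t1)// ltr1n.
apply: real_induction.
- rewrite subr0; apply: (level_axis hM hf hmin hcompl side).
  have [|_ ->] := Hg 1; first by rewrite (lt_trans a0)//= ltr1n.
  rewrite scale1r radialD /w -scaleN1r ThetaZ Theta_p_radial mulr0 scale0r subr0.
  by rewrite scaleN1r subrr.
- move=> s /andP[s0 s1] ls.
  have cs : {for s, continuous (fun s : R => g (1 - s))}.
    apply: (@continuous_comp _ _ _ (fun s : R => 1 - s) g).
      by apply: cvgB; [exact: cvg_cst|exact: cvg_id].
    by apply: cg; apply/andP; split; lra.
  have : \forall u \near s, level (g (1 - u)) by exact: (cs _ (level_near ls)).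
  move=> /nbhs_normP[e /= e0 He]; exists e => // u /andP[u1 u2]; apply: He.
  by rewrite /ball_ /= ltr0_norm; lra.
- move=> s /andP[s0 s1] ls.
  apply: (@level_back m a (1 - s) g a0 _ Hg); first by apply/andP; split; lra.
  move=> t /andP[t1 t2].
  have -> : t = 1 - (1 - t) by ring.
  by apply: ls; apply/andP; split; lra.
Qed.

(** Contact planes are not integrable: on an open set of singular points both
    coefficients of the plane field would vanish, and so would its curl. *)
Lemma nonsingular_dense (m : M) (U : set M) : nbhs m U -> exists2 m', U m' & ~ singular A f m'.
Proof.
move=> Um; apply: contrapT => H.
have sU m' : U m' -> singular A f m' by move=> Um'; apply: contrapT => nm; apply: H; exists m'.
have sm := sU m (nbhs_singleton Um).
pose w := row3 1 0 (yco (f m)).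
have [wx wy wz] : [/\ xco w = 1, yco w = 0 & zco w = yco (f m)] by exact: row3E.
have Thw : Theta (f m) w = 0 by rewrite /Theta wx wy wz; ring.
have wn : w != 0.
  by apply: contra_eq_neq wx => ->; have [-> _ _] := @co0 R; rewrite eq_sym oner_neq0.
have [v2 [n [r [G [phi [V [q [k [c [d]]]]]]]]]] := singular_plane_field hM hf hmin sm Thw wn.
set K := _ + _ => -[Tw Tv2 gG HF ThE].
have r0 := graph_gt0 gG.
have : nbhs (0 : 'rV[R]_2) (G @^-1` U).
  by apply: (graph_cont gG (graph_norm0 gG)); rewrite (graph_base gG).
move=> /nbhs_normP[rho /= rho0 Hrho].
have Fz a b : `|a| < Num.min rho r -> `|b| < Num.min rho r ->
    field1 phi K a b = 0 /\ field2 phi K a b = 0.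
  rewrite !lt_min => /andP[a1 a2] /andP[b1 b2].
  have yr := pt2_norm_lt a2 b2.
  have sG : singular A f (G (pt2 a b)).
    by apply: sU; apply: Hrho; rewrite /ball_ /= sub0r normrN pt2_norm_lt.
  have Z e1 e2 : field1 phi K a b * e1 + field2 phi K a b * e2 = 0.
    rewrite -(ThE a b e1 e2 a2 b2).
    suff : T (G (pt2 a b)) (e1 *: w + e2 *: v2 + 'd phi (pt2 a b) (pt2 e1 e2) *: n) by rewrite sG.
    by apply/(graph_tangent gG yr); exists (pt2 e1 e2); rewrite !pt2E.
  split; first by have := Z 1 0; rewrite mulr1 mulr0 addr0.
  by have := Z 0 1; rewrite mulr1 mulr0 add0r.
have [_ _ _ _ K0 curl _ st] := HF.
have [|D D0 HD] := st (K / 2); first by rewrite divr_gt0.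
pose e := Num.min D (Num.min rho r) / 2.
have m0 : 0 < Num.min D (Num.min rho r) by rewrite !lt_min D0 rho0.
have e0 : 0 < e by rewrite divr_gt0.
have eD : `|e| < D.
  by rewrite gtr0_norm// (@lt_le_trans _ _ (Num.min D (Num.min rho r)))// ?ge_min ?lexx// /e; lra.
have er : `|e| < Num.min rho r.
  rewrite gtr0_norm// (@lt_le_trans _ _ (Num.min D (Num.min rho r)))//; last by rewrite ge_min lexx orbT.
  by rewrite /e; lra.
have n0D : `|0 : R| < D by rewrite normr0.
have n0r : `|0 : R| < Num.min rho r by rewrite normr0 lt_min rho0.
have [F10 F20] := Fz 0 0 n0r n0r.
have [_ F2e] := Fz e 0 er n0r; have [F1e _] := Fz 0 e n0r er.
have [_ c1] := HD e 0 0 0 eD n0D n0D n0D; have [k1 _] := HD 0 e 0 0 n0D eD n0D n0D.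
rewrite F20 F2e !subr0 mulr0 addr0 sub0r normr0 addr0 normrN normrM in c1.
rewrite F10 F1e !subr0 mulr0 !add0r normr0 add0r normrN normrM in k1.
have ne : 0 < `|e| by rewrite normr_gt0 gt_eqF.
rewrite ler_pM2r// in c1; rewrite ler_pM2r// in k1.
have := ler_norm c; have := ler_norm (- k); rewrite normrN; lra.
Qed.

Lemma flat_everywhere m : flat m.
Proof.
pose F := within [set m' | ~ singular A f m'] (nbhs m).
have FF : Filter F by apply: within_filter; exact: nbhs_filter.
have PF : ProperFilter F.
  apply: (Build_ProperFilter_ex _ FF) => U; move=> /nonsingular_dense[m' Um' nm']; exists m'; exact: Um'.
have HF : \forall m' \near F, flat m'.
  have : F [set m' | ~ singular A f m'] by apply: withinT; exact: nbhs_filter.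
  apply: filterS => m' nm'; apply: (level_flat hM hf).
  exact: level_nonsingular.
have cF : (fun m' => m') m' @[m' --> F] --> m by move=> U Um; exact: (cvg_within _ Um).
by split; apply: (@tangent_closed R M A f hM hf M F PF id m _ cF);
  apply: filterS HF => m' [].
Qed.

End Conclusion.

(** * The surface is a plane *)

Section Planarity.
Context {R : realType} {M : topologicalType}.
Context (A : set (chart R M)) (f : M -> 'rV[R]_3).
Context (hM : C2_2manifold A) (hf : C2_immersion A f).
Context (hmin : p_minimal A f) (hcompl : complete_surface A f).
Context (hconn : connected [set: M]) (p : 'rV[R]_3).
Hypothesis side : forall m, Theta p (f m) <> zco p.

Lemma height_constant m0 m : Theta p (f m) = Theta p (f m0).
Proof.
have lev := level_everywhere hM hf (flat_everywhere hM hf hmin hcompl side).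
pose B := [set m' | Theta p (f m') = Theta p (f m0)].
suff BT : B = [set: M] by have : [set: M] m by []; rewrite -BT.
have opn (P : set R) : open [set m' | P (Theta p (f m'))].
  rewrite openE => m' Pm'; apply: filterS (lev m') => m'' E.
  by rewrite /= E.
apply: hconn; first by exists m0.
- by exists B; rewrite ?setTI//; exact: (opn [set x | x = Theta p (f m0)]).
exists B; rewrite ?setTI// -[B]setCK; apply: open_closedC.
exact: (opn [set x | x <> Theta p (f m0)]).
Qed.

(** The lifts of the lines of the plane through [f m] are available everywhere,
    so that they are complete. *)
Lemma plane_swept m w : Theta p w = 0 -> exists m', f m' = f m + w.
Proof.
move=> w0; have fl := flat_everywhere hM hf hmin hcompl side.
apply: (reach hM hf hcompl); last exact/(flatP hM hf _ (fl m)).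
move=> m' t _ _; have [r [G [phi [N gG]]]] := flat_graph hM hf (fl m').
have phi0 y : `|y| < r -> phi y = 0.
  move=> yr; have := flat_graph_height gG yr.
  by rewrite (height_constant m' (G y)) -[LHS]addr0 => /addrI.
pose a := xco w; pose b := yco w.
have wE : w = a *: hor1 p + b *: hor2 p.
  by rewrite {1}(contact_decomp p w) w0 scale0r addr0.
have c0 : {for (0 : R), continuous (fun s : R => pt2 (0 + s * a) (0 + s * b))}.
  exact: segment_continuous.
have z0 : pt2 (0 + 0 * a) (0 + 0 * b) = 0 by rewrite !mul0r addr0 pt20.
have : \forall s \near (0 : R), `|pt2 (0 + s * a) (0 + s * b)| < r.
  apply: (c0 [set y | `|y| < r]); rewrite z0; apply: open_nbhs_nbhs; split.
    exact: open_norm_lt.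
  exact: graph_norm0 gG.
move=> /nbhs_normP[e /= e0 He]; exists e => //.
exists (fun s => G (pt2 (0 + s * a) (0 + s * b))); first by rewrite z0 (graph_base gG).
move=> s; rewrite -ltr_norml => se.
have yr : `|pt2 (0 + s * a) (0 + s * b)| < r.
  by apply: He; rewrite /ball_ /= sub0r normrN.
split.
  apply: (@continuous_comp _ _ _ (fun s : R => pt2 (0 + s * a) (0 + s * b)) G).
    exact: segment_continuous.
  exact: (graph_cont gG yr).
rewrite (graph_eq gG yr) phi0// !pt2E !add0r scale0r addr0 wE.
by rewrite scalerDr !scalerA.
Qed.

End Planarity.

Lemma contact_plane_height {R : realType} (p : 'rV[R]_3) (k : R) :
  contact_plane (p + (k - zco p) *: vert) = [set q | Theta p q = k].
Proof.
have [vx vy vz] := @vertE R.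
have [x y z] := coD p ((k - zco p) *: vert); have [x' y' z'] := coZ (k - zco p) (vert : 'rV[R]_3).
rewrite x' y' z' vx vy vz !mulr0 !addr0 mulr1 in x y z.
apply/seteqP; split=> q; rewrite /contact_plane /= x y z /Theta => h; lra.
Qed.

Lemma parallel_translate {R : realType} (p : 'rV[R]_3) (k : R) :
  parallel (contact_plane (p + (k - zco p) *: vert)) (contact_plane p).
Proof.
exists ((k - zco p) *: vert).
have h := contact_plane_height p (zco p); rewrite subrr scale0r addr0 in h.
rewrite h contact_plane_height.
apply/seteqP; split=> [q /= qk|_ [q /= qk <-]].
  exists (q - (k - zco p) *: vert); last by rewrite subrK.
  by rewrite /= -scaleNr ThetaD ThetaZ Theta_vert mulr1 qk; ring.
by rewrite ThetaD ThetaZ Theta_vert mulr1 qk; ring.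
Qed.

Theorem theoremD (R : realType) (p : 'rV[R]_3)
    (M : topologicalType) (A : set (chart R M)) (f : M -> 'rV[R]_3)
    (hM : C2_2manifold A) (hM0 : [set: M] !=set0) (hf : C2_immersion A f)
    (hconn : connected [set: M]) (hcompl : complete_surface A f)
    (hmin : p_minimal A f)
    (hside : range f `<=` upper_halfspace p \/
             range f `<=` lower_halfspace p) :
  exists q : 'rV[R]_3,
    range f = contact_plane q /\ parallel (contact_plane q) (contact_plane p).
Proof.
have side m : Theta p (f m) <> zco p.
  have im : range f (f m) by exists m.
  by rewrite /Theta; case: hside => /(_ _ im) /=; rewrite /upper_halfspace/lower_halfspace/=; lra.
have [m0 _] := hM0.
exists (p + (Theta p (f m0) - zco p) *: vert); split; last exact: parallel_translate.
rewrite contact_plane_height; apply/seteqP; split=> [_ [m _ <-]|q /= qk].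
  exact: (height_constant hM hf hmin hcompl hconn side).
have [|m fm] := plane_swept hM hf hmin hcompl hconn side m0 (w := q - f m0).
  by rewrite -scaleN1r ThetaD ThetaZ qk mulN1r subrr.
by exists m => //; rewrite fm addrC subrK.
Qed.
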